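(* Let $n\ge1$ be an integer, $r\in[0,1)$, $p\in[1,+\infty)$ and $\beta>-1$. Then $$\sup_{\|f\|_{H^p}\le1}\big\{\mathcal{M}(f,\sigma):\ \sigma\in\mathbb{D}^n,\ \max_{\lambda\in\sigma}|\lambda|\le r\big\}\asymp\left(\frac{n}{1-r}\right)^{\frac1p}$$ with constants depending only on $p$, and $$\sup_{\|f\|_{A^p(\beta)}\le1}\big\{\mathcal{M}(f,\sigma):\ \sigma\in\mathbb{D}^n,\ \max_{\lambda\in\sigma}|\lambda|\le r\big\}\asymp\left(\frac{n}{1-r}\right)^{\frac{2+\beta}{p}}$$ with constants depending only on $p$ and $\beta$. (In each case the supremum is taken over all $f$ in the unit ball of the indicated space and all $\sigma$ as indicated.)
   Context: $\mathbb{D}=\{z\in\mathbb{C}:|z|<1\}$ and $\mathcal{H}ol(\mathbb{D})$ is the space of holomorphic functions on $\mathbb{D}$. $H^p=H^p(\mathbb{D})$ are the usual Hardy spaces with their standard norms. For $1\le p<\infty$ and $\beta>-1$, $A^p(\beta)$ consists of $f\in\mathcal{H}ol(\mathbb{D})$ with $$\|f\|_{A^p(\beta)}^p=\int_{\mathbb{D}}|f(z)|^p(1-|z|^2)^\beta\,d\mathcal{A}(z)<\infty,$$ where $\mathcal{A}$ is the normalized area measure on $\mathbb{D}$. $\mathcal{C}_n$ denotes the set of complex $n\times n$ matrices $T$ with $\|T\|\le1$, where $\|\cdot\|$ is the operator norm associated with the Hilbert norm on $\mathbb{C}^n$; $m_T$ is the (monic) minimal polynomial of $T$. For $\sigma\in\mathbb{D}^n$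 (points may be repeated), $P_\sigma$ is the monic polynomial with zero set $\sigma$, counted with multiplicities. For $f\in\mathcal{H}ol(\mathbb{D})$ and $\sigma\in\mathbb{D}^n$, $$\mathcal{M}(f,\sigma)=\sup\{\|f(T)\|:\ T\in\mathcal{C}_n,\ m_T=P_\sigma\},$$ where $f(T)$ is given by the holomorphic functional calculus (equivalently $f(T)=q(T)$ for any polynomial $q$ such that $f-q=P_\sigma h$ for some $h\in\mathcal{H}ol(\mathbb{D})$). The notation $a\asymp b$ means that there are positive constants $c_1,c_2$ (here depending only on the indicated parameters, not on $n$ and $r$) such that $c_1 b\le a\le c_2 b$. *)

(* Defs.v *)
From HB Require Import structures.
From mathcomp Require Import all_boot all_order all_algebra.
From mathcomp Require Import complex.
From mathcomp Require Import all_classical all_reals all_analysis.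

Set Implicit Arguments.
Unset Strict Implicit.
Unset Printing Implicit Defensive.

Import Order.TTheory GRing.Theory Num.Theory.
Import numFieldNormedType.Exports.

Local Open Scope classical_set_scope.
Local Open Scope complex_scope.
Local Open Scope ring_scope.

(* The library norm `|z| of z : R[i] takes its values in R[i]; absc is the
   same modulus as an element of R. *)
Definition absc (R : realType) (z : R[i]) : R := complex.Re `|z|.

Definition unit_disc (R : realType) : set R[i] := [set z | absc z < 1].

(* Derivability in the direction 1 over the field R[i] is the existence of the
   complex derivative.  Functions are total on R[i], but only their values on
   the unit disc are ever used. *)
Definition holomorphic_disc (R : realType) (f : R[i] -> R[i]) : Prop :=
  forall z : R[i], unit_disc z -> derivable (f : R[i]^o -> R[i]^o) z 1.

Definition hardy_norm (R : realType) (p : R) (f : R[i] -> R[i]) : \bar R :=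
  ereal_sup [set
    (((2 * pi)^-1)%:E *
     \int[lebesgue_measure]_(t in `[0%R, (2 * pi)%R])
       (absc (f ((s * cos t) +i* (s * sin t))) `^ p)%:E) `^ p^-1
    | s in `[0%R, 1%R[ ]%E.

Definition hardy_ball (R : realType) (p : R) : set (R[i] -> R[i]) :=
  [set f | holomorphic_disc f /\ (hardy_norm p f <= 1)%E].

(* dA = dx dy / pi, with z = w.1 + i w.2. *)
Definition bergman_norm (R : realType) (p beta : R) (f : R[i] -> R[i]) :
    \bar R :=
  (((pi^-1)%:E *
    \int[lebesgue_measure \x lebesgue_measure]_(w in
        [set w : R * R | unit_disc (w.1 +i* w.2)])
      (absc (f (w.1 +i* w.2)) `^ p *
       (1 - absc (w.1 +i* w.2) ^+ 2) `^ beta)%:E) `^ p^-1)%E.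

Definition bergman_ball (R : realType) (p beta : R) : set (R[i] -> R[i]) :=
  [set f | holomorphic_disc f /\ (bergman_norm p beta f <= 1)%E].

(* The library norm on matrices is the sup norm, hence these definitions. *)
Definition l2norm (R : realType) (n : nat) (x : 'cV[R[i]]_n) : R :=
  Num.sqrt (\sum_(i < n) absc (x i ord0) ^+ 2).

Definition opnorm (R : realType) (n : nat) (T : 'M[R[i]]_n) : R :=
  sup [set l2norm (T *m x) | x in [set x : 'cV[R[i]]_n | l2norm x <= 1]].

Definition contractions (R : realType) (n : nat) : set 'M[R[i]]_n :=
  [set T | opnorm T <= 1].

Definition poly_of_zeros (R : realType) (s : seq R[i]) : {poly R[i]} :=
  \prod_(l <- s) ('X - l%:P).

(* The polynomials q with f - q = m_T h on the unit disc for some holomorphic h;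
   when the spectrum of T lies in the disc such q exist and all of them have
   the same value at T. *)
Definition interpolants (R : realType) (n : nat)
    (f : R[i] -> R[i]) (T : 'M[R[i]]_n.+1) : set {poly R[i]} :=
  [set q | exists2 h : R[i] -> R[i], holomorphic_disc h &
     forall z, unit_disc z -> f z - q.[z] = (mxminpoly T).[z] * h z].

Definition holo_mx (R : realType) (n : nat)
    (f : R[i] -> R[i]) (T : 'M[R[i]]_n.+1) : 'M[R[i]]_n.+1 :=
  horner_mx T (xget 0 (interpolants f T)).

Definition calM (R : realType) (n : nat)
    (f : R[i] -> R[i]) (s : n.+1.-tuple R[i]) : \bar R :=
  ereal_sup [set (opnorm (holo_mx f T))%:E |
    T in [set T : 'M[R[i]]_n.+1 |
          contractions T /\ mxminpoly T = poly_of_zeros s]].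

Definition points_within (R : realType) (n : nat) (r : R) :
    set (n.-tuple R[i]) :=
  [set s : n.-tuple R[i] | forall l, l \in s -> unit_disc l /\ absc l <= r].
Arguments points_within {R} n r.

(* n.+1 is the size of the matrices and of the tuples of points, so that n = 0
   is the one-dimensional case. *)
Definition sup_calM (R : realType) (n : nat) (r : R)
    (B : set (R[i] -> R[i])) : \bar R :=
  ereal_sup [set calM f s | f in B & s in points_within n.+1 r].

(* Main.v *)
(** Upper bounds. Let [T] be a contraction with [m_T = P_s] and [f = q + P_s h],
    and put [M = n / (1 - r)]. Peeling off the Blaschke factors of [s] one at a
    time gives [|(1 - z^* T)^-1| <= 2 M] on the unit circle. For [|z| = rho] with
    [1 - rho] of the order of [1/M], put [u = (1 - T/z)^-1 x],
    [v = (1 - T/z)^-1 y] and [K(z) = <u, y> + <x, v> - <x, y>].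
    Expanding [u] along the zeros of [P_s] shows that [P_s h] contributes nothing
    to the mean of [f K] over the circle, whence [mean Re (f K) = Re <q(T) x, y>].
    Because [T] is a contraction, [K] is almost positive semidefinite, so its
    mean modulus is bounded while its supremum is at most a multiple of [M].
    From [a <= A + a^p A^(1-p)] one gets
    [|q(T)| <= C (A + M A^(1-p) mean |f|^p)] for all [A > 0]; take [A = M^(1/p)] for
    the Hardy space. For the Bergman space average over an annulus of width of
    the order of [1/M] and take [A = M^((2+beta)/p)].

    Lower bounds. Let [J] be the nilpotent shift, [T = (r + J) (1 + r J)^-1],
    [s = 1 - (1-r)/(4n)] and [f = a (1 - s z)^-k]. Then
    [(1 - s T) (1 + r J) = (1 - s r) (1 - t J)] with [1 - t <= 1/(2n)], and testing
    [f(T)] on [((1 - s r) (1 - t J))^k y], where [y_i = 'C(i + k, k) t^i], yields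
    [|f(T)| >= c a M^k]. For [k] large, [|1 - s z|^-kp] is integrated with the
    Poisson kernel on circles, and radially by an explicit primitive. *)
Require Import Defs.
From HB Require Import structures.
From mathcomp Require Import all_boot all_order all_algebra.
From mathcomp Require Import complex.
From mathcomp Require Import all_classical all_reals all_analysis.
From mathcomp Require Import measurable_realfun.
From mathcomp Require Import ring lra.

Set Implicit Arguments.
Unset Strict Implicit.
Unset Printing Implicit Defensive.

Import Order.TTheory GRing.Theory Num.Theory.
Import numFieldNormedType.Exports.

Local Open Scope classical_set_scope.
Local Open Scope complex_scope.
Local Open Scope ring_scope.

(** Functions are controlled only inside the disc, so means are taken on a circle |z| = rho < 1;
    there the kernel that reproduces q(T) is the Poisson kernel of T/rho, which need not be a
    contraction. The loss of positivity is of size (rho^-2 - 1) |u|^2. On the circle 1/z equals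
    rho^-2 times the conjugate of z, and the resolvent bound with 1 - rho <= 1/(8 M) lets u be
    compared with the resolvent taken at the conjugate of z, whose kernel is genuinely positive with
    mean |x|^2. Hence the mean bound 25 = 1 + 24, free of M, and the supremum bound 32 M; the
    constants of the upper estimates descend from these two. The only function theory behind the
    means is the mean value property for functions that are merely complex differentiable at each
    point, hence Goursat's bisection. f(T) enters only through an interpolating polynomial, whose
    contribution is computed coefficient by coefficient. In the lower bounds k is free: each k with
    k p >= 2, respectively k p >= 3 + beta, gives the same power of M, because the amplitude a
    carries a compensating power of 1 - s. *)

Lemma eq_ler (R : numDomainType) (x y : R) : x = y -> x <= y.
Proof. by move=> ->. Qed.

(** * Complex derivatives *)

Section Modulus.
Variable R : realType.
Implicit Types z w : R[i].

Lemma normc_absc z : `|z| = (absc z)%:C.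
Proof. by rewrite /absc normc_def. Qed.

Lemma absc_sqr z : absc z ^+ 2 = complex.Re z ^+ 2 + complex.Im z ^+ 2.
Proof. by rewrite /absc normc_def /= sqr_sqrtr// addr_ge0 ?sqr_ge0. Qed.

Lemma absc_ge0 z : 0 <= absc z.
Proof. by rewrite /absc normc_def /= sqrtr_ge0. Qed.

Lemma abscM z w : absc (z * w) = absc z * absc w.
Proof. by apply: complexI; rewrite rmorphM/= -!normc_absc normrM. Qed.

Lemma abscD z w : absc (z + w) <= absc z + absc w.
Proof. by rewrite -lecR rmorphD/= -!normc_absc ler_normD. Qed.

Lemma abscN z : absc (- z) = absc z.
Proof. by rewrite /absc normrN. Qed.

Lemma abscB z w : absc (z - w) = absc (w - z).
Proof. by rewrite /absc distrC. Qed.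

Lemma absc0 : absc (0 : R[i]) = 0.
Proof. by rewrite /absc normr0. Qed.

Lemma absc1 : absc (1 : R[i]) = 1.
Proof. by rewrite /absc normr1. Qed.

Lemma abscV z : absc z^-1 = (absc z)^-1.
Proof. by apply: complexI; rewrite fmorphV/= -!normc_absc normfV. Qed.

Lemma abscX z n : absc (z ^+ n) = absc z ^+ n.
Proof. by apply: complexI; rewrite rmorphXn/= -!normc_absc normrX. Qed.

Lemma absc_conj z : absc z^* = absc z.
Proof. by rewrite /absc normcJ. Qed.

Lemma absc_real (x : R) : absc x%:C = `|x|.
Proof. by rewrite /absc normc_def /= expr0n addr0 sqrtr_sqr. Qed.

Lemma absc_eq0 z : (absc z == 0) = (z == 0).
Proof.
apply/idP/idP => [/eqP h|/eqP ->]; last by rewrite absc0.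
by rewrite -normr_eq0 normc_absc h.
Qed.

Lemma absc_gt0 z : (0 < absc z) = (z != 0).
Proof. by rewrite lt_neqAle absc_ge0 andbT eq_sym absc_eq0. Qed.

Lemma normr_Re z : `|complex.Re z| <= absc z.
Proof. by have := normc_ge_Re z; rewrite normc_absc lecR. Qed.

Lemma normr_Im z : `|complex.Im z| <= absc z.
Proof.
rewrite -(ler_pXn2r (_ : 0 < 2)%N)// ?nnegrE ?absc_ge0//.
by rewrite real_normK ?num_real// absc_sqr lerDr sqr_ge0.
Qed.

Lemma absc_le z : absc z <= `|complex.Re z| + `|complex.Im z|.
Proof.
case: z => a b; have -> : a +i* b = a%:C + 'i%C * b%:C by rewrite [LHS]complexE.
apply: (le_trans (abscD _ _)); rewrite abscM !absc_real.
have -> : absc ('i%C : R[i]) = 1 by rewrite /absc normc_def/= expr0n add0r expr1n sqrtr1.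
by rewrite mul1r; simpc.
Qed.

Lemma ler_abscB z w : absc z - absc w <= absc (z - w).
Proof. by rewrite lerBlDr; apply: le_trans (abscD _ _); rewrite subrK. Qed.

Lemma mulc_conj z : z * z^* = (absc z ^+ 2)%:C.
Proof. by rewrite -sqr_normc normc_absc rmorphXn. Qed.

Lemma ReD z w : complex.Re (z + w) = complex.Re z + complex.Re w.
Proof. by case: z w => [a b] [c d]. Qed.

Lemma ReN z : complex.Re (- z) = - complex.Re z.
Proof. by case: z. Qed.

Lemma ReB z w : complex.Re (z - w) = complex.Re z - complex.Re w.
Proof. by rewrite ReD ReN. Qed.

Lemma ImD z w : complex.Im (z + w) = complex.Im z + complex.Im w.
Proof. by case: z w => [a b] [c d]. Qed.

Lemma ImN z : complex.Im (- z) = - complex.Im z.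
Proof. by case: z. Qed.

Lemma ImB z w : complex.Im (z - w) = complex.Im z - complex.Im w.
Proof. by rewrite ImD ImN. Qed.

Lemma Re_conj z : complex.Re z^* = complex.Re z.
Proof. by case: z. Qed.

Lemma ReZ (x : R) z : complex.Re (x%:C * z) = x * complex.Re z.
Proof. by case: z => a b /=; rewrite mul0r subr0. Qed.

Lemma ImZ (x : R) z : complex.Im (x%:C * z) = x * complex.Im z.
Proof. by case: z => a b /=; rewrite mul0r addr0. Qed.

Lemma Re_le_absc z : complex.Re z <= absc z.
Proof. exact: le_trans (ler_norm _) (normr_Re z). Qed.

End Modulus.

Section ComplexDerivative.
Variable R : realType.
Implicit Types (g h : R[i] -> R[i]) (z w : R[i]).

Definition cdiff g z := derivable (g : R[i]^o -> R[i]^o) z 1.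

(** Passing to the real modulus and to a full neighbourhood, [w = z] included, removes the punctured
    filter and the partial order of [R[i]] from the estimates below. *)
Lemma cdiffP g z : cdiff g z <-> exists A : R[i], forall e : R, 0 < e ->
  exists2 d : R, 0 < d & forall w, absc (w - z) < d ->
    absc (g w - g z - A * (w - z)) <= e * absc (w - z).
Proof.
split=> [dg|[A hA]].
  exists (lim ((fun h : R[i]^o => h^-1 *: ((g : R[i]^o -> R[i]^o) (h *: (1 : R[i]^o) + z) - g z)) @ 0^')).
  move=> e e0; set A := lim _.
  have /cvgrPdist_le /(_ e%:C) := (dg : cvg _).
  rewrite ltcR => /(_ e0) [d/= d0 hd].
  move: d0; rewrite ltcE /= => /andP[/eqP dI dR].
  exists (complex.Re d) => // w wd.
  have [->|wz] := eqVneq w z; first by rewrite !subrr mulr0 subr0 absc0 mulr0.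
  have wz0 : w - z != 0 by rewrite subr_eq0.
  have := hd (w - z); rewrite /ball_ /= sub0r normrN normc_absc.
  rewrite (_ : d = (complex.Re d)%:C); last by case: (d) dI => a b/= ->.
  rewrite ltcR => /(_ wd wz0).
  rewrite -/A /GRing.scale/= mulr1 subrK normc_absc lecR => H.
  rewrite (_ : g w - g z - A * (w - z) = - ((w - z) * (A - (w - z)^-1 * (g w - g z)))).
    by rewrite abscN abscM mulrC ler_wpM2r ?absc_ge0.
  by rewrite [in RHS]mulrBr mulVKf// opprB [A * _]mulrC.
apply/cvg_ex; exists A; apply/cvgrPdist_le => e; rewrite ltcE => /andP[/eqP/= eI eR].
have [d d0 hd] := hA _ eR.
exists d%:C; first by rewrite /= ltcR.
move=> h; rewrite /ball_/= sub0r normrN normc_absc ltcR => hd1 h0.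
rewrite /GRing.scale/= mulr1.
have := hd (h + z); rewrite addrK => /(_ hd1) H.
rewrite (_ : e = (complex.Re e)%:C); last by case: (e) eI => a b/= ->.
rewrite normc_absc lecR -(ler_pM2l (_ : 0 < absc h)) ?absc_gt0//.
rewrite -abscM mulrBr mulVKf// abscB [h * A]mulrC.
by rewrite [_ * complex.Re e]mulrC.
Qed.

Lemma cdiff_cst c z : cdiff (fun=> c) z.
Proof. exact: derivable_cst. Qed.

Lemma cdiff_id z : cdiff (fun w => w) z.
Proof. exact: derivable_id. Qed.

Lemma cdiffD g h z : cdiff g z -> cdiff h z -> cdiff (fun w => g w + h w) z.
Proof. exact: derivableD. Qed.

Lemma cdiffB g h z : cdiff g z -> cdiff h z -> cdiff (fun w => g w - h w) z.
Proof. exact: derivableB. Qed.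

Lemma cdiffM g h z : cdiff g z -> cdiff h z -> cdiff (fun w => g w * h w) z.
Proof. exact: derivableM. Qed.

Lemma cdiffV g z : g z != 0 -> cdiff g z -> cdiff (fun w => (g w)^-1) z.
Proof. exact: derivableV. Qed.

Lemma cdiffX g n z : cdiff g z -> cdiff (fun w => g w ^+ n) z.
Proof.
move=> dg; elim: n => [|n ih]; first exact: cdiff_cst.
under eq_fun do rewrite exprS.
exact: cdiffM.
Qed.

Lemma cdiff_horner (p : {poly R[i]}) z : cdiff (horner p) z.
Proof.
elim/poly_ind: p => [|p c ih].
  rewrite (_ : horner 0 = fun=> 0); last by apply/funext => w; rewrite horner0.
  exact: cdiff_cst.
rewrite (_ : horner _ = fun w => p.[w] * w + c%:P.[w]).
  apply: cdiffD; first exact: (cdiffM ih (@cdiff_id z)).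
  rewrite (_ : horner _ = fun=> c); last by apply/funext => w; rewrite hornerC.
  exact: cdiff_cst.
by apply/funext => w; rewrite hornerMXaddC hornerC.
Qed.

Lemma cdiff_comp_scale g (a : R[i]) z :
  cdiff g (a * z) -> cdiff (fun w => g (a * w)) z.
Proof.
have [->|a0] := eqVneq a 0.
  by under eq_fun do rewrite mul0r; move=> _; exact: cdiff_cst.
move=> /cdiffP[A hA]; apply/cdiffP; exists (A * a) => e e0.
have a1 : 0 < absc a by rewrite absc_gt0.
have [d d0 hd] := hA (e / absc a) (divr_gt0 e0 a1).
exists (d / absc a); first exact: divr_gt0.
move=> w; rewrite ltr_pdivlMr// => wd.
have := hd (a * w); rewrite -mulrBr abscM (mulrC (absc a)) => /(_ wd).
by rewrite [_ * (_ * absc a)]mulrCA divfK ?gt_eqF// mulrA [_ * e]mulrC.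
Qed.

(** Schwarz reflection. The form [ip] is conjugate-linear in its second slot, and this makes a
    resolvent taken at a conjugated point and placed there depend holomorphically on the point. *)
Lemma cdiff_conj g z : cdiff g z^* -> cdiff (fun w => (g w^*)^*) z.
Proof.
move=> /cdiffP[A hA]; apply/cdiffP; exists (A^*) => e e0.
have [d d0 hd] := hA e e0; exists d => // w wd.
have := hd w^*; rewrite -rmorphB absc_conj => /(_ wd).
rewrite (_ : _ - _ - A^* * _ = (g w^* - g z^* - A * (w - z)^*)^*) ?absc_conj//.
by rewrite !rmorphB/= rmorphM/= !rmorphB/= !conjCK.
Qed.

Lemma cdiff_continuous g z : cdiff g z -> forall e : R, 0 < e ->
  exists2 d : R, 0 < d & forall w, absc (w - z) < d -> absc (g w - g z) < e.
Proof.
move=> /cdiffP[A hA] e e0.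
have [d d0 hd] := hA 1 ltr01.
have K : 0 < 1 + absc A by rewrite ltr_pwDl// absc_ge0.
exists (Num.min d (e / (1 + absc A))); first by rewrite lt_min d0 divr_gt0.
move=> w; rewrite lt_min => /andP[/hd h1 h2].
rewrite -(subrK (A * (w - z)) (g w - g z)).
apply: le_lt_trans (abscD _ _) _.
rewrite mul1r in h1; apply: (@le_lt_trans _ _ ((1 + absc A) * absc (w - z))).
  by rewrite mulrDl mul1r abscM lerD2r.
by rewrite mulrC -ltr_pdivlMr.
Qed.

End ComplexDerivative.

(** * The mean value property *)

Section SegmentIntegral.
Variable R : realType.
Implicit Types (f g : R -> R) (a b c : R).
Notation mu := (@lebesgue_measure R).

Definition segint f a b : R := \int[mu]_(t in `[a, b]) f t.

Definition seg_cont f a b := forall t, a <= t <= b -> {for t, continuous f}.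

Lemma seg_cont_integrable f a b : seg_cont f a b ->
  mu.-integrable `[a, b] (EFin \o f).
Proof.
move=> h; apply: continuous_compact_integrable; first exact: segment_compact.
apply: continuous_in_subspaceT => t; rewrite inE/= in_itv/= => tab.
exact: h.
Qed.

Lemma segint_cst k a b : a <= b -> segint (fun=> k) a b = k * (b - a).
Proof.
move=> ab; rewrite /segint Rintegral_cst//= lebesgue_measure_itv/= lte_fin.
move: ab; rewrite le_eqVlt => /predU1P[->|ab]; first by rewrite ltxx subrr.
by rewrite ab -EFinB.
Qed.

Lemma segintD f g a b : seg_cont f a b -> seg_cont g a b ->
  segint (fun t => f t + g t) a b = segint f a b + segint g a b.
Proof. by move=> hf hg; rewrite /segint RintegralD//; exact: seg_cont_integrable. Qed.

Lemma segintB f g a b : seg_cont f a b -> seg_cont g a b ->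
  segint (fun t => f t - g t) a b = segint f a b - segint g a b.
Proof. by move=> hf hg; rewrite /segint RintegralB//; exact: seg_cont_integrable. Qed.

Lemma segintZ k f a b : seg_cont f a b ->
  segint (fun t => k * f t) a b = k * segint f a b.
Proof. by move=> hf; rewrite /segint RintegralZl//; exact: seg_cont_integrable. Qed.

Lemma eq_segint f g a b : (forall t, a <= t <= b -> f t = g t) ->
  segint f a b = segint g a b.
Proof. by move=> fg; apply: eq_Rintegral => t; rewrite inE/= in_itv/=; exact: fg. Qed.

Lemma le_segint f g a b : seg_cont f a b -> seg_cont g a b ->
  (forall t, a <= t <= b -> f t <= g t) -> segint f a b <= segint g a b.
Proof.
by move=> hf hg fg; apply: le_Rintegral => //; exact: seg_cont_integrable.
Qed.

Lemma segint_cat f a b c : a <= b -> b <= c -> seg_cont f a c ->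
  segint f a c = segint f a b + segint f b c.
Proof.
move=> ab bc hf; have ih := seg_cont_integrable hf.
have := Rintegral_itvB ih (x := b).
rewrite !bnd_simp => /(_ ab bc) /(canRL (subrK _)).
rewrite -/(segint f a c) -/(segint f a b) addrC => ->; congr (_ + _).
rewrite /segint Rintegral_itv_obnd_cbnd//.
apply: integrableS ih => //.
by apply: subset_itv; rewrite bnd_simp.
Qed.

Lemma seg_contB f g a b : seg_cont f a b -> seg_cont g a b ->
  seg_cont (fun t => f t - g t) a b.
Proof. by move=> hf hg t tab; apply: continuousB; [exact: hf|exact: hg]. Qed.

Lemma segint_close f k M a b : a <= b -> seg_cont f a b ->
  (forall t, a <= t <= b -> `|f t - k| <= M) ->
  `|segint f a b - k * (b - a)| <= M * (b - a).
Proof.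
move=> ab hf fM.
have cc x : seg_cont (fun=> x) a b by move=> t _; exact: cvg_cst.
rewrite ler_distl -!segint_cst// -segintB// -segintD//.
have cB : seg_cont (fun=> k - M) a b by exact: seg_contB.
have cD : seg_cont (fun=> k + M) a b by move=> t _; exact: cvg_cst.
apply/andP; split.
  by apply: le_segint cB hf _ => t /fM; rewrite ler_distl => /andP[].
by apply: le_segint hf cD _ => t /fM; rewrite ler_distl => /andP[].
Qed.

End SegmentIntegral.

Lemma dist_in_segment (R : realType) (u v x w : R) :
  x <= u <= x + w -> x <= v <= x + w -> `|u - v| <= w.
Proof. by move=> /andP[a1 a2] /andP[b1 b2]; rewrite ler_norml; lra. Qed.

(** * Goursat's theorem on rectangles for a pair of real functions *)

Section Goursat.
Variables (R : realType) (P Q : R -> R -> R) (A B : R).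

(** Differentiability at a single point, without continuity of the partial derivatives, together
    with the one equation dP/ds = dQ/dt, whose common value is [al]. *)
Definition green_at s t := exists al be ga : R, forall e, 0 < e ->
  exists2 d, 0 < d & forall s' t', `|s' - s| < d -> `|t' - t| < d ->
    `|P s' t' - P s t - (al * (s' - s) + be * (t' - t))|
       <= e * (`|s' - s| + `|t' - t|) /\
    `|Q s' t' - Q s t - (ga * (s' - s) + al * (t' - t))|
       <= e * (`|s' - s| + `|t' - t|).

Hypothesis greenPQ : forall s t, A < s < B -> green_at s t.

Lemma small_cont (f : R -> R) (t k : R) :
  (forall e, 0 < e -> exists2 d, 0 < d & forall t', `|t' - t| < d ->
    `|f t' - f t - k * (t' - t)| <= e * `|t' - t|) ->
  {for t, continuous f}.
Proof.
move=> h; have [d d0 hd] := h 1 ltr01.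
have K : 0 < 1 + `|k| by rewrite ltr_pwDl.
apply/cvgrPdist_lt => e e0; near=> t'.
have h1 : `|t' - t| < d.
  by rewrite distrC; near: t'; by apply/nbhs_ballP; exists d.
have h2 : `|t' - t| < e / (1 + `|k|).
  by rewrite distrC; near: t'; by apply/nbhs_ballP; exists (e / (1 + `|k|)) => //=; exact: divr_gt0.
rewrite distrC -(subrK (k * (t' - t)) (f t' - f t)).
apply: le_lt_trans (ler_normD _ _) _; rewrite normrM.
apply: (@le_lt_trans _ _ ((1 + `|k|) * `|t' - t|)).
  by rewrite mulrDl lerD2r hd.
by rewrite mulrC -ltr_pdivlMr.
Unshelve. all: by end_near. Qed.

Lemma green_cont_P s t : A < s < B -> {for t, continuous (P s)}.
Proof.
move=> /(greenPQ t)[al [be [ga h]]]; apply: (@small_cont _ _ be) => e /h[d d0 hd].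
exists d => // t' t'd; have := hd s t'; rewrite subrr normr0 => /(_ d0 t'd)[+ _].
by rewrite mulr0 !add0r.
Qed.

Lemma green_cont_Q s t : A < s < B -> {for s, continuous (Q ^~ t)}.
Proof.
move=> /(greenPQ t)[al [be [ga h]]]; apply: (@small_cont _ _ ga) => e /h[d d0 hd].
exists d => // t' t'd; have := hd t' t; rewrite subrr normr0 => /(_ t'd d0)[_].
by rewrite mulr0 !addr0.
Qed.

(** The integral of Q ds + P dt, counter-clockwise, around the rectangle with lower left corner [x]
    and sides [w] and [l]. *)
Definition circulation (x : R * R) (w l : R) : R :=
  segint (fun t => P (x.1 + w) t - P x.1 t) x.2 (x.2 + l) -
  segint (fun s => Q s (x.2 + l) - Q s x.2) x.1 (x.1 + w).

Lemma circulation_quarter x w l : 0 <= w -> 0 <= l ->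
  A < x.1 -> x.1 + (w + w) < B ->
  circulation x (w + w) (l + l) =
    circulation x w l + circulation (x.1 + w, x.2) w l +
    circulation (x.1, x.2 + l) w l + circulation (x.1 + w, x.2 + l) w l.
Proof.
case: x => a c /= w0 l0 Aa aB; rewrite /circulation /=.
have cP s t t' : a <= s <= a + (w + w) -> seg_cont (P s) t t'.
  move=> /andP[h1 h2] u _; apply: green_cont_P.
  by rewrite (lt_le_trans Aa)//= (le_lt_trans h2).
have cQ s s' t : a <= s -> s' <= a + (w + w) -> seg_cont (Q ^~ t) s s'.
  move=> h1 h2 u /andP[h3 h4]; apply: (@green_cont_Q u).
  by rewrite (lt_le_trans Aa) ?(le_trans h1)//= (le_lt_trans h4)// (le_lt_trans h2).
rewrite !addrA in cP cQ *.
have e1 : a <= a <= a + w + w by lra.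
have e2 : a <= a + w <= a + w + w by lra.
have e3 : a <= a + w + w <= a + w + w by lra.
have f1 : a <= a by [].
have f2 : a <= a + w by lra.
have f3 : a + w <= a + w + w by lra.
have f4 : a + w + w <= a + w + w by [].
rewrite !segintB; do ?[exact: cP|exact: cQ].
rewrite (@segint_cat _ (P (a + w + w)) c (c + l) (c + l + l)) ?lerDl//; last exact: cP.
rewrite (@segint_cat _ (P a) c (c + l) (c + l + l)) ?lerDl//; last exact: cP.
rewrite (@segint_cat _ (Q ^~ (c + l + l)) a (a + w) (a + w + w)) ?lerDl//; last exact: cQ.
rewrite (@segint_cat _ (Q ^~ c) a (a + w) (a + w + w)) ?lerDl//; last exact: cQ.
ring.
Qed.

(** The linear parts contribute [al * w * l] to both integrals and cancel. What remains is an
    increment of size [e * (w + l)] on sides of length [l] and [w]. *)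
Lemma circulation_local s t (e : R) : A < s < B -> 0 < e ->
  exists2 d, 0 < d & forall x w l, 0 <= w < d -> 0 <= l < d ->
    A < x.1 -> x.1 + w < B ->
    x.1 <= s <= x.1 + w -> x.2 <= t <= x.2 + l ->
    `|circulation x w l| <= e * (w + l) ^+ 2.
Proof.
move=> sAB e0; have [al [be [ga h]]] := greenPQ t sAB.
(* Each increment is a difference of two remainders, hence half of [e] for each. *)
have e20 : 0 < e / 2 by rewrite divr_gt0.
have [d d0 hd] := h _ e20; exists d => // -[a c] w l /=.
move=> /andP[w0 wd] /andP[l0 ld] Aa aB sa tc.
have cP s1 u u' : a <= s1 <= a + w -> seg_cont (P s1) u u'.
  move=> /andP[h1 h2] v _; apply: green_cont_P.
  by rewrite (lt_le_trans Aa)//= (le_lt_trans h2).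
have cQ u : seg_cont (Q ^~ u) a (a + w).
  move=> v /andP[h3 h4]; apply: (@green_cont_Q v).
  by rewrite (lt_le_trans Aa)//= (le_lt_trans h4).
have aL : a <= a <= a + w by rewrite lexx lerDl.
have aR : a <= a + w <= a + w by rewrite lexx lerDl w0.
have cL : c <= c <= c + l by rewrite lexx lerDl.
have cR : c <= c + l <= c + l by rewrite lexx lerDl l0.
have ineq x y : x <= w + l -> y <= w + l -> e / 2 * x + e / 2 * y <= e * (w + l).
  move=> xw yw; rewrite -mulrDr mulrAC ler_pdivrMr// -mulrA ler_pM2l// mulr_natr mulr2n.
  exact: lerD.
have k1 : `|segint (fun u => P (a + w) u - P a u) c (c + l) - (al * w) * (c + l - c)|
    <= (e * (w + l)) * (c + l - c).
  apply: segint_close; rewrite ?lerDl//.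
    by apply: seg_contB; exact: cP.
  move=> u uc.
  have b1 := dist_in_segment uc tc.
  have b2 := dist_in_segment aR sa.
  have b3 := dist_in_segment aL sa.
  have [g1 _] := hd (a + w) u (le_lt_trans b2 wd) (le_lt_trans b1 ld).
  have [g2 _] := hd a u (le_lt_trans b3 wd) (le_lt_trans b1 ld).
  rewrite (_ : _ - _ - _ = (P (a + w) u - P s t - (al * (a + w - s) + be * (u - t))) -
     (P a u - P s t - (al * (a - s) + be * (u - t)))); last by ring.
  rewrite (le_trans (ler_normB _ _))// (le_trans (lerD g1 g2))// ineq//; exact: lerD.
have k2 : `|segint (fun u => Q u (c + l) - Q u c) a (a + w) - (al * l) * (a + w - a)|
    <= (e * (w + l)) * (a + w - a).
  apply: segint_close; rewrite ?lerDl//.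
    by apply: seg_contB; exact: cQ.
  move=> u ua.
  have b1 := dist_in_segment ua sa.
  have b2 := dist_in_segment cR tc.
  have b3 := dist_in_segment cL tc.
  have [_ g1] := hd u (c + l) (le_lt_trans b1 wd) (le_lt_trans b2 ld).
  have [_ g2] := hd u c (le_lt_trans b1 wd) (le_lt_trans b3 ld).
  rewrite (_ : _ - _ - _ = (Q u (c + l) - Q s t - (ga * (u - s) + al * (c + l - t))) -
     (Q u c - Q s t - (ga * (u - s) + al * (c - t)))); last by ring.
  rewrite (le_trans (ler_normB _ _))// (le_trans (lerD g1 g2))// ineq//; exact: lerD.
rewrite /circulation/=; set I1 := segint _ _ _ in k1 *; set I2 := segint _ _ _ in k2 *.
rewrite (_ : I1 - I2 = (I1 - al * w * (c + l - c)) - (I2 - al * l * (a + w - a))); last by ring.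
rewrite (le_trans (ler_normB _ _))// (le_trans (lerD k1 k2))//.
by apply: eq_ler; ring.
Qed.

(** Bisection: some quarter always carries at least a fourth of the circulation, the chosen quarters
    shrink to a point, and the local estimate at that point beats the factor 4^-n. *)
Lemma goursat_circulation x w l : 0 <= w -> 0 <= l ->
  A < x.1 -> x.1 + w < B -> circulation x w l = 0.
Proof.
case: x => a0 c0 /= w0 l0 Aa aB.
pose h n : R := (2 ^+ n)^-1.
have h0 n : 0 < h n by rewrite invr_gt0 exprn_gt0.
have hS n : h n = h n.+1 + h n.+1.
  by rewrite /h exprS invfM -mulrDl -[LHS]mul1r; congr (_ * _); field.
(* The position bounds are premises under the existential, so that [choice] returns a total
   successor function. *)
have step (nx : nat * (R * R)) : exists y : R * R,
    a0 <= nx.2.1 -> nx.2.1 + w * h nx.1 <= a0 + w ->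
    [/\ nx.2.1 <= y.1 <= nx.2.1 + w * h nx.1.+1,
        nx.2.2 <= y.2 <= nx.2.2 + l * h nx.1.+1 &
        `|circulation nx.2 (w * h nx.1) (l * h nx.1)| / 4
          <= `|circulation y (w * h nx.1.+1) (l * h nx.1.+1)| ].
  case: nx => n [a c] /=; set w' := w * h n.+1; set l' := l * h n.+1.
  have w'0 : 0 <= w' by rewrite mulr_ge0 // ltW.
  have l'0 : 0 <= l' by rewrite mulr_ge0 // ltW.
  have -> : w * h n = w' + w' by rewrite hS mulrDr.
  have -> : l * h n = l' + l' by rewrite hS mulrDr.
  set D := circulation (a, c) (w' + w') (l' + l').
  case: (boolP (`|D| / 4 <= `|circulation (a, c) w' l'|)) => H1.
    by exists (a, c) => /= _ _; split => //; rewrite lexx lerDl.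
  case: (boolP (`|D| / 4 <= `|circulation (a + w', c) w' l'|)) => H2.
    by exists (a + w', c) => /= _ _; split => //; rewrite lexx lerDl ?w'0.
  case: (boolP (`|D| / 4 <= `|circulation (a, c + l') w' l'|)) => H3.
    by exists (a, c + l') => /= _ _; split => //; rewrite lexx lerDl ?l'0.
  exists (a + w', c + l') => /= ha hw; split;
    [by rewrite lexx lerDl w'0|by rewrite lexx lerDl l'0|].
  rewrite -!ltNge in H1 H2 H3.
  have := @circulation_quarter (a, c) w' l' w'0 l'0; rewrite /= -/D => DE.
  have {}DE := DE (lt_le_trans Aa ha) (le_lt_trans hw aB).
  rewrite leNgt; apply/negP => H4.
  suff : `|D| < `|D| by rewrite ltxx.
  rewrite {1}DE; apply: le_lt_trans (ler_normD _ _) _.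
  apply: le_lt_trans (lerD (ler_normD _ _) (lexx _)) _.
  apply: le_lt_trans (lerD (lerD (ler_normD _ _) (lexx _)) (lexx _)) _.
  by rewrite [ltRHS](_ : _ = `|D| / 4 + `|D| / 4 + `|D| / 4 + `|D| / 4); [rewrite !ltrD|field].
have [next nextP] := choice step.
pose x := fix x n : R * R := if n is m.+1 then next (m, x m) else (a0, c0).
have xr n : a0 <= (x n).1 /\ (x n).1 + w * h n <= a0 + w.
  elim: n => [|n [i1 i2]]; first by rewrite /h expr0 invr1 mulr1.
  have [/andP[j1 j2] _ _] := nextP (n, x n) i1 i2.
  rewrite -[x n.+1]/(next (n, x n)); split; first exact: le_trans i1 j1.
  by apply: le_trans i2; rewrite (hS n) mulrDr addrA lerD2r.
have xn n := nextP (n, x n) (xr n).1 (xr n).2.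
have Dn n : `|circulation (a0, c0) w l| * h n ^+ 2 <=
    `|circulation (x n) (w * h n) (l * h n)|.
  elim: n => [|n ih]; first by rewrite /h expr0 invr1 expr1n !mulr1.
  have [_ _ j] := xn n; apply: le_trans j.
  rewrite -[(n, x n).2]/(x n) -[(n, x n).1]/n ler_pdivlMr//; apply: le_trans ih.
  by rewrite (hS n); apply: eq_ler; ring.
(* Nested intervals, used once for each coordinate. *)
have nest (u : nat -> R) (k : R) : (forall n, u n <= u n.+1 <= u n + k * h n.+1) ->
    exists s, forall n, u n <= s <= u n + k * h n.
  move=> uu.
  have mono m n : (m <= n)%N -> u m <= u n.
    move=> /subnK <-; elim: (n - m)%N => [|i ih]; rewrite ?add0n// addSn.
    by apply: (le_trans ih); have /andP[] := uu (i + m)%N.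
  have anti m n : (m <= n)%N -> u n + k * h n <= u m + k * h m.
    move=> /subnK <-; elim: (n - m)%N => [|i ih]; rewrite ?add0n// addSn.
    apply: le_trans ih; have /andP[] := uu (i + m)%N; rewrite (hS (i + m)%N) mulrDr; lra.
  have k0 : 0 <= k.
    have /andP[i1 i2] := uu 0%N; have : 0 <= k * h 1%N by lra.
    by rewrite pmulr_lge0.
  have ub m n : u n <= u m + k * h m.
    case/orP: (leq_total m n) => mn; last first.
      by apply: (le_trans (mono _ _ mn)); rewrite lerDl mulr_ge0// ltW.
    by apply: le_trans (anti _ _ mn); rewrite lerDl mulr_ge0// ltW.
  exists (sup (range u)) => n; apply/andP; split.
    by apply: sup_upper_bound; [split; [by exists (u 0%N), 0%N|
       by exists (u 0%N + k * h 0%N) => _ [m _ <-]]|by exists n].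
  by apply: ge_sup; [by exists (u 0%N), 0%N|move=> _ [m _ <-]].
have [s hs] : exists s, forall n, (x n).1 <= s <= (x n).1 + w * h n.
  by apply: nest => n; have [] := xn n.
have [t ht] : exists t, forall n, (x n).2 <= t <= (x n).2 + l * h n.
  by apply: nest => n; have [] := xn n.
have sAB : A < s < B.
  have /andP[s1 s2] := hs 0%N; have [r1 r2] := xr 0%N.
  apply/andP; split; first exact: lt_le_trans Aa (le_trans r1 s1).
  exact: le_lt_trans (le_trans s2 r2) aB.
apply/eqP; rewrite -normr_eq0; apply/eqP/le_anti; rewrite normr_ge0 andbT.
apply/ler_addgt0Pr => e e0; rewrite add0r.
have q0 : 0 < (w + l) ^+ 2 + 1 by rewrite ltr_wpDl ?sqr_ge0.
have e'0 : 0 < e / ((w + l) ^+ 2 + 1) by rewrite divr_gt0.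
have [d d0 hd] := circulation_local t sAB e'0.
have [n hn] : exists n, (w + l) * h n < d.
  have := @cvg_geometric R (w + l) (2^-1).
  rewrite ger0_norm ?invr_ge0// invf_lt1// ltr1n => /(_ isT) /cvgrPdist_lt /(_ d d0).
  move=> [n _ /(_ n (leqnn n))] /=; rewrite sub0r normrN => H; exists n.
  by apply: le_lt_trans H; rewrite /geometric/= exprVn ler_norm.
have wh : 0 <= w * h n by rewrite mulr_ge0// ltW.
have lh : 0 <= l * h n by rewrite mulr_ge0// ltW.
rewrite mulrDl in hn.
have [r1 r2] := xr n.
have := hd (x n) (w * h n) (l * h n).
move=> /(_ ltac:(lra) ltac:(lra) (lt_le_trans Aa r1) (le_lt_trans r2 aB) (hs n) (ht n)).
move=> /(le_trans (Dn n)).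
(* Both sides carry the factor [h n ^+ 2]; it cancels and leaves a bound for the original
   rectangle. *)
rewrite -(mulrDl w l) exprMn [e / _ * _]mulrA ler_pM2r ?exprn_gt0// => /le_trans; apply.
by rewrite mulrAC ler_pdivrMr// ler_pM2l// lerDl.
Qed.

Lemma goursat a b c d : A < a -> a <= b -> b < B -> c <= d ->
  segint (fun t => P b t - P a t) c d = segint (fun s => Q s d - Q s c) a b.
Proof.
move=> Aa ab bB cd; apply/eqP; rewrite -subr_eq0.
have := @goursat_circulation (a, c) (b - a) (d - c).
rewrite /circulation /= !subr_ge0 !addrA ![_ + b]addrC ![_ + d]addrC !addrK.
by move=> ->.
Qed.

End Goursat.

(** * Circular means in logarithmic coordinates *)

Section CircleMean.
Variable R : realType.
Implicit Types (g : R[i] -> R[i]) (z w : R[i]) (t : R).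

Definition eit t : R[i] := cos t +i* sin t.

Lemma eit0 : eit 0 = 1.
Proof. by rewrite /eit cos0 sin0. Qed.

Lemma eit2pi : eit (2 * pi) = 1.
Proof. by rewrite /eit mulr_natl cos2pi sin2pi. Qed.

Lemma eitD t u : eit (t + u) = eit t * eit u.
Proof. by rewrite /eit cosD sinD; simpc; congr (_ +i* _); ring. Qed.

Lemma absc_eit t : absc (eit t) = 1.
Proof. by rewrite /absc normc_def /= cos2Dsin2 sqrtr1. Qed.

Lemma is_derive_small (f : R -> R) (x df : R) : is_derive x 1 f df ->
  forall e, 0 < e -> exists2 d, 0 < d & forall h, `|h| < d ->
    `|f (x + h) - f x - df * h| <= e * `|h|.
Proof.
move=> [dv dE] e e0.
have /cvgrPdist_le /(_ e e0) [d /= d0 hd] := (dv : cvg _).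
exists d => // h hdd; have [->|h0] := eqVneq h 0.
  by rewrite addr0 subrr mulr0 subrr normr0 mulr0.
have := hd h; rewrite /ball_/= sub0r normrN => /(_ hdd h0).
move: dE; rewrite /derive => -> H.
rewrite /GRing.scale/= mulr1 [h + x]addrC in H.
rewrite (_ : _ - _ - _ = - (h * (df - h^-1 * (f (x + h) - f x)))).
  by rewrite normrN normrM mulrC ler_wpM2r.
by rewrite [in RHS]mulrBr mulVKf// opprB [df * _]mulrC.
Qed.

(** First order expansion of the exponential at 0 in the variable a + i b, from which (s, t) -> g(z0
    exp(s + i t)) inherits the differentiability of g. *)
Lemma exp_eit_small (e : R) : 0 < e -> exists2 d, 0 < d & forall a b : R,
  `|a| < d -> `|b| < d ->
  absc ((expR a)%:C * eit b - 1 - (a +i* b)) <= e * (`|a| + `|b|).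
Proof.
move=> e0; pose eta := Num.min (e / 8) 1.
have eta0 : 0 < eta by rewrite lt_min ltr01 divr_gt0.
have [d1 d10 h1] := is_derive_small (is_derive_expR (0 : R)) eta0.
have [d2 d20 h2] := is_derive_small (is_derive_cos (0 : R)) eta0.
have [d3 d30 h3] := is_derive_small (is_derive_sin (0 : R)) eta0.
exists (Num.min (Num.min d1 d2) (Num.min d3 (Num.min (e / 8) 2^-1))).
  by rewrite !lt_min d10 d20 d30 divr_gt0//= invr_gt0.
move=> a b; rewrite !lt_min => /andP[/andP[a1 _] /andP[_ /andP[a4 a5]]].
move=> /andP[/andP[b1 b2] /andP[b3 /andP[b4 b5]]].
have := h1 _ a1; rewrite add0r expR0 mul1r => {}h1.
have := h2 _ b2; rewrite add0r cos0 sin0 oppr0 mul0r subr0 => {}h2.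
have := h3 _ b3; rewrite add0r cos0 sin0 subr0 mul1r => {}h3.
have eta1 : eta <= 1 by rewrite ge_min lexx orbT.
have eta8 : eta <= e / 8 by rewrite ge_min lexx.
have E1 : `|expR a - 1| <= 2 * `|a|.
  rewrite -(subrK a (expR a - 1)) (le_trans (ler_normD _ _))//.
  rewrite mulr_natl mulr2n lerD2r (le_trans h1)// ler_piMl//.
have E2 : `|expR a| <= 2.
  rewrite -(subrK 1 (expR a)) (le_trans (ler_normD _ _))// normr1.
  rewrite -[leRHS]/(1 + 1) lerD2r (le_trans E1)// -ler_pdivlMl// mulr1; exact: ltW.
apply: le_trans (absc_le _) _.
rewrite !(ReB, ImB, ReZ, ImZ)/= subr0 mulrDr;
  apply: (@le_trans _ _ (e / 8 * `|a| + 2 * (e / 8 * `|b|) + (2 * (e / 8 * `|b|) + 2 * `|a| * `|b|))).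
  apply: lerD.
    rewrite (_ : _ - _ - _ = (expR a - 1 - a) + expR a * (cos b - 1)); last by ring.
    rewrite (le_trans (ler_normD _ _))// lerD//.
      by rewrite (le_trans h1)// ler_wpM2r.
    by rewrite normrM ler_pM// (le_trans h2)// ler_wpM2r.
  rewrite (_ : _ - _ = expR a * (sin b - b) + (expR a - 1) * b); last by ring.
  rewrite (le_trans (ler_normD _ _))// lerD//.
    by rewrite normrM ler_pM// (le_trans h3)// ler_wpM2r.
  by rewrite normrM ler_wpM2r.
have : `|a| * `|b| <= e / 8 * `|b| by rewrite ler_wpM2r// ltW.
have : 0 <= e / 8 * `|a| by rewrite mulr_ge0// ltW// divr_gt0.
have : 0 <= e / 8 * `|b| by rewrite mulr_ge0// ltW// divr_gt0.
have -> : e * `|a| + e * `|b| = 8 * (e / 8 * `|a|) + 8 * (e / 8 * `|b|) by field.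
rewrite -[2 * `|a| * `|b|]mulrA.
move: (`|a| * `|b|) (e / 8 * `|a|) (e / 8 * `|b|) => y u v ? ? ?; lra.
Qed.

Definition ccont (phi : R -> R[i]) t := forall e, 0 < e ->
  exists2 d, 0 < d & forall t', `|t' - t| < d -> absc (phi t' - phi t) < e.

Lemma ccont_Re phi t : ccont phi t -> {for t, continuous (fun t => complex.Re (phi t))}.
Proof.
move=> h; apply/cvgrPdist_lt => e e0; have [d d0 hd] := h _ e0.
apply/nbhs_ballP; exists d => //= t' td; rewrite -ReB.
apply: le_lt_trans (normr_Re _) _; rewrite abscB; apply: hd.
by rewrite distrC.
Qed.

Lemma ccont_absc phi t : ccont phi t -> {for t, continuous (fun t => absc (phi t))}.
Proof.
move=> h; apply/cvgrPdist_lt => e e0; have [d d0 hd] := h _ e0.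
apply/nbhs_ballP; exists d => //= t' td; rewrite /ball_/= distrC in td.
apply: le_lt_trans (hd _ td).
have := ler_abscB (phi t') (phi t); have := ler_abscB (phi t) (phi t').
by rewrite (abscB (phi t) (phi t')) => ? ?; rewrite ler_norml; apply/andP; split; lra.
Qed.

Lemma ccont_comp g phi t : cdiff g (phi t) -> ccont phi t -> ccont (fun t => g (phi t)) t.
Proof.
move=> /cdiff_continuous dg h e e0; have [d d0 hd] := dg _ e0.
by have [d' d'0 hd'] := h _ d0; exists d' => // t' /hd'/hd.
Qed.

Lemma ccont_circle (z : R[i]) t : ccont (fun t => z * eit t) t.
Proof.
apply: (ccont_comp (g := fun w => z * w)); first by apply: cdiffM;
  [exact: cdiff_cst|exact: cdiff_id].
move=> e e0; have e20 : 0 < e / 2 by rewrite divr_gt0.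
have /cvgrPdist_lt /(_ _ e20) /nbhs_ballP [d1 d10 h1] := @continuous_cos R t.
have /cvgrPdist_lt /(_ _ e20) /nbhs_ballP [d2 d20 h2] := @continuous_sin R t.
exists (Num.min d1 d2); first by rewrite lt_min d10.
move=> t'; rewrite lt_min distrC => /andP[t1 t2].
apply: le_lt_trans (absc_le _) _; rewrite ReB ImB /=.
rewrite (splitr e) ltrD//.
  by have := h1 _ t1; rewrite /= distrC.
by have := h2 _ t2; rewrite /= distrC.
Qed.

(** In s + i t the function g(z0 exp(s + i t)) is holomorphic and 2 pi periodic in t. Goursat on the
    rectangle [s, 0] x [0, 2 pi] shows that the mean does not depend on s, and s -> -oo gives the
    value at the centre. *)
Lemma mean_value g rad z0 : (forall z, absc z < rad -> cdiff g z) ->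
  absc z0 < rad ->
  segint (fun t => complex.Re (g (z0 * eit t))) 0 (2 * pi) = 2 * pi * complex.Re (g 0).
Proof.
move=> dg z0r.
have pi20 : 0 <= 2 * pi :> R by rewrite mulr_ge0 ?pi_ge0.
have [->|z00] := eqVneq z0 0.
  rewrite (@eq_segint _ _ (fun=> complex.Re (g 0))); last by move=> t _; rewrite mul0r.
  by rewrite segint_cst// subr0 mulrC.
have az0 : 0 < absc z0 by rewrite absc_gt0.
pose B := ln (rad / absc z0).
have q1 : 1 < rad / absc z0 by rewrite ltr_pdivlMr// mul1r.
have B0 : 0 < B by rewrite ln_gt0.
have qB : expR B = rad / absc z0 by rewrite lnK// posrE (lt_trans ltr01).
pose G s t := g ((expR s)%:C * z0 * eit t).
have inr s t : s < B -> absc ((expR s)%:C * z0 * eit t) < rad.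
  move=> sB; rewrite !abscM absc_eit mulr1 absc_real ger0_norm ?expR_ge0//.
  by rewrite -ltr_pdivlMr// -qB ltr_expR.
pose P s t := complex.Re (G s t); pose Q s t := complex.Im (G s t).
have green A s t : A < s < B -> green_at P Q s t.
  move=> /andP[_ sB]; set w0 := (expR s)%:C * z0 * eit t.
  have w00 : 0 < absc w0.
    by rewrite !abscM absc_eit mulr1 absc_real mulr_gt0// normr_gt0 gt_eqF// expR_gt0.
  have dgw := dg w0 (inr s t sB).
  have [Ag hA] := proj1 (cdiffP _ _) dgw.
  (* [C] is the derivative with respect to s + i t; its real and imaginary parts give the partial
     derivatives of [P] and [Q] by the Cauchy-Riemann equations. *)
  pose C := Ag * w0; exists (complex.Re C), (- complex.Im C), (complex.Im C) => e e0.
  have K0 : 0 < absc w0 * 3 by rewrite mulr_gt0.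
  have L0 : 0 < absc C + 1 by rewrite ltr_wpDl ?absc_ge0.
  have e1 : 0 < e / 2 / (absc w0 * 3) by rewrite !divr_gt0.
  have e2 : 0 < Num.min 1 (e / 2 / (absc C + 1)) by rewrite lt_min ltr01 !divr_gt0.
  have [d1 d10 h1] := hA _ e1.
  have [d2 d20 h2] := exp_eit_small e2.
  exists (Num.min d2 (d1 / (absc w0 * 4))).
    by rewrite lt_min d20 divr_gt0// mulr_gt0.
  move=> s' t'; rewrite !lt_min => /andP[s1 s2] /andP[t1 t2].
  set a := s' - s in s1 s2 *; set b := t' - t in t1 t2 *.
  have := h2 a b s1 t1; set r := _ - _ - _ => hr.
  rewrite /P /Q.
  have -> : G s' t' = g (w0 * (1 + (a +i* b) + r)).
    have -> : 1 + (a +i* b) + r = (expR a)%:C * eit b by rewrite /r; ring.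
    rewrite /G; congr g; rewrite /w0 /a /b -[in LHS](subrK s s') -[in LHS](subrK t t') expRD eitD.
    by rewrite rmorphM/=; ring.
  have -> : G s t = g w0 by [].
  set u := a +i* b.
  have u1 : absc u <= `|a| + `|b| by exact: absc_le.
  have r1 : absc r <= `|a| + `|b|.
    by rewrite (le_trans hr)// ler_piMl ?addr_ge0// ge_min lexx.
  have ab : absc (w0 * (1 + u + r) - w0) <= absc w0 * (2 * (`|a| + `|b|)).
    rewrite -[X in _ - X]mulr1 -mulrBr abscM ler_wpM2l ?absc_ge0//.
    have -> : 1 + u + r - 1 = u + r by ring.
    rewrite (le_trans (abscD _ _))// mulr_natl mulr2n lerD//.
  have ab2 : absc (w0 * (1 + u + r) - w0) < d1.
    apply: le_lt_trans ab _; rewrite mulrA -ltr_pdivlMl ?mulr_gt0//.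
    rewrite (splitr (_ * d1)) ltrD//.
      by rewrite (lt_le_trans s2)//; apply: eq_ler; field; rewrite gt_eqF.
    by rewrite (lt_le_trans t2)//; apply: eq_ler; field; rewrite gt_eqF.
  have {ab2} hh := h1 _ ab2.
  have main : absc (g (w0 * (1 + u + r)) - g w0 - C * u) <= e * (`|a| + `|b|).
    rewrite (_ : _ - _ - _ = (g (w0 * (1 + u + r)) - g w0 - Ag * (w0 * (1 + u + r) - w0)) + C * r); last first.
      by rewrite /C; ring.
    apply: le_trans (abscD _ _) _; rewrite (splitr e) mulrDl lerD//.
      apply: le_trans hh _;
        apply: (@le_trans _ _ (e / 2 / (absc w0 * 3) * (absc w0 * (2 * (`|a| + `|b|))))).
        by rewrite ler_wpM2l// ltW.
      rewrite (_ : _ * _ = e / 2 * (`|a| + `|b|) * (2 / 3)); last by field; rewrite gt_eqF.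
      apply: ler_piMr; last by rewrite ler_pdivrMr// mul1r ler_nat.
      by rewrite mulr_ge0 ?addr_ge0// ltW// divr_gt0.
    rewrite abscM; apply: (@le_trans _ _ ((absc C + 1) * (e / 2 / (absc C + 1) * (`|a| + `|b|)))).
      apply: ler_pM; rewrite ?absc_ge0 ?lerDl// (le_trans hr)// ler_wpM2r ?addr_ge0//.
      by rewrite ge_min lexx orbT.
    by rewrite mulrA [X in X * _]mulrC divfK// gt_eqF.
  split.
    apply: le_trans main; apply: le_trans (normr_Re _).
    by rewrite !ReB {1 3}/u; case: (C) => c1 c2 /=; apply: eq_ler; congr `|_|; ring.
  apply: le_trans main; apply: le_trans (normr_Im _).
  by rewrite !ImB {1 3}/u; case: (C) => c1 c2 /=; apply: eq_ler; congr `|_|; ring.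
(* The two edges t = 0 and t = 2 pi carry the same values of [Q], so the circulation reduces to the
   difference of two circular means. *)
have const s : s <= 0 -> segint (P 0) 0 (2 * pi) = segint (P s) 0 (2 * pi).
  move=> s0.
  have gr := green (s - 1).
  have As : s - 1 < s by rewrite ltrBlDr ltrDl.
  have cP u : s <= u -> u <= 0 -> seg_cont (P u) 0 (2 * pi).
    move=> su u0 t _; apply: (green_cont_P gr); rewrite (lt_le_trans As su)/=.
    exact: le_lt_trans B0.
  have := @goursat _ P Q (s - 1) B gr s 0 0 (2 * pi) As s0 B0 pi20.
  rewrite segintB; [|exact: cP|exact: cP].
  rewrite (@eq_segint _ (fun s => Q s (2 * pi) - Q s 0) (fun=> 0)); last first.
    by move=> t _; rewrite /Q /G eit0 eit2pi subrr.
  by rewrite segint_cst// mul0r => /eqP; rewrite subr_eq0 => /eqP.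
have -> : segint (fun t => complex.Re (g (z0 * eit t))) 0 (2 * pi) = segint (P 0) 0 (2 * pi).
  by apply: eq_segint => t _; rewrite /P /G expR0 mul1r.
apply/eqP; rewrite -subr_eq0 -normr_eq0; apply/eqP/le_anti; rewrite normr_ge0 andbT.
apply/ler_addgt0Pr => e e0; rewrite add0r.
have r0 : absc (0 : R[i]) < rad by rewrite absc0 (lt_trans az0).
have e1 : 0 < e / (2 * pi + 1) by rewrite divr_gt0// ltr_wpDl.
have [d d0 hd] := cdiff_continuous (dg 0 r0) e1.
pose s := Num.min 0 (ln (d / 2 / absc z0)).
have s0 : s <= 0 by rewrite ge_min lexx.
have sd : expR s * absc z0 < d.
  rewrite -ltr_pdivlMr//; apply: (@le_lt_trans _ _ (d / 2 / absc z0)).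
    rewrite -[leRHS]lnK ?posrE ?divr_gt0// ler_expR ge_min lexx orbT //.
  by rewrite ltr_pM2r ?invr_gt0// ltr_pdivrMr// ltr_pMr// ltr1n.
rewrite (const s s0) [2 * pi * complex.Re _]mulrC.
have cs : seg_cont (P s) 0 (2 * pi).
  move=> t _; apply: (green_cont_P (green (s - 1))).
  by rewrite ltrBlDr ltrDl ltr01/= (le_lt_trans s0).
have := segint_close (k := complex.Re (g 0)) (M := e / (2 * pi + 1)) pi20 cs.
rewrite subr0 => H; apply: (@le_trans _ _ (e / (2 * pi + 1) * (2 * pi))); last first.
  by rewrite mulrAC ler_pdivrMr ?ltr_wpDl// ler_pM2l// lerDl.
apply: H => t _; rewrite /P -ReB; apply: (le_trans (normr_Re _)); apply/ltW/hd.
by rewrite subr0 !abscM absc_eit mulr1 absc_real ger0_norm ?expR_ge0.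
Qed.

End CircleMean.

(** * Contractions and their resolvents *)

Section HilbertSpace.
Variables (R : realType) (n : nat).
Implicit Types (x y z : 'cV[R[i]]_n) (T : 'M[R[i]]_n).

Definition ip x y : R[i] := \sum_(i < n) x i ord0 * (y i ord0)^*.

Lemma ipDl x y z : ip (x + y) z = ip x z + ip y z.
Proof. by rewrite /ip -big_split; apply: eq_bigr => i _; rewrite mxE mulrDl. Qed.

Lemma ipZl a x y : ip (a *: x) y = a * ip x y.
Proof. by rewrite /ip mulr_sumr; apply: eq_bigr => i _; rewrite mxE mulrA. Qed.

Lemma ip_conj x y : (ip x y)^* = ip y x.
Proof.
rewrite /ip rmorph_sum/=; apply: eq_bigr => i _.
by rewrite rmorphM/= conjCK mulrC.
Qed.

Lemma ipDr x y z : ip x (y + z) = ip x y + ip x z.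
Proof. by rewrite -ip_conj ipDl rmorphD/= !ip_conj. Qed.

Lemma ipZr a x y : ip x (a *: y) = a^* * ip x y.
Proof. by rewrite -ip_conj ipZl rmorphM/= ip_conj. Qed.

Lemma ipNl x y : ip (- x) y = - ip x y.
Proof. by rewrite -scaleN1r ipZl mulN1r. Qed.

Lemma ipNr x y : ip x (- y) = - ip x y.
Proof. by rewrite -ip_conj ipNl rmorphN/= ip_conj. Qed.

Lemma ip0l y : ip 0 y = 0.
Proof. by rewrite /ip big1// => i _; rewrite mxE mul0r. Qed.

Lemma l2norm_sqr x : l2norm x ^+ 2 = \sum_(i < n) absc (x i ord0) ^+ 2.
Proof. by rewrite /l2norm sqr_sqrtr// sumr_ge0// => i _; rewrite sqr_ge0. Qed.

Lemma ipxx x : ip x x = (l2norm x ^+ 2)%:C.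
Proof.
rewrite l2norm_sqr rmorph_sum/=; apply: eq_bigr => i _; exact: mulc_conj.
Qed.

Lemma l2norm_ge0 x : 0 <= l2norm x.
Proof. exact: sqrtr_ge0. Qed.

Lemma l2norm0 : l2norm (0 : 'cV[R[i]]_n) = 0.
Proof.
by rewrite /l2norm big1 ?sqrtr0// => i _; rewrite mxE absc0 expr0n.
Qed.

Lemma absc_entry_le x i : absc (x i ord0) <= l2norm x.
Proof.
rewrite -(ler_pXn2r (_ : 0 < 2)%N)// ?nnegrE ?absc_ge0 ?l2norm_ge0//.
rewrite l2norm_sqr (bigD1 i)//= lerDl sumr_ge0// => j _; exact: sqr_ge0.
Qed.

Lemma l2norm_eq0 x : l2norm x = 0 -> x = 0.
Proof.
move=> x0; apply/matrixP => i j; rewrite ord1 mxE; apply/eqP.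
by rewrite -absc_eq0 eq_le absc_ge0 andbT -x0 absc_entry_le.
Qed.

Lemma l2normZ a x : l2norm (a *: x) = absc a * l2norm x.
Proof.
apply/eqP; rewrite -(@eqrXn2 _ 2)// ?mulr_ge0 ?l2norm_ge0 ?absc_ge0//.
apply/eqP; rewrite exprMn !l2norm_sqr mulr_sumr; apply: eq_bigr => i _.
by rewrite mxE abscM exprMn.
Qed.

Lemma l2norm_sqrBZ x a y : l2norm (x - a *: y) ^+ 2 =
  l2norm x ^+ 2 - 2 * complex.Re (a^* * ip x y) + absc a ^+ 2 * l2norm y ^+ 2.
Proof.
apply: complexI; rewrite -ipxx !(ipDl, ipDr, ipNl, ipNr, ipZl, ipZr) !ipxx.
rewrite -(ip_conj x y); set c := ip x y.
have E1 : (absc a ^+ 2 * l2norm y ^+ 2)%:C = a * a^* * (l2norm y ^+ 2)%:C.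
  by rewrite mulc_conj -rmorphM.
have E2 : (2 * complex.Re (a^* * c))%:C = a^* * c + a * c^*.
  have -> : a * c^* = (a^* * c)^* by rewrite rmorphM/= conjCK.
  by case: (a^* * c) => u v; apply/eqP; rewrite eq_complex/=; apply/andP; split; apply/eqP; ring.
by rewrite rmorphD rmorphB/= E1 E2; ring.
Qed.

(* The sign [a/|a|] turns the positive semidefinite form's value at [x - a y]
   into the arithmetic-geometric mean bound. *)
Lemma defect_form_le T x y : (forall z, l2norm (T *m z) <= l2norm z) ->
  absc (ip x y - ip (T *m x) (T *m y)) <=
  ((l2norm x ^+ 2 - l2norm (T *m x) ^+ 2) + (l2norm y ^+ 2 - l2norm (T *m y) ^+ 2)) / 2.
Proof.
move=> hT; set c := ip x y - _.
have hT2 z : l2norm (T *m z) ^+ 2 <= l2norm z ^+ 2.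
  by rewrite ler_pXn2r// ?nnegrE ?l2norm_ge0.
have [c0|c0] := eqVneq c 0.
  by rewrite c0 absc0 divr_ge0// addr_ge0// subr_ge0.
have ac : 0 < absc c by rewrite absc_gt0.
pose a := c * (absc c)^-1%:C.
have aa : absc a = 1.
  by rewrite /a abscM absc_real ger0_norm ?invr_ge0 ?absc_ge0// divff// gt_eqF.
have ca : a^* * c = (absc c)%:C.
  rewrite /a rmorphM/= mulrAC [c^* * c]mulrC mulc_conj.
  have -> : ((absc c)^-1%:C)^* = ((absc c)^-1)%:C :> R[i] by simpc.
  by rewrite -rmorphM/= expr2 mulfK// gt_eqF.
have := hT2 (x - a *: y).
rewrite mulmxBr -scalemxAr !l2norm_sqrBZ aa expr1n !mul1r -subr_ge0.
have -> : complex.Re (a^* * ip x y) = absc c + complex.Re (a^* * ip (T *m x) (T *m y)).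
  have -> : absc c = complex.Re (a^* * c) by rewrite ca.
  by rewrite /c mulrBr ReB subrK.
rewrite ler_pdivlMr//; lra.
Qed.

(** The defect form of the zero matrix is the inner product itself. *)
Lemma ip_amgm x y : absc (ip x y) <= (l2norm x ^+ 2 + l2norm y ^+ 2) / 2.
Proof.
have := @defect_form_le 0 x y; rewrite !mul0mx ip0l l2norm0 expr0n/= !subr0; apply.
by move=> z; rewrite mul0mx l2norm0 l2norm_ge0.
Qed.

Lemma cauchy_schwarz x y : absc (ip x y) <= l2norm x * l2norm y.
Proof.
have [x0|x0] := eqVneq (l2norm x) 0.
  by rewrite (l2norm_eq0 x0) ip0l absc0 l2norm0 mul0r.
have [y0|y0] := eqVneq (l2norm y) 0.
  by rewrite (l2norm_eq0 y0) -ip_conj ip0l absc_conj absc0 l2norm0 mulr0.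
have := ip_amgm ((l2norm x)^-1%:C *: x) ((l2norm y)^-1%:C *: y).
rewrite ipZl ipZr !l2normZ !abscM absc_conj !absc_real !ger0_norm ?invr_ge0 ?l2norm_ge0//.
rewrite !mulVf// expr1n divff// mulrA -invfM ler_pdivrMl ?mulr1//.
by rewrite mulr_gt0 // lt_neqAle eq_sym ?x0 ?y0 l2norm_ge0.
Qed.

Lemma l2normD x y : l2norm (x + y) <= l2norm x + l2norm y.
Proof.
rewrite -(ler_pXn2r (_ : 0 < 2)%N)// ?nnegrE ?addr_ge0 ?l2norm_ge0//.
rewrite -[y in l2norm (x + y)]opprK -[- y]scale1r l2norm_sqrBZ absc1 expr1n mul1r.
rewrite ipNr rmorph1 mul1r ReN sqrrD.
rewrite (_ : l2norm (- y) = l2norm y); last by rewrite -scaleN1r l2normZ abscN absc1 mul1r.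
have := le_trans (Re_le_absc _) (cauchy_schwarz x y); rewrite mulr2n; lra.
Qed.

Lemma l2norm_subr x y : l2norm x - l2norm y <= l2norm (x - y).
Proof. by rewrite lerBlDr -{1}(subrK y x) l2normD. Qed.

(** A real [sup] is meaningful only for a nonempty bounded set; the bound here is the Euclidean norm
    of the row sums of moduli. *)
Lemma opnorm_set_bounded T :
  has_sup [set l2norm (T *m x) | x in [set x : 'cV[R[i]]_n | l2norm x <= 1]].
Proof.
split; first by exists (l2norm (T *m 0)), 0 => //=; rewrite l2norm0 ler01.
pose K i := \sum_(j < n) absc (T i j).
exists (Num.sqrt (\sum_(i < n) K i ^+ 2)) => _ [x /= x1 <-].
rewrite /l2norm ler_sqrt ?sumr_ge0// => [|i _]; last exact: sqr_ge0.
apply: ler_sum => i _.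
have K0 : 0 <= K i by rewrite sumr_ge0// => j _; exact: absc_ge0.
rewrite ler_pXn2r ?nnegrE ?absc_ge0// mxE.
apply: le_trans (_ : \sum_(j < n) absc (T i j * x j ord0) <= _).
  elim/big_ind2 : _ => [|a b c d ab cd|j _]; rewrite ?absc0//.
  exact: le_trans (abscD _ _) (lerD ab cd).
apply: ler_sum => j _; rewrite abscM ler_piMr ?absc_ge0//.
exact: le_trans (absc_entry_le _ _) x1.
Qed.

Lemma l2norm_mulmx_le T x : l2norm (T *m x) <= opnorm T * l2norm x.
Proof.
have [x0|x0] := eqVneq (l2norm x) 0.
  by rewrite (l2norm_eq0 x0) mulmx0 !l2norm0 mulr0.
have xp : 0 < l2norm x by rewrite lt_neqAle eq_sym x0 l2norm_ge0.
rewrite -ler_pdivrMr//; apply: (sup_upper_bound (opnorm_set_bounded T)).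
exists ((l2norm x)^-1%:C *: x).
  by rewrite /= l2normZ absc_real ger0_norm ?invr_ge0 ?l2norm_ge0// mulVf.
by rewrite -scalemxAr l2normZ absc_real ger0_norm ?invr_ge0 ?l2norm_ge0// mulrC.
Qed.

Lemma opnorm_le T c : 0 <= c -> (forall x, l2norm (T *m x) <= c * l2norm x) ->
  opnorm T <= c.
Proof.
move=> c0 h; apply: ge_sup; first by have [] := opnorm_set_bounded T.
by move=> _ [x /= x1 <-]; apply: le_trans (h x) _; rewrite ler_piMr.
Qed.

Lemma contractionP T : contractions T <-> forall x, l2norm (T *m x) <= l2norm x.
Proof.
split=> [h x|h].
  by apply: le_trans (l2norm_mulmx_le T x) _; rewrite ler_piMl ?l2norm_ge0.
by apply: opnorm_le => // x; rewrite mul1r.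
Qed.

End HilbertSpace.

(** * Blaschke factors and the resolvent on the unit circle *)

Ltac vec_ring := apply/matrixP => ? ?; rewrite !mxE; ring.

Section BlaschkeAlgebra.
Variables (F : fieldType) (n : nat).
Implicit Types (a b c e l z : F).

(** Here [b0], [b1], [b2] stand for g, A g, A (A g): the factors A - a and 1 - b A commute. The
    operator is kept out of sight so that the identity is purely scalar in each entry. *)
Lemma factor_swap a b (b0 b1 b2 : 'cV[F]_n) :
  (b1 - a *: b0) - b *: (b2 - a *: b1) = (b1 - b *: b2) - a *: (b0 - b *: b1).
Proof. by vec_ring. Qed.

Lemma factor_swap_resolvent a b (b0 b1 b2 : 'cV[F]_n) :
  (b0 - a *: b1) - b *: (b1 - a *: b2) = (b0 - b *: b1) - a *: (b1 - b *: b2).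
Proof. by vec_ring. Qed.

Lemma factor_lin a l (b0 b1 c0 c1 : 'cV[F]_n) :
  b1 - a *: c1 - l *: (b0 - a *: c0) = (b1 - l *: b0) - a *: (c1 - l *: c0).
Proof. by vec_ring. Qed.

(** With [z] and [lc] read as the conjugates of z and l, the first coefficient is the conjugate of
    the Blaschke factor (z - l) / (1 - conj(l) z), and the second is the weight of the remaining
    resolvent term. *)
Lemma blaschke_scalars l lc z : 1 - l * z != 0 ->
  1 = - ((z - lc) / (1 - l * z) * l) + (1 - l * lc) / (1 - l * z) /\
  - lc = (z - lc) / (1 - l * z) - (1 - l * lc) / (1 - l * z) * z.
Proof. by move=> d0; split; field. Qed.

Lemma blaschke_split a c e l z (b0 b1 : 'cV[F]_n) : 1 = - (c * l) + e -> - a = c - e * z ->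
  b0 - a *: b1 = c *: (b1 - l *: b0) + e *: (b0 - z *: b1).
Proof.
move=> e1 e2; rewrite -[b0 in LHS]scale1r -scaleNr e2 {1}e1; vec_ring.
Qed.

End BlaschkeAlgebra.

(** The price of one zero: in [1 - q ^+ 2] the factor [1 - q] is absorbed by [D] and leaves 1 + q <=
    2, while the [1 - q] dividing [X] is at least [1 - r]. *)
Lemma blaschke_gain (R : realFieldType) (q r D G X : R) : 0 <= q -> q <= r -> r < 1 ->
  1 - q <= D -> 0 <= G -> G <= X / (1 - q) ->
  (1 - q ^+ 2) / D * G <= 2 / (1 - r) * X.
Proof.
move=> q0 qr r1 qD G0 GX; have q1 : q < 1 by exact: le_lt_trans r1.
have q1' : 0 < 1 - q by rewrite subr_gt0.
have D0 : 0 < D by exact: lt_le_trans qD.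
have X0 : 0 <= X by have := le_trans G0 GX; rewrite pmulr_lge0 ?invr_gt0.
apply: (@le_trans _ _ (2 * (X / (1 - q)))); last first.
  rewrite [leRHS]mulrAC -mulrA ler_pM2l// ler_wpM2l// lef_pV2 ?posrE ?subr_gt0//.
  by rewrite lerD2l lerN2.
apply: ler_pM => //; first by rewrite divr_ge0 ?ltW// subr_gt0 expr_lt1.
rewrite ler_pdivrMr//; apply: le_trans (_ : 2 * (1 - q) <= _); last by rewrite ler_pM2l.
rewrite (_ : 1 - _ = (1 + q) * (1 - q)); last by ring.
by rewrite ler_wpM2r ?(ltW q1')// -[leRHS]/(1 + 1) lerD2l ltW.
Qed.

Section Resolvent.
Variables (R : realType) (n : nat) (A : 'cV[R[i]]_n -> 'cV[R[i]]_n).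
Implicit Types (x y u : 'cV[R[i]]_n) (l z w a : R[i]).

Hypothesis linA : forall x a y, A (x - a *: y) = A x - a *: A y.
Hypothesis contrA : forall x, l2norm (A x) <= l2norm x.

Fixpoint zeros_vec (s : seq R[i]) u : 'cV[R[i]]_n :=
  if s is l :: s' then zeros_vec s' (A u - l *: u) else u.

Lemma zeros_vec_lin s x a y : zeros_vec s (x - a *: y) = zeros_vec s x - a *: zeros_vec s y.
Proof.
elim: s x y => [//|l s ih] x y /=; by rewrite -ih linA factor_lin.
Qed.

Lemma zeros_vec_comm s x : A (zeros_vec s x) = zeros_vec s (A x).
Proof. by elim: s x => [//|l s ih] x /=; rewrite ih linA. Qed.

Lemma l2norm_resolvent_lower l x :
  (1 - absc l) * l2norm x <= l2norm (x - l *: A x).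
Proof.
apply: le_trans (l2norm_subr _ _); rewrite l2normZ mulrBl mul1r lerD2l lerN2.
by rewrite ler_wpM2l ?absc_ge0.
Qed.

Lemma resolvent_inj l x : absc l < 1 -> x - l *: A x = 0 -> x = 0.
Proof.
move=> l1 E; have := l2norm_resolvent_lower l x.
rewrite E l2norm0 pmulr_rle0 ?subr_gt0// => h.
by apply/l2norm_eq0/le_anti; rewrite h l2norm_ge0.
Qed.

(** The squared norms differ by (1 - |l|^2) (|x|^2 - |A x|^2). This is the contractivity of a
    Blaschke factor of A, stated without an inverse; it serves again for the extremal matrix. *)
Lemma mobius_contraction l x : absc l <= 1 ->
  l2norm (A x - l *: x) <= l2norm (x - l^* *: A x).
Proof.
move=> l1; rewrite -(ler_pXn2r (_ : 0 < 2)%N)// ?nnegrE ?l2norm_ge0//.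
rewrite !l2norm_sqrBZ absc_conj conjCK -(ip_conj (A x) x).
have -> : complex.Re (l * (ip (A x) x)^*) = complex.Re (l^* * ip (A x) x).
  by rewrite -Re_conj rmorphM/= conjCK.
have h : l2norm (A x) ^+ 2 <= l2norm x ^+ 2 by rewrite ler_pXn2r// ?nnegrE ?l2norm_ge0.
have l2 : absc l ^+ 2 <= 1 by rewrite expr_le1 ?absc_ge0.
rewrite -subr_ge0.
rewrite [leRHS](_ : _ = (1 - absc l ^+ 2) * (l2norm x ^+ 2 - l2norm (A x) ^+ 2)); last by ring.
by rewrite mulr_ge0 ?subr_ge0.
Qed.

Hypothesis resolvent_surj : forall l u, absc l < 1 -> exists g, u = g - l *: A g.

(* With [g = (1 - l^* A)^-1 u], the Blaschke factor [b] of [l] satisfies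
   [u - (b z)^* b(A) u = (1-|l|^2) / (1 - l z^* ) (g - z^* A g)], and [b(A)] is a
   contraction; peeling off the factors one by one leaves [0]. *)
Lemma resolvent_bound (r : R) s z u : r < 1 -> (forall l, l \in s -> absc l <= r) ->
  absc z = 1 -> zeros_vec s u = 0 ->
  l2norm u <= 2 * (size s)%:R / (1 - r) * l2norm (u - z^* *: A u).
Proof.
move=> r1 sr z1; have r1' : 0 < 1 - r by rewrite subr_gt0.
elim: s sr u => [|l s ih] sr u /=.
  by move=> ->; rewrite l2norm0 mulr_ge0 ?l2norm_ge0// mulr0 mul0r.
move=> Pu.
have lr : absc l <= r by apply: sr; rewrite mem_head.
have l1 : absc l < 1 by exact: le_lt_trans r1.
have [g ug] : exists g, u = g - l^* *: A g by apply: resolvent_surj; rewrite absc_conj.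
pose v := A g - l *: g.
(* Applying 1 - conj(l) A to the left side gives the product of all factors, that of [l] included,
   at [u], which is 0; that operator is injective. *)
have Pv : zeros_vec s v = 0.
  apply: (@resolvent_inj l^*); first by rewrite absc_conj.
  rewrite zeros_vec_comm -zeros_vec_lin -[RHS]Pu.
  by congr zeros_vec; rewrite /v ug !linA factor_swap.
pose x := u - z^* *: A u; pose g' := g - z^* *: A g.
have xg : x = g' - l^* *: A g'.
  by rewrite /x ug /g' !linA factor_swap_resolvent.
have vg : v - z^* *: A v = A g' - l *: g'.
  by rewrite /v /g' !linA factor_swap.
have sr' l' : l' \in s -> absc l' <= r by move=> l's; apply: sr; rewrite inE l's orbT.
have := ih sr' v Pv; rewrite vg => ihv.
have ihv' : l2norm v <= 2 * (size s)%:R / (1 - r) * l2norm x.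
  apply: le_trans ihv _; rewrite ler_wpM2l//.
    by rewrite divr_ge0 ?mulr_ge0// ltW.
  by rewrite xg; apply: mobius_contraction; exact: ltW.
have g'x : l2norm g' <= l2norm x / (1 - absc l).
  rewrite ler_pdivlMr ?subr_gt0// mulrC xg -(absc_conj l).
  exact: l2norm_resolvent_lower.
pose d := 1 - l * z^*.
have dl : 1 - absc l <= absc d.
  by have := ler_abscB 1 (l * z^*); rewrite absc1 abscM absc_conj z1 mulr1.
have d0 : d != 0 by rewrite -absc_gt0 (lt_le_trans _ dl)// subr_gt0.
pose c := (z^* - l^*) / d.
have c1 : absc c = 1.
  rewrite /c abscM abscV; have -> : absc (z^* - l^*) = absc d; last by rewrite divff// absc_eq0.
  have -> : d = z^* * (z - l).
    by rewrite mulrBr [z^* * z]mulrC mulc_conj z1 expr1n /d [l * _]mulrC.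
  by rewrite abscM absc_conj z1 mul1r -rmorphB absc_conj.
have uv : u = c *: v + ((1 - absc l ^+ 2)%:C / d) *: g'.
  have ll : (1 - absc l ^+ 2)%:C = 1 - l * l^* by rewrite rmorphB/= mulc_conj.
  have [e1 e2] := blaschke_scalars l^* d0.
  by rewrite ll {1}ug (blaschke_split _ _ e1 e2).
have le1 := blaschke_gain (absc_ge0 l) lr r1 dl (l2norm_ge0 g') g'x.
have q2 : 0 <= 1 - absc l ^+ 2 by rewrite subr_ge0 expr_le1 ?absc_ge0// ltW.
have {}uv : l2norm u <= l2norm v + (1 - absc l ^+ 2) / absc d * l2norm g'.
  rewrite {1}uv; apply: le_trans (l2normD _ _) _.
  by rewrite !l2normZ c1 mul1r abscM abscV absc_real (ger0_norm q2).
apply: (le_trans uv); apply: (le_trans (lerD ihv' le1)).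
by apply: eq_ler => /=; rewrite -[(size s).+1]addn1 natrD; ring.
Qed.

End Resolvent.

Section MatrixResolvent.
Variables (R : realType) (n : nat) (T : 'M[R[i]]_n.+1).
Implicit Types (x u : 'cV[R[i]]_n.+1).

Lemma mulmx_lin x a u : T *m (x - a *: u) = T *m x - a *: (T *m u).
Proof. by rewrite mulmxBr -scalemxAr. Qed.

Lemma horner_mx_zeros_vec s u :
  horner_mx T (poly_of_zeros s) *m u = zeros_vec (mulmx T) s u.
Proof.
elim: s u => [|l s ih] u; first by rewrite /poly_of_zeros big_nil rmorph1 mul1mx.
rewrite /= -ih /poly_of_zeros big_cons mulrC rmorphM/= -mulmxE -mulmxA; congr (_ *m _).
by rewrite rmorphB/= horner_mx_X horner_mx_C mulmxBl mul_scalar_mx.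
Qed.

Lemma contraction_resolvent_surj (l : R[i]) u :
  (forall x : 'cV_n.+1, l2norm (T *m x) <= l2norm x) -> absc l < 1 ->
  exists g, u = g - l *: (T *m g).
Proof.
move=> contrT l1.
have Tu : 1%:M - l *: T \in unitmx.
  rewrite unitmxE unitfE -det_tr; apply/negP => /det0P[v v0 vA].
  have Ev : v^T - l *: (T *m v^T) = 0.
    by have := congr1 trmx vA; rewrite trmx_mul trmxK trmx0 mulmxBl mul1mx -scalemxAl.
  move/negP: v0; apply; rewrite -trmx_eq0; apply/eqP.
  exact: (resolvent_inj contrT l1).
exists (invmx (1%:M - l *: T) *m u).
by rewrite scalemxAl -{1}(mul1mx (invmx _ *m u)) -mulmxBl mulKVmx.
Qed.

End MatrixResolvent.

Section ContinuityClosure.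
Variable R : realType.
Implicit Types (phi psi : R -> R[i]) (t : R).

Lemma ccont_cst (c : R[i]) t : ccont (fun=> c) t.
Proof. by move=> e e0; exists 1 => // t' _; rewrite subrr absc0. Qed.

Lemma ccontD phi psi t : ccont phi t -> ccont psi t -> ccont (fun t => phi t + psi t) t.
Proof.
move=> h1 h2 e e0; have e2 : 0 < e / 2 by rewrite divr_gt0.
have [d1 d10 {}h1] := h1 _ e2; have [d2 d20 {}h2] := h2 _ e2.
exists (Num.min d1 d2); first by rewrite lt_min d10.
move=> t'; rewrite lt_min => /andP[/h1 k1 /h2 k2].
rewrite opprD addrACA (splitr e); exact: le_lt_trans (abscD _ _) (ltrD k1 k2).
Qed.

Lemma ccontM phi psi t : ccont phi t -> ccont psi t -> ccont (fun t => phi t * psi t) t.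
Proof.
move=> h1 h2 e e0; pose a := absc (phi t) + 1; pose b := absc (psi t) + 1.
have a0 : 0 < a by rewrite ltr_wpDl ?absc_ge0.
have b0 : 0 < b by rewrite ltr_wpDl ?absc_ge0.
have e1 : 0 < Num.min 1 (e / 2 / b) by rewrite lt_min ltr01 !divr_gt0.
have e2 : 0 < e / 2 / a by rewrite !divr_gt0.
have [d1 d10 {}h1] := h1 _ e1; have [d2 d20 {}h2] := h2 _ e2.
exists (Num.min d1 d2); first by rewrite lt_min d10.
move=> t'; rewrite lt_min => /andP[/h1 k1 /h2 k2].
move: k1; rewrite lt_min => /andP[k1 k1'].
have pa : absc (phi t') <= a.
  by have := ler_abscB (phi t') (phi t); rewrite /a; lra.
rewrite (_ : _ - _ = phi t' * (psi t' - psi t) + (phi t' - phi t) * psi t); last by ring.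
apply: le_lt_trans (abscD _ _) _; rewrite !abscM (splitr e) ltr_leD//.
  rewrite -[e / 2](divfK (lt0r_neq0 a0)) [ltRHS]mulrC.
  apply: (@le_lt_trans _ _ (a * absc (psi t' - psi t))); first by rewrite ler_wpM2r ?absc_ge0.
  by rewrite ltr_pM2l.
rewrite -[e / 2](divfK (lt0r_neq0 b0)); apply: ler_pM;
  [exact: absc_ge0|exact: absc_ge0|exact: ltW|by rewrite lerDl].
Qed.

Lemma ccont_conj phi t : ccont phi t -> ccont (fun t => (phi t)^*) t.
Proof. by move=> h e /h[d d0 hd]; exists d => // t' /hd; rewrite -rmorphB absc_conj. Qed.

(** Away from zeros of [f] the power is differentiable. At a zero that argument is replaced by f^p
    <= f for f <= 1, which is where [1 <= p] enters. *)
Lemma continuous_powR_comp (f : R -> R) (p t : R) : 1 <= p -> (forall u, 0 <= f u) ->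
  {for t, continuous f} -> {for t, continuous (fun u => f u `^ p)}.
Proof.
move=> p1 f0 cf; have p0 : p != 0 by rewrite gt_eqF// (lt_le_trans ltr01).
have := f0 t; rewrite le_eqVlt => /predU1P[ft|ft]; last first.
  apply: (@continuous_comp _ _ _ f (fun x => x `^ p)); first exact: cf.
  have /derivable1_diffP/differentiable_continuous// : derivable (fun x : R => x `^ p) (f t) 1.
  by apply: derivable_powR; rewrite in_itv/= ft.
apply/cvgrPdist_lt => e e0; rewrite -ft powR0//.
have e1 : 0 < Num.min e 1 by rewrite lt_min e0 ltr01.
move/cvgrPdist_lt: cf => /(_ _ e1); apply: filterS => u.
rewrite -ft !sub0r !normrN ger0_norm// ger0_norm ?powR_ge0// lt_min => /andP[fe f1].
apply: le_lt_trans fe; have := f0 u; rewrite le_eqVlt => /predU1P[<-|fu].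
  by rewrite powR0.
by rewrite ge1r_powR// fu ltW.
Qed.

End ContinuityClosure.

(** [x'] and [u'] stand for T x and T u, and the second premise says (1 - w T) u = (T - l) x. *)
Lemma newton_step (F : fieldType) (n : nat) (l w : F) (x x' u u' : 'cV[F]_n) :
  1 - w * l != 0 -> u - w *: u' = x' - l *: x ->
  (1 - w * l)^-1 *: (x + w *: u) - w *: ((1 - w * l)^-1 *: (x' + w *: u')) = x.
Proof.
move=> lw E; have -> : u = x' - l *: x + w *: u' by rewrite -E subrK.
by apply/matrixP => i j; rewrite !mxE; field.
Qed.

(** * The resolvent as an explicit rational function *)

Section NewtonResolvent.
Variables (R : realType) (n : nat) (T : 'M[R[i]]_n.+1).
Implicit Types (s : seq R[i]) (x y : 'cV[R[i]]_n.+1) (z w : R[i]).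

(* Newton's expansion of [(1 - w T)^-1 x] along the zeros [s] of an annihilating
   polynomial: it makes the dependence on [w] an explicit rational function. *)
Fixpoint resolvent_vec s w x : 'cV[R[i]]_n.+1 :=
  if s is l :: s' then
    (1 - w * l)^-1 *: (x + w *: resolvent_vec s' w (T *m x - l *: x))
  else 0.

Lemma resolvent_vecP s w x : horner_mx T (poly_of_zeros s) *m x = 0 ->
  (forall l, l \in s -> 1 - w * l != 0) ->
  resolvent_vec s w x - w *: (T *m resolvent_vec s w x) = x.
Proof.
elim: s x => [|l s ih] x; first by rewrite horner_mx_zeros_vec /= => ->;
  rewrite mulmx0 scaler0 subr0.
rewrite horner_mx_zeros_vec /= -horner_mx_zeros_vec => Px sw.
have lw : 1 - w * l != 0 by apply: sw; rewrite mem_head.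
have := ih _ Px (fun l' l's => sw l' (mem_behead (s := l :: s) l's)).
set u' := resolvent_vec _ _ _ => E.
rewrite -scalemxAr mulmxDr -scalemxAr.
apply: newton_step => //.
Qed.

Lemma resolvent_vec_mulmx s w x :
  resolvent_vec s w (T *m x) = T *m resolvent_vec s w x.
Proof.
elim: s x => [|l s ih] x /=; first by rewrite mulmx0.
by rewrite -!scalemxAr mulmxDr -scalemxAr -ih mulmxBr -scalemxAr.
Qed.

Lemma resolvent_vec_cdiff s w x y : (forall l, l \in s -> 1 - w * l != 0) ->
  cdiff (fun w => ip (resolvent_vec s w x) y) w.
Proof.
elim: s x => [|l s ih] x sw /=; first by under eq_fun do rewrite ip0l; exact: cdiff_cst.
under eq_fun do rewrite ipZl ipDl ipZl.
apply: cdiffM; last apply: cdiffD; first apply: cdiffV.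
- by apply: sw; rewrite mem_head.
- apply: cdiffB; first exact: cdiff_cst.
  by apply: cdiffM; [exact: cdiff_id|exact: cdiff_cst].
- exact: cdiff_cst.
- apply: cdiffM; first exact: cdiff_id.
  by apply: ih => l' l's; apply: sw; rewrite inE l's orbT.
Qed.

(** The polynomial clears every denominator 1 - l/z and even leaves a factor z. So h times this
    product is holomorphic and vanishes at 0, which is why the term [P_s h] has mean 0. *)
Lemma resolvent_vec_poly s x y : exists2 H : {poly R[i]}, H.[0] = 0 &
  forall z, z != 0 -> (forall l, l \in s -> z != l) ->
  (poly_of_zeros s).[z] * ip (resolvent_vec s z^-1 x) y = H.[z].
Proof.
elim: s x => [|l s ih] x /=.
  by exists 0 => [|z _ _]; rewrite ?horner0// ip0l mulr0.
have [H H0 HP] := ih (T *m x - l *: x).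
exists ((ip x y)%:P * 'X * poly_of_zeros s + H).
  by rewrite hornerD !hornerM hornerX H0 mulr0 mul0r addr0.
move=> z z0 zs; have zl : z - l != 0 by rewrite subr_eq0 zs// mem_head.
rewrite [in RHS]hornerD -HP// => [|l' l's]; last by apply: zs; rewrite inE l's orbT.
rewrite /poly_of_zeros big_cons !hornerM hornerXsubC hornerX hornerC ipZl ipDl ipZl.
have -> : 1 - z^-1 * l = (z - l) / z by rewrite mulrBl divff// [l / z]mulrC.
move: (ip x y) (ip _ y) (horner _ z) => a b c; move: z0 zl; clear.
by move=> z0 zl; field; rewrite z0.
Qed.

End NewtonResolvent.

(** * The upper estimate on circles *)

Section RealMean.
Variable R : realType.
Implicit Types (phi psi : R -> R[i]).

Definition remean phi : R := segint (fun t => complex.Re (phi t)) 0 (2 * pi).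

Lemma remean_cont phi : (forall t, ccont phi t) ->
  seg_cont (fun t => complex.Re (phi t)) 0 (2 * pi).
Proof. by move=> h t _; exact: ccont_Re. Qed.

Lemma remeanD phi psi : (forall t, ccont phi t) -> (forall t, ccont psi t) ->
  remean (fun t => phi t + psi t) = remean phi + remean psi.
Proof.
move=> h1 h2; rewrite /remean -segintD; [|exact: remean_cont|exact: remean_cont].
by apply: eq_segint => t _; rewrite ReD.
Qed.

Lemma remeanB phi psi : (forall t, ccont phi t) -> (forall t, ccont psi t) ->
  remean (fun t => phi t - psi t) = remean phi - remean psi.
Proof.
move=> h1 h2; rewrite /remean -segintB; [|exact: remean_cont|exact: remean_cont].
by apply: eq_segint => t _; rewrite ReB.
Qed.

Lemma eq_remean phi psi : (forall t, complex.Re (phi t) = complex.Re (psi t)) ->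
  remean phi = remean psi.
Proof. by move=> h; apply: eq_segint => t _. Qed.

End RealMean.

(** The resolvent identity applied to a vector; [v] and [v'] stand for T u and T u'. *)
Lemma resolvent_diff (F : fieldType) (n : nat) (a b : F) (u u' v v' x : 'cV[F]_n) :
  u - a *: v = x -> u' - b *: v' = x -> u - u' - a *: (v - v') = (a - b) *: v'.
Proof.
move=> /(canRL (subrK _)) -> /(canRL (subrK _)) ->.
by vec_ring.
Qed.

(** With [a] = T u and [b] = T v the vectors [u - w *: a] and [v - w *: b] are the x and y of the
    kernel, which thus becomes a defect form in the resolvent vectors. *)
Lemma kernel_identity (R : realType) (n : nat) (u v a b : 'cV[R[i]]_n) (w : R[i]) :
  ip u (v - w *: b) + ip (u - w *: a) v - ip (u - w *: a) (v - w *: b) =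
  ip u v - w * w^* * ip a b.
Proof.
rewrite !(ipDl, ipDr, ipNl, ipNr, ipZl, ipZr).
move: (ip u v) (ip u b) (ip a v) (ip a b) w^* => c d e f g; ring.
Qed.

Lemma kernel_identity_real (R : realType) (n : nat) (u a : 'cV[R[i]]_n) (w : R[i]) :
  2 * complex.Re (ip u (u - w *: a)) - l2norm (u - w *: a) ^+ 2 =
  l2norm u ^+ 2 - absc w ^+ 2 * l2norm a ^+ 2.
Proof. by rewrite l2norm_sqrBZ ipDr ipNr ipZr ipxx ReB /=; ring. Qed.

Lemma majorant_arith (R : realFieldType) (e a b u v tu tv : R) : 0 <= e ->
  tu <= u -> tv <= v -> a <= ((u - tu) + (v - tv)) / 2 -> b <= (tu + tv) / 2 ->
  a + e * b <= ((u - (1 + e) * tu + 2 * e * u) + (v - (1 + e) * tv + 2 * e * v)) / 2.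
Proof.
move=> e0 /(ler_wpM2l e0) e1 /(ler_wpM2l e0) e2 h /(ler_wpM2l e0) e3; lra.
Qed.

(** * The reproducing kernel on a circle close to the unit circle *)

Section Kernel.
Variables (R : realType) (n : nat) (T : 'M[R[i]]_n.+1).
Hypothesis contrT : forall x : 'cV_n.+1, l2norm (T *m x) <= l2norm x.
Variables (s : seq R[i]) (r : R).
Hypotheses (r0 : 0 <= r) (r1 : r < 1) (sr : forall l, l \in s -> absc l <= r).
Hypotheses (s0 : (0 < size s)%N) (PT : horner_mx T (poly_of_zeros s) = 0).
Variables (M rho : R).
Hypothesis ME : M = (size s)%:R / (1 - r).
Hypothesis rho1 : rho < 1.
Hypothesis rhoM : 1 - (8 * M)^-1 <= rho.
Implicit Types (x y : 'cV[R[i]]_n.+1) (z : R[i]).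

(** [U] reproduces the functional calculus but its kernel is only almost positive; [U'], taken at a
    point of modulus below 1, has a positive kernel and serves for comparison. *)
Let U x z := resolvent_vec T s z^-1 x.
Let U' x z := resolvent_vec T s z^* x.

Lemma M_ge1 : 1 <= M.
Proof.
rewrite ME ler_pdivlMr ?subr_gt0// mul1r.
have : 1 <= (size s)%:R :> R by rewrite ler1n.
have := r0; lra.
Qed.

Lemma rho_gap : (1 - rho) * M <= 1 / 8.
Proof.
have M0 : 0 < M := lt_le_trans ltr01 M_ge1.
have h : 1 - rho <= (8 * M)^-1 by have := rhoM; lra.
rewrite (le_trans (ler_wpM2r (ltW M0) h))// invfM mulfVK ?gt_eqF//; lra.
Qed.

Lemma rho_ge : 7 / 8 <= rho.
Proof.
have h : 1 - rho <= (1 - rho) * M by rewrite ler_peMr ?M_ge1// subr_ge0 ltW.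
have := rho_gap; lra.
Qed.

Lemma rho_gt0 : 0 < rho.
Proof. by apply: lt_le_trans rho_ge; lra. Qed.

(** The square is what matters: 1/z is rewritten as rho^-2 times the conjugate of z, and the latter
    expression is continued to the whole unit disc, where it must avoid the poles. *)
Lemma r_lt_rho2 : r < rho ^+ 2.
Proof.
have r1' : 0 < 1 - r by rewrite subr_gt0.
(* Since [M] is at least 1 / (1 - r); then rho^2 >= 1 - 2 (1 - rho) >= 1 - (1 - r) / 4 > r. *)
have h : 1 - rho <= (1 - r) / 8.
  have := rho_gap; rewrite ME mulrA ler_pdivrMr// => h.
  have s1 : 1 <= (size s)%:R :> R by rewrite ler1n.
  apply: le_trans (_ : (1 - rho) * (size s)%:R <= _).
    by rewrite ler_peMr// subr_ge0 ltW.
  by apply: (le_trans h); lra.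
have := sqr_ge0 (1 - rho); rewrite sqrrB expr1n mul1r; move: r1' h.
rewrite mulr2n; lra.
Qed.

Lemma unit_small w l : l \in s -> absc w * r < 1 -> 1 - w * l != 0.
Proof.
move=> ls wr; apply/eqP => E.
have := ler_abscB 1 (w * l); rewrite E absc0 absc1 abscM subr_le0 => h.
have : absc w * absc l <= absc w * r by rewrite ler_wpM2l ?absc_ge0// sr.
lra.
Qed.

Lemma unit_inv z l : absc z = rho -> l \in s -> 1 - z^-1 * l != 0.
Proof.
move=> zr ls; apply: unit_small => //; rewrite abscV zr mulrC ltr_pdivrMr ?rho_gt0//.
rewrite mul1r; apply: lt_le_trans r_lt_rho2 _.
by rewrite expr2 ler_piMl ?ltW// ?rho_gt0.
Qed.

Lemma unit_conj z l : absc z = rho -> l \in s -> 1 - z^* * l != 0.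
Proof.
move=> zr ls; apply: unit_small => //; rewrite absc_conj zr.
by apply: le_lt_trans r1; rewrite ler_piMl// ltW.
Qed.

Lemma PTx x : horner_mx T (poly_of_zeros s) *m x = 0.
Proof. by rewrite PT mul0mx. Qed.

Lemma UP x z : absc z = rho -> U x z - z^-1 *: (T *m U x z) = x.
Proof. by move=> zr; apply: resolvent_vecP; [exact: PTx|move=> l; exact: unit_inv]. Qed.

Lemma U'P x z : absc z = rho -> U' x z - z^* *: (T *m U' x z) = x.
Proof. by move=> zr; apply: resolvent_vecP; [exact: PTx|move=> l; exact: unit_conj]. Qed.

Lemma z_neq0 z : absc z = rho -> z != 0.
Proof. by move=> zr; rewrite -absc_gt0 zr rho_gt0. Qed.

Lemma inv_conj z : absc z = rho -> z^-1 = (rho ^- 2)%:C * z^*.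
Proof.
move=> zr; apply: (mulfI (z_neq0 zr)); rewrite divff ?z_neq0// mulrCA mulc_conj zr.
by rewrite -rmorphM/= mulVf// expf_neq0// gt_eqF// rho_gt0.
Qed.

(** The bound 2 M holds at the radial projection [zeta] of [z]. Moving back to [z] costs 2 M (1 -
    rho) / rho |v|, at most half of |v|, which is absorbed on the left and doubles the constant. *)
Lemma resolvent_near_circle z v : absc z = rho ->
  l2norm v <= 4 * M * l2norm (v - z^-1 *: (T *m v)).
Proof.
move=> zr; pose zeta := z / rho%:C.
have r0' : rho%:C != 0 by rewrite -absc_eq0 absc_real normr_eq0 gt_eqF// rho_gt0.
have az : absc zeta = 1.
  by rewrite /zeta abscM abscV absc_real zr ger0_norm ?ltW ?rho_gt0// divff// gt_eqF// rho_gt0.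
have zc : zeta^* = rho%:C * z^-1.
  rewrite inv_conj// /zeta rmorphM/= fmorphV/= mulrA [z^* / _]mulrC; congr (_ * _).
  have -> : (rho%:C)^* = rho%:C by simpc.
  rewrite -rmorphM/= -fmorphV/=; congr (_%:C).
  by field; rewrite gt_eqF// rho_gt0.
have Pv : zeros_vec (mulmx T) s v = 0 by rewrite -horner_mx_zeros_vec PTx.
have := resolvent_bound (mulmx_lin T) contrT
  (fun l u => contraction_resolvent_surj u contrT) r1 sr az Pv.
rewrite (_ : 2 * (size s)%:R / (1 - r) = 2 * M); last by rewrite ME mulrA.
rewrite zc; set X := l2norm (v - z^-1 *: _).
have -> : v - (rho%:C * z^-1) *: (T *m v) =
    (v - z^-1 *: (T *m v)) + ((1 - rho)%:C * z^-1) *: (T *m v).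
  by rewrite rmorphB/= mulrBl mul1r scalerBl addrA subrK.
move=> h; have M0 : 0 < M := lt_le_trans ltr01 M_ge1.
have rg0 := rho_gt0.
have : 2 * M * ((1 - rho) / rho) <= 1 / 2.
  rewrite mulrA ler_pdivrMr//; have := rho_gap; have := rho_ge.
  by rewrite -mulrA [M * _]mulrC; lra.
set k := (1 - rho) / rho => kM.
have k0 : 0 <= k by rewrite divr_ge0// ?subr_ge0 ltW.
have h2 : l2norm v <= 2 * M * (X + k * l2norm v).
  apply: (le_trans h); rewrite ler_pM2l ?mulr_gt0//.
  apply: (le_trans (l2normD _ _)); rewrite lerD2l l2normZ abscM abscV absc_real zr.
  rewrite ger0_norm ?subr_ge0; last exact: ltW.
  by rewrite ler_wpM2l.
have h3 : 2 * M * k * l2norm v <= 1 / 2 * l2norm v by rewrite ler_wpM2r ?l2norm_ge0.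
rewrite -mulrA; move: h2.
rewrite (_ : 2 * M * (X + _) = 2 * (M * X) + 2 * M * k * l2norm v); last by ring.
by move: h3; set Y := M * X; lra.
Qed.

Lemma resolvent_vec_bound z x : absc z = rho -> l2norm (U x z) <= 4 * M * l2norm x.
Proof. by move=> zr; have := resolvent_near_circle (U x z) zr; rewrite UP. Qed.

(** By the resolvent identity U - U' is the resolvent at 1/z of (1/z - conj z) T U'. The bound 4 M
    times rho^-1 - rho is at most 2, so |U - U'| <= 2 |U'|. *)
Lemma resolvent_vec_compare z x : absc z = rho -> l2norm (U x z) <= 3 * l2norm (U' x z).
Proof.
move=> zr; have := resolvent_near_circle (U x z - U' x z) zr.
have -> : U x z - U' x z - z^-1 *: (T *m (U x z - U' x z)) =
    (z^-1 - z^*) *: (T *m U' x z).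
  by rewrite mulmxBr; apply: resolvent_diff (UP x zr) (U'P x zr).
rewrite l2normZ => h.
have rg0 := rho_gt0; have M0 : 0 < M := lt_le_trans ltr01 M_ge1.
have zz : absc (z^-1 - z^*) = rho^-1 - rho.
  rewrite inv_conj// -{2}[z^*]mul1r -mulrBl abscM absc_conj zr.
  have -> : (rho ^- 2)%:C - 1 = (rho ^- 2 - 1)%:C by rewrite rmorphB.
  rewrite absc_real ger0_norm; first by field; rewrite gt_eqF.
  by rewrite subr_ge0 invf_ge1 ?exprn_gt0// expr_le1// ltW.
have kM : 4 * M * (rho^-1 - rho) <= 2.
  have -> : rho^-1 - rho = (1 - rho) * (1 + rho) / rho by field; rewrite gt_eqF.
  rewrite mulrA ler_pdivrMr//; have := rho_gap; have := rho_ge => g1 g2.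
  have : (1 - rho) * M * (1 + rho) <= 1 / 8 * (1 + rho) by rewrite ler_wpM2r// addr_ge0// ltW.
  by rewrite (_ : 4 * M * _ = 4 * ((1 - rho) * M * (1 + rho))); [lra|ring].
rewrite zz in h.
have h2 : 4 * M * ((rho^-1 - rho) * l2norm (T *m U' x z)) <= 2 * l2norm (U' x z).
  rewrite mulrA; apply: ler_pM => //; last exact: l2norm_ge0.
  by rewrite mulr_ge0 ?mulr_ge0// ?ltW// -zz absc_gt0 -absc_gt0 zz subr_gt0 (lt_le_trans rho1)// invf_ge1// ltW.
have := l2norm_subr (U x z) (U' x z); lra.
Qed.

Definition kern x y z := ip (U x z) y + ip x (U y z) - ip x y.
Definition kern' x z : R := 2 * complex.Re (ip (U' x z) x) - l2norm x ^+ 2.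
Let eps := rho ^- 2 - 1.
(** The diagonal kernel is |U|^2 - (1 + eps) |T U|^2. One [eps] times |U|^2 compensates its possible
    negativity, the other dominates the off-diagonal term eps <T U x, T U y>. *)
Definition majorant x z : R := complex.Re (kern x x z) + 2 * eps * l2norm (U x z) ^+ 2.

Lemma kernE x y z : absc z = rho ->
  kern x y z = ip (U x z) (U y z) - (rho ^- 2)%:C * ip (T *m U x z) (T *m U y z).
Proof.
move=> zr; have := kernel_identity (U x z) (U y z) (T *m U x z) (T *m U y z) z^-1.
by rewrite !UP// mulc_conj abscV zr exprVn => <-.
Qed.

Lemma eps_ge0 : 0 <= eps.
Proof. by rewrite /eps subr_ge0 invf_ge1 ?exprn_gt0 ?rho_gt0// expr_le1// ltW// rho_gt0. Qed.

Lemma Re_kernE x z : absc z = rho ->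
  complex.Re (kern x x z) = l2norm (U x z) ^+ 2 - rho ^- 2 * l2norm (T *m U x z) ^+ 2.
Proof. by move=> zr; rewrite kernE// !ipxx ReB -rmorphM. Qed.

Lemma kern_majorant x y z : absc z = rho ->
  absc (kern x y z) <= (majorant x z + majorant y z) / 2.
Proof.
move=> zr; rewrite kernE// /majorant !Re_kernE//.
set u := U x z; set v := U y z.
have -> : (rho ^- 2)%:C = 1 + eps%:C by rewrite /eps rmorphB/= addrC subrK.
rewrite mulrDl mul1r opprD addrA.
apply: le_trans (abscD _ _) _; rewrite abscN abscM absc_real (ger0_norm eps_ge0).
have h3 w : l2norm (T *m w) ^+ 2 <= l2norm w ^+ 2.
  by rewrite ler_pXn2r// ?nnegrE ?l2norm_ge0.
have -> : rho ^- 2 = 1 + eps by rewrite /eps addrC subrK.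
apply: majorant_arith eps_ge0 (h3 u) (h3 v) _ (ip_amgm _ _).
exact: defect_form_le.
Qed.

(** The two resolvent terms of the kernel give 8 M. In the correction, |U|^2 <= 16 M^2 |x|^2 becomes
    linear in [M] because eps M <= 1/2, and gives 16 M; the constant 32 leaves slack. *)
Lemma majorant_bound x z : absc z = rho -> majorant x z <= 32 * M * l2norm x ^+ 2.
Proof.
move=> zr; rewrite /majorant /kern.
have uB := resolvent_vec_bound x zr; set u := U x z in uB *.
have M1 := M_ge1; have M0 : 0 < M := lt_le_trans ltr01 M1.
have x0 := l2norm_ge0 x; have u0 := l2norm_ge0 u.
have h1 : complex.Re (ip u x + ip x u - ip x x) <= 8 * M * l2norm x ^+ 2.
  rewrite ReB ReD ipxx -(ip_conj u x) Re_conj.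
  have h : complex.Re (ip u x) <= 4 * M * l2norm x ^+ 2.
    apply: le_trans (Re_le_absc _) _; apply: le_trans (cauchy_schwarz _ _) _.
    by rewrite expr2 [leRHS]mulrA ler_wpM2r.
  rewrite (_ : 8 * M = 4 * M + 4 * M); last by ring.
  rewrite mulrDl; have := sqr_ge0 (l2norm x); move: h => /=; lra.
have h2 : l2norm u ^+ 2 <= 16 * M ^+ 2 * l2norm x ^+ 2.
  rewrite (_ : 16 * M ^+ 2 * _ = (4 * M * l2norm x) ^+ 2); last by ring.
  by rewrite ler_pXn2r// nnegrE mulr_ge0// mulr_ge0// ltW.
have eM : eps * M <= 1 / 2.
  have rg0 := rho_gt0; rewrite /eps.
  have -> : rho ^- 2 - 1 = (1 - rho) * (1 + rho) / rho ^+ 2 by field; rewrite gt_eqF.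
  rewrite mulrAC ler_pdivrMr ?exprn_gt0// mulrAC.
  have g := rho_ge.
  apply: le_trans (_ : 1 / 8 * (1 + rho) <= _).
    by rewrite ler_wpM2r ?rho_gap// addr_ge0// ltW.
  have : 7 / 8 * (7 / 8) <= rho ^+ 2 by rewrite expr2; apply: ler_pM => //; lra.
  have := rho1; lra.
have h3 : 2 * eps * l2norm u ^+ 2 <= 16 * M * l2norm x ^+ 2.
  apply: (@le_trans _ _ (2 * eps * (16 * M ^+ 2 * l2norm x ^+ 2))).
    by rewrite ler_wpM2l// mulr_ge0// eps_ge0.
  rewrite (_ : 2 * eps * _ = (2 * (eps * M)) * (16 * M * l2norm x ^+ 2)); last by ring.
  rewrite ler_piMl//; last by move: eM; lra.
  by rewrite mulr_ge0 ?sqr_ge0// mulr_ge0// ltW.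
have h4 : 0 <= M * l2norm x ^+ 2 by rewrite mulr_ge0 ?sqr_ge0// ltW.
apply: (le_trans (lerD h1 h3)); rewrite -!mulrA; move: h4; set Y := M * _; lra.
Qed.

(** The correction is moved to a kernel whose mean is known: |U|^2 <= 9 |U'|^2 and (1 - rho^2)
    |U'|^2 <= [kern']. As rho >= 7/8, the factor 18 rho^-2 is below 24. *)
Lemma majorant_mean_bound x z : absc z = rho ->
  majorant x z <= complex.Re (kern x x z) + 24 * kern' x z.
Proof.
move=> zr; rewrite /majorant lerD2l.
have rg0 := rho_gt0.
have kE : kern' x z = l2norm (U' x z) ^+ 2 - rho ^+ 2 * l2norm (T *m U' x z) ^+ 2.
  have := kernel_identity_real (U' x z) (T *m U' x z) z^*.
  by rewrite U'P// absc_conj zr.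
have h1 := resolvent_vec_compare x zr.
have u0 := l2norm_ge0 (U x z).
have h2 : l2norm (U x z) ^+ 2 <= 9 * l2norm (U' x z) ^+ 2.
  rewrite (_ : 9 * _ = (3 * l2norm (U' x z)) ^+ 2); last by ring.
  by rewrite ler_pXn2r// nnegrE mulr_ge0// l2norm_ge0.
have h3 : (1 - rho ^+ 2) * l2norm (U' x z) ^+ 2 <= kern' x z.
  rewrite kE mulrBl mul1r lerD2l lerN2 ler_wpM2l ?sqr_ge0//.
  by rewrite ler_pXn2r// ?nnegrE ?l2norm_ge0.
have q0 : 0 <= 1 - rho ^+ 2 by rewrite subr_ge0 expr_le1// ltW.
have k0 : 0 <= kern' x z by apply: le_trans h3; rewrite mulr_ge0// sqr_ge0.
have eE : eps = rho ^- 2 * (1 - rho ^+ 2) by rewrite /eps; field; rewrite gt_eqF.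
apply: (@le_trans _ _ (18 * rho ^- 2 * ((1 - rho ^+ 2) * l2norm (U' x z) ^+ 2))).
  rewrite (_ : 18 * rho ^- 2 * _ = 2 * eps * (9 * l2norm (U' x z) ^+ 2)); last by rewrite eE; ring.
  by rewrite ler_wpM2l// mulr_ge0// eps_ge0.
apply: (@le_trans _ _ (18 * rho ^- 2 * kern' x z)).
  by rewrite ler_wpM2l// mulr_ge0// invr_ge0 sqr_ge0.
rewrite ler_wpM2r// ler_pdivrMr ?exprn_gt0//.
have : 7 / 8 * (7 / 8) <= rho ^+ 2 by rewrite expr2; apply: ler_pM; rewrite ?rho_ge//; lra.
lra.
Qed.

End Kernel.

(** * The functional calculus as a circular mean *)

Section KeyEstimate.
Variables (R : realType) (n : nat) (T : 'M[R[i]]_n.+1).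
Hypothesis contrT : forall x : 'cV_n.+1, l2norm (T *m x) <= l2norm x.
Variables (s : seq R[i]) (r : R).
Hypotheses (r0 : 0 <= r) (r1 : r < 1) (sr : forall l, l \in s -> absc l <= r).
Hypotheses (s0 : (0 < size s)%N) (PT : horner_mx T (poly_of_zeros s) = 0).
Variables (M rho : R).
Hypothesis ME : M = (size s)%:R / (1 - r).
Hypothesis rho1 : rho < 1.
Hypothesis rhoM : 1 - (8 * M)^-1 <= rho.
Variable z0 : R[i].
Hypothesis z0E : absc z0 = rho.
Implicit Types (x y : 'cV[R[i]]_n.+1) (z : R[i]).

Let C t := z0 * eit t.
Let rho_gt0' : 0 < rho := rho_gt0 r0 r1 s0 ME rho1 rhoM.

Lemma absc_circle t : absc (C t) = rho.
Proof. by rewrite /C abscM absc_eit mulr1 z0E. Qed.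

(** Conjugating twice makes the second factor holomorphic, so the mean is the value at 0, where the
    resolvent is the identity. The choice k = rho^-2 gives 1/z on the circle, k = 1 gives the
    comparison kernel. *)
Lemma conj_mean (F : R[i] -> R[i]) (k : R) x y :
  (forall z, absc z < 1 -> cdiff F z) -> 0 <= k -> k * r < 1 ->
  remean (fun t => F (C t) * ip x (resolvent_vec T s (k%:C * (C t)^*) y)) =
  2 * pi * complex.Re (F 0 * ip x y).
Proof.
move=> dF k0 kr; pose g1 w := ip (resolvent_vec T s (k%:C * w) y) x.
have dg1 w : absc w < 1 -> cdiff g1 w.
  move=> w1; apply: (@cdiff_comp_scale _ (fun w => ip (resolvent_vec T s w y) x)).
  apply: resolvent_vec_cdiff => l ls; apply: (unit_small sr) => //.
  rewrite abscM absc_real ger0_norm// mulrAC.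
  by apply: le_lt_trans kr; rewrite ler_piMr ?mulr_ge0// ltW.
pose g z := F z * (g1 z^*)^*.
have dg z : absc z < 1 -> cdiff g z.
  move=> z1; apply: cdiffM; first exact: dF.
  by apply: cdiff_conj; apply: dg1; rewrite absc_conj.
have := mean_value (rad := 1) dg (z0 := z0); rewrite z0E => /(_ rho1).
rewrite -/(remean _) (_ : complex.Re (g 0) = complex.Re (F 0 * ip x y)); last first.
  rewrite /g /g1 rmorph0 mulr0 ip_conj; congr (complex.Re (_ * ip x _)).
  have := @resolvent_vecP _ _ T s 0 y; rewrite scale0r subr0; apply.
    by rewrite PT mul0mx.
  by move=> l _; rewrite mul0r subr0 oner_eq0.
by move=> <-; apply: eq_remean => t; rewrite /g /g1 ip_conj.
Qed.

Lemma ccont_resolvent x y t : ccont (fun t => ip (resolvent_vec T s (C t)^-1 x) y) t.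
Proof.
apply: (@ccont_comp _ (fun w => ip (resolvent_vec T s w x) y) (fun t => (C t)^-1)).
  apply: resolvent_vec_cdiff => l ls.
  exact: (unit_inv r0 r1 sr s0 ME rho1 rhoM (absc_circle t) ls).
apply: (@ccont_comp _ (fun w => w^-1)); last exact: ccont_circle.
apply: cdiffV; last exact: cdiff_id.
by rewrite -absc_gt0 absc_circle rho_gt0'.
Qed.

Lemma ccont_resolvent_conj x y t :
  ccont (fun t => ip (resolvent_vec T s (C t)^* x) y) t.
Proof.
apply: (@ccont_comp _ (fun w => ip (resolvent_vec T s w x) y) (fun t => (C t)^*)).
  apply: resolvent_vec_cdiff => l ls.
  exact: (unit_conj r0 r1 sr rho1 (absc_circle t) ls).
exact/ccont_conj/ccont_circle.
Qed.

Lemma ccont_on_circle (F : R[i] -> R[i]) t : (forall z, absc z < 1 -> cdiff F z) ->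
  ccont (fun t => F (C t)) t.
Proof.
move=> dF; apply: (ccont_comp (g := F)); last exact: ccont_circle.
by apply: dF; rewrite absc_circle.
Qed.

Lemma remean_on_circle (F : R[i] -> R[i]) : (forall z, absc z < 1 -> cdiff F z) ->
  remean (fun t => F (C t)) = 2 * pi * complex.Re (F 0).
Proof. by move=> dF; apply: (mean_value dF); rewrite z0E. Qed.

Lemma inv_sqr_ge0 : 0 <= rho ^- 2.
Proof. by rewrite invr_ge0 sqr_ge0. Qed.

Lemma inv_sqr_lt : rho ^- 2 * r < 1.
Proof.
rewrite mulrC ltr_pdivrMr ?exprn_gt0 ?rho_gt0'// mul1r.
exact: (r_lt_rho2 r0 r1 s0 ME rho1 rhoM).
Qed.

Lemma conj_mean_inv (F : R[i] -> R[i]) x y : (forall z, absc z < 1 -> cdiff F z) ->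
  remean (fun t => F (C t) * ip x (resolvent_vec T s (C t)^-1 y)) =
  2 * pi * complex.Re (F 0 * ip x y).
Proof.
move=> dF; rewrite -(conj_mean _ _ dF inv_sqr_ge0 inv_sqr_lt).
apply: eq_remean => t.
by rewrite (inv_conj r0 r1 s0 ME rho1 rhoM (absc_circle t)).
Qed.

(** Induction along Horner's scheme: z u = T u + z x on the circle trades a factor z for a factor T,
    and the term z q(z) <x, y> vanishes at 0, so its mean is 0. *)
Lemma poly_mean (q : {poly R[i]}) x y :
  remean (fun t => q.[C t] * ip (resolvent_vec T s (C t)^-1 x) y) =
  2 * pi * complex.Re (ip (horner_mx T q *m x) y).
Proof.
elim/poly_ind: q x y => [|q c ih] x y.
  rewrite rmorph0 mul0mx ip0l mulr0; rewrite (@eq_remean _ _ (fun=> 0)) => [|t];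
    last by rewrite horner0 mul0r.
  by rewrite /remean segint_cst ?mul0r// mulr_ge0 ?pi_ge0.
have E t : (q * 'X + c%:P).[C t] * ip (resolvent_vec T s (C t)^-1 x) y =
    q.[C t] * ip (resolvent_vec T s (C t)^-1 (T *m x)) y +
    ((q * 'X).[C t] * ip x y + c * ip (resolvent_vec T s (C t)^-1 x) y).
  have Cn : C t != 0 by rewrite -absc_gt0 absc_circle rho_gt0'.
  have := UP r0 r1 sr s0 PT ME rho1 rhoM x (absc_circle t).
  rewrite resolvent_vec_mulmx; set u := resolvent_vec _ _ _ _ => Eu.
  rewrite hornerMXaddC hornerMX -[in X in _ = _ + (_ * X + _)]Eu ipDl ipNl ipZl.
  move: (horner q _) (ip u y) (ip (T *m u) y) => a b d; move: Cn; move: (C t) => z Cn.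
  by field.
rewrite (eq_remean (fun t => congr1 (@complex.Re R) (E t))).
have cq t : ccont (fun t => q.[C t]) t by apply: (ccont_on_circle t) => z _; exact: cdiff_horner.
have cqX t : ccont (fun t => (q * 'X).[C t]) t by apply: (ccont_on_circle t) => z _;
  exact: cdiff_horner.
have c1 t := ccontM (cq t) (ccont_resolvent (T *m x) y t).
have c2 t := ccontM (cqX t) (ccont_cst (ip x y) t).
have c3 t := ccontM (ccont_cst c t) (ccont_resolvent x y t).
rewrite (remeanD c1 (fun t => ccontD (c2 t) (c3 t))) (remeanD c2 c3) ih.
have -> : remean (fun t => (q * 'X).[C t] * ip x y) = 0.
  rewrite (@remean_on_circle (fun z => (q * 'X).[z] * ip x y)).
    by rewrite hornerMX mulr0 mul0r mulr0.
  by move=> z _; apply: cdiffM; [exact: cdiff_horner|exact: cdiff_cst].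
(* On the circle this integrand is conjugate-holomorphic; its conjugate has the same real part and
   falls under the previous mean formula. *)
have -> : remean (fun t => c * ip (resolvent_vec T s (C t)^-1 x) y) =
    2 * pi * complex.Re (c * ip x y).
  have := @conj_mean_inv (fun=> c^*) y x (fun z _ => @cdiff_cst _ _ z).
  have <- : complex.Re (c^* * ip y x) = complex.Re (c * ip x y).
    by rewrite -Re_conj rmorphM/= conjCK ip_conj.
  move=> <-; apply: eq_remean => t.
  by rewrite -[RHS]Re_conj rmorphM/= conjCK ip_conj.
rewrite add0r -mulrDr -ReD; congr (_ * complex.Re _).
rewrite rmorphD rmorphM/= horner_mx_X horner_mx_C mulmxDl -mulmxE -mulmxA.
by rewrite mul_scalar_mx ipDl ipZl.
Qed.

Variables (f h : R[i] -> R[i]) (q : {poly R[i]}).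
Hypothesis df : forall z, absc z < 1 -> cdiff f z.
Hypothesis dh : forall z, absc z < 1 -> cdiff h z.
Hypothesis fqh : forall z, absc z < 1 -> f z - q.[z] = (poly_of_zeros s).[z] * h z.

Lemma functional_calculus_mean x y :
  remean (fun t => f (C t) * ip (resolvent_vec T s (C t)^-1 x) y) =
  2 * pi * complex.Re (ip (horner_mx T q *m x) y).
Proof.
have [H H0 HE] := resolvent_vec_poly T s x y.
have E t : f (C t) * ip (resolvent_vec T s (C t)^-1 x) y =
    q.[C t] * ip (resolvent_vec T s (C t)^-1 x) y + h (C t) * H.[C t].
  have Cr := absc_circle t.
  rewrite -HE; last 2 first.
  - by rewrite -absc_gt0 Cr rho_gt0'.
  - move=> l ls; apply/eqP => Cl; have := sr ls; rewrite -Cl Cr.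
    have := r_lt_rho2 r0 r1 s0 ME rho1 rhoM.
    have : rho ^+ 2 <= rho by rewrite expr2 ler_piMl// ltW// rho_gt0'.
    lra.
  have -> : f (C t) = q.[C t] + (poly_of_zeros s).[C t] * h (C t).
    by rewrite -fqh ?Cr// addrC subrK.
  by rewrite mulrDl; congr (_ + _); rewrite mulrAC mulrC.
rewrite (eq_remean (fun t => congr1 (@complex.Re R) (E t))).
have cq t : ccont (fun t => q.[C t]) t by apply: (ccont_on_circle t) => z _; exact: cdiff_horner.
have cH t : ccont (fun t => H.[C t]) t by apply: (ccont_on_circle t) => z _; exact: cdiff_horner.
rewrite remeanD => [|t|t].
- rewrite poly_mean (@remean_on_circle (fun z => h z * H.[z])).
    by rewrite H0 mulr0 mulr0 addr0.
  by move=> z z1; apply: cdiffM; [exact: dh|exact: cdiff_horner].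
- exact: ccontM (cq t) (ccont_resolvent x y t).
- exact: ccontM (ccont_on_circle t dh) (cH t).
Qed.

Lemma ccont_kern x y t : ccont (fun t => kern T s x y (C t)) t.
Proof.
apply: ccontD; first apply: ccontD.
- exact: ccont_resolvent.
- under eq_fun do rewrite -ip_conj; exact/ccont_conj/ccont_resolvent.
- exact: ccont_cst.
Qed.

(** The kernel may replace <u, y> because the two added terms cancel in the mean: both f <x, v> and
    f <x, y> average to f(0) <x, y>. *)
Lemma kern_mean x y : remean (fun t => f (C t) * kern T s x y (C t)) =
  2 * pi * complex.Re (ip (horner_mx T q *m x) y).
Proof.
have cf t := ccont_on_circle t df.
have ck2 t : ccont (fun t => ip x (resolvent_vec T s (C t)^-1 y)) t.
  under eq_fun do rewrite -ip_conj; exact/ccont_conj/ccont_resolvent.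
have E t : f (C t) * kern T s x y (C t) =
    (f (C t) * ip (resolvent_vec T s (C t)^-1 x) y + f (C t) * ip x (resolvent_vec T s (C t)^-1 y))
    - f (C t) * ip x y by rewrite /kern mulrBr mulrDr.
rewrite (eq_remean (fun t => congr1 (@complex.Re R) (E t))).
have c1 t := ccontM (cf t) (ccont_resolvent x y t).
have c2 t := ccontM (cf t) (ck2 t).
have c3 t := ccontM (cf t) (ccont_cst (ip x y) t).
rewrite (remeanB (fun t => ccontD (c1 t) (c2 t)) c3) (remeanD c1 c2).
rewrite functional_calculus_mean (conj_mean_inv x y df).
have := @remean_on_circle (fun z => f z * ip x y).
by move=> -> => [|z z1]; [exact: addrK|apply: cdiffM; [exact: df|exact: cdiff_cst]].
Qed.

Definition kern_bound x z : R := complex.Re (kern T s x x z) + 24 * kern' T s x z.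

(** 25 = 1 + 24: the diagonal kernel and [kern'] both have mean |x|^2. *)
Lemma kern_bound_mean x :
  segint (fun t => kern_bound x (C t)) 0 (2 * pi) = 2 * pi * (25 * l2norm x ^+ 2).
Proof.
pose phi t := kern T s x x (C t) + 24%:R * (2%:R * ip x (resolvent_vec T s (C t)^* x) - ip x x).
have c3 t : ccont (fun t => ip x (resolvent_vec T s (C t)^* x)) t.
  under eq_fun do rewrite -ip_conj; exact/ccont_conj/ccont_resolvent_conj.
have c2 t : ccont (fun t => ip x (resolvent_vec T s (C t)^-1 x)) t.
  under eq_fun do rewrite -ip_conj; exact/ccont_conj/ccont_resolvent.
have c1 t := ccont_resolvent x x t.
have m0 k : remean (fun=> k) = 2 * pi * complex.Re k :> R.
  by rewrite /remean segint_cst ?subr0 1?mulrC// mulr_ge0 ?pi_ge0.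
have m1 : remean (fun t => ip (resolvent_vec T s (C t)^-1 x) x) = 2 * pi * l2norm x ^+ 2.
  have := poly_mean 1 x x; rewrite rmorph1 mul1mx ipxx /= => <-.
  by apply: eq_remean => t; rewrite hornerC mul1r.
have m2 : remean (fun t => ip x (resolvent_vec T s (C t)^-1 x)) = 2 * pi * l2norm x ^+ 2.
  by rewrite -m1; apply: eq_remean => t; rewrite -[LHS]Re_conj ip_conj.
have m3 : remean (fun t => ip x (resolvent_vec T s (C t)^* x)) = 2 * pi * l2norm x ^+ 2.
  have := @conj_mean (fun=> 1) 1 x x (fun z _ => @cdiff_cst _ _ z) ler01.
  rewrite !mul1r ipxx => /(_ r1) /= <-; apply: eq_remean => t.
  by rewrite !mul1r.
have kc t := ccont_kern x x t.
have mk : remean (fun t => kern T s x x (C t)) = 2 * pi * l2norm x ^+ 2.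
  rewrite (remeanB (fun t => ccontD (c1 t) (c2 t)) (ccont_cst (ip x x))).
  by rewrite (remeanD c1 c2) m1 m2 m0 ipxx /= addrK.
rewrite (@eq_segint _ _ (fun t => complex.Re (kern T s x x (C t)) +
   (48 * complex.Re (ip x (resolvent_vec T s (C t)^* x)) - 24 * l2norm x ^+ 2))); last first.
  move=> t _; rewrite /kern_bound /kern' -(ip_conj x (resolvent_vec _ _ _ _)) Re_conj.
  by congr (_ + _); ring.
have sc (k : R) : seg_cont (fun=> k) 0 (2 * pi) by move=> t _; exact: cvg_cst.
have s1 : seg_cont (fun t => 48 * complex.Re (ip x (resolvent_vec T s (C t)^* x))) 0 (2 * pi).
  by move=> t _; apply: continuousM; [exact: cvg_cst|exact: ccont_Re].
rewrite segintD; last 2 first.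
- exact: remean_cont.
- exact: seg_contB.
rewrite segintB// segintZ; last exact: remean_cont.
rewrite -!/(remean _) mk m3 segint_cst ?subr0 ?mulr_ge0 ?pi_ge0//; ring.
Qed.

Lemma functional_calculus_estimate (p A : R) x y : 1 <= p -> 0 < A ->
  l2norm x <= 1 -> l2norm y <= 1 ->
  2 * pi * complex.Re (ip (horner_mx T q *m x) y) <=
  A * (2 * pi * 25 + 32 * M * segint (fun t => (absc (f (C t)) / A) `^ p) 0 (2 * pi)).
Proof.
move=> p1 A0 x1 y1.
have cf t := ccont_on_circle t df.
have sf : seg_cont (fun t => (absc (f (C t)) / A) `^ p) 0 (2 * pi).
  move=> t _; apply: (continuous_powR_comp (f := fun t => absc (f (C t)) / A)) => //.
    by move=> u; rewrite divr_ge0 ?absc_ge0// ltW.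
  by apply: continuousM; [exact: ccont_absc|exact: cvg_cst].
have sb w : seg_cont (fun t => kern_bound w (C t)) 0 (2 * pi).
  move=> t _; apply: continuousD; first exact/ccont_Re/ccont_kern.
  apply: continuousM; first exact: cvg_cst.
  apply: continuousB; last exact: cvg_cst.
  apply: continuousM; first exact: cvg_cst.
  exact/ccont_Re/ccont_resolvent_conj.
have M1 := M_ge1 r0 r1 s0 ME.
rewrite -kern_mean.
pose G t := A * ((kern_bound x (C t) + kern_bound y (C t)) / 2 + 32 * M * (absc (f (C t)) / A) `^ p).
have sG1 : seg_cont (fun t => (kern_bound x (C t) + kern_bound y (C t)) / 2) 0 (2 * pi).
  move=> t h1; apply: continuousM; last exact: cvg_cst.
  by apply: continuousD; exact: sb.
have sG2 : seg_cont (fun t => 32 * M * (absc (f (C t)) / A) `^ p) 0 (2 * pi).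
  by move=> t h1; apply: continuousM; [exact: cvg_cst|exact: sf].
have sG : seg_cont (fun t => (kern_bound x (C t) + kern_bound y (C t)) / 2 + 32 * M * (absc (f (C t)) / A) `^ p) 0 (2 * pi).
  by move=> t h1; apply: continuousD; [exact: sG1|exact: sG2].
apply: (@le_trans _ _ (segint G 0 (2 * pi))); last first.
  rewrite /G segintZ// segintD// segintZ// ler_pM2l// lerD2r.
  rewrite (@eq_segint _ _ (fun t => 2^-1 * (kern_bound x (C t) + kern_bound y (C t))));
    last by move=> t _; rewrite mulrC.
  rewrite segintZ; last by move=> t h1; apply: continuousD; exact: sb.
  rewrite segintD// !kern_bound_mean.
  have p0 : 0 <= 2 * pi :> R by rewrite mulr_ge0 ?pi_ge0.
  have -> : 2^-1 * (2 * pi * (25 * l2norm x ^+ 2) + 2 * pi * (25 * l2norm y ^+ 2)) =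
    2 * pi * (25 * ((l2norm x ^+ 2 + l2norm y ^+ 2) / 2)) by field.
  rewrite ler_wpM2l// ler_piMr// ler_pdivrMr// mul1r -[leRHS]/(1 + 1).
  by rewrite lerD// expr_le1 ?l2norm_ge0.
apply: le_segint; first by apply: remean_cont => t; apply: ccontM; [exact: cf|exact: ccont_kern].
  by move=> t h1; apply: continuousM; [exact: cvg_cst|exact: sG].
move=> t _; have Cr := absc_circle t; rewrite /G.
apply: le_trans (Re_le_absc _) _; rewrite abscM.
set a := absc (f (C t)); set z := C t in Cr *.
have kb := kern_majorant contrT r0 r1 sr s0 PT ME rho1 rhoM x y Cr.
have wx := majorant_mean_bound contrT r0 r1 sr s0 PT ME rho1 rhoM x Cr.
have wy := majorant_mean_bound contrT r0 r1 sr s0 PT ME rho1 rhoM y Cr.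
have w2 v : l2norm v <= 1 -> majorant T s rho v z <= 32 * M.
  move=> v1; apply: le_trans (majorant_bound contrT r0 r1 sr s0 PT ME rho1 rhoM v Cr) _.
  by rewrite ler_piMr ?expr_le1 ?l2norm_ge0// mulr_ge0// (le_trans ler01).
have wx2 := w2 _ x1; have wy2 := w2 _ y1.
rewrite -/(kern_bound x z) in wx; rewrite -/(kern_bound y z) in wy.
set K := absc (kern _ _ _ _ _) in kb *; pose w := (majorant T s rho x z + majorant T s rho y z) / 2.
have K0 : 0 <= K by exact: absc_ge0.
have a0 : 0 <= a by exact: absc_ge0.
have wb : w <= (kern_bound x z + kern_bound y z) / 2 by rewrite ler_pM2r ?invr_gt0// lerD.
have wM : w <= 32 * M.
  by rewrite ler_pdivrMr// [leRHS](_ : _ = 32 * M + 32 * M) ?lerD//; ring.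
have Kw : K <= w by [].
have w0 : 0 <= w by exact: le_trans Kw.
rewrite (_ : a * K = A * (a / A * K)); last by field; exact: lt0r_neq0.
rewrite ler_pM2l//.
set b := a / A; have b0 : 0 <= b by rewrite divr_ge0// ltW.
(* From b <= 1 + b^p: the term 1 is weighted by [w] and later integrated through its mean bound, the
   term b^p is paired with the supremum 32 M of [w]. *)
apply: (@le_trans _ _ ((1 + b `^ p) * w)).
  apply: ler_pM => //; case: (leP b 1) => b1; first by rewrite (le_trans b1)// lerDl powR_ge0.
  by rewrite (le_trans (le1r_powR (ltW b1) p1))// lerDr.
by rewrite mulrDl mul1r lerD// mulrC ler_wpM2r// powR_ge0.
Qed.

End KeyEstimate.

(** * Passage to the suprema and the Hardy upper bound *)

Section UpperBounds.
Variable R : realType.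
Implicit Types (p r : R) (f : R[i] -> R[i]).

Lemma opnorm_le_Re n (Q : 'M[R[i]]_n) (B : R) :
  (forall x y, l2norm x <= 1 -> l2norm y <= 1 -> complex.Re (ip (Q *m x) y) <= B) ->
  opnorm Q <= B.
Proof.
move=> h; apply: ge_sup; first by have [] := opnorm_set_bounded Q.
move=> _ [x /= x1 <-]; set v := Q *m x.
have [v0|v0] := eqVneq (l2norm v) 0.
  by have := h x 0 x1; rewrite -ip_conj ip0l rmorph0 v0 l2norm0; apply.
have v0' : 0 < l2norm v by rewrite lt_neqAle eq_sym v0 l2norm_ge0.
have := h x ((l2norm v)^-1%:C *: v) x1.
rewrite l2normZ absc_real ger0_norm ?invr_ge0 ?l2norm_ge0// mulVf// => /(_ (lexx _)).
rewrite ipZr -/v ipxx.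
have -> : ((l2norm v)^-1%:C)^* = ((l2norm v)^-1)%:C :> R[i] by simpc.
by rewrite -rmorphM/= expr2 mulKf.
Qed.

Lemma opnorm0 n : opnorm (0 : 'M[R[i]]_n) <= 0.
Proof. by apply: opnorm_le_Re => x y _ _; rewrite mul0mx ip0l. Qed.

Lemma sup_calM_le n r (S : set (R[i] -> R[i])) (B : R) : 0 <= B ->
  (forall f, S f -> holomorphic_disc f) ->
  (forall f h (s : n.+1.-tuple R[i]) (T : 'M[R[i]]_n.+1) q x y, S f ->
    (forall x : 'cV_n.+1, l2norm (T *m x) <= l2norm x) ->
    (forall l, l \in tval s -> absc l <= r) -> horner_mx T (poly_of_zeros s) = 0 ->
    holomorphic_disc h ->
    (forall z, absc z < 1 -> f z - q.[z] = (poly_of_zeros s).[z] * h z) ->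
    l2norm x <= 1 -> l2norm y <= 1 -> complex.Re (ip (horner_mx T q *m x) y) <= B) ->
  (sup_calM n r S <= B%:E)%E.
Proof.
move=> B0 Sh H; apply: ge_ereal_sup => _ [f Sf [s sr <-]].
apply: ge_ereal_sup => _ [T [/contractionP cT mT] <-]; rewrite lee_fin /holo_mx.
(* Without an interpolant [xget] returns its default 0, and the matrix is then 0. *)
have [ex|nex] := pselect (exists q, interpolants f T q); last first.
  rewrite xgetPN; last by move=> q hq; apply: nex; exists q.
  by rewrite rmorph0 (le_trans (opnorm0 _)).
have [h hh hE] := xgetPex 0 ex; set q := xget _ _ in hE *.
apply: opnorm_le_Re => x y x1 y1.
apply: (H f h s T q x y) => //.
- by move=> l /sr[].
- by rewrite -mT mx_root_minpoly.
- by rewrite -mT.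
Qed.

(** Not normalised by 2 pi. The base point is complex, rather than a radius, so that rotating a
    point of the plane yields this integral directly. *)
Definition circle_pint p f (z0 : R[i]) : R :=
  segint (fun t => absc (f (z0 * eit t)) `^ p) 0 (2 * pi).

Lemma circle_pint_cont p f z0 : 1 <= p -> holomorphic_disc f -> absc z0 < 1 ->
  seg_cont (fun t => absc (f (z0 * eit t)) `^ p) 0 (2 * pi).
Proof.
move=> p1 df z1 t _; apply: (continuous_powR_comp (f := fun t => absc (f (z0 * eit t)))) => //.
  by move=> u; exact: absc_ge0.
by apply: ccont_absc; exact: (@ccont_on_circle R (absc z0) z1 z0 erefl f t df).
Qed.

Lemma calculus_estimate n r f h (s : n.+1.-tuple R[i]) (T : 'M[R[i]]_n.+1) q x y z0 p A :
  0 <= r < 1 -> 1 <= p -> 0 < A ->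
  (forall x : 'cV_n.+1, l2norm (T *m x) <= l2norm x) ->
  (forall l, l \in tval s -> absc l <= r) -> horner_mx T (poly_of_zeros s) = 0 ->
  holomorphic_disc f -> holomorphic_disc h ->
  (forall z, absc z < 1 -> f z - q.[z] = (poly_of_zeros s).[z] * h z) ->
  l2norm x <= 1 -> l2norm y <= 1 ->
  1 - (8 * (n.+1%:R / (1 - r)))^-1 <= absc z0 < 1 ->
  2 * pi * complex.Re (ip (horner_mx T q *m x) y) <=
  A * (50 * pi + 32 * (n.+1%:R / (1 - r)) * A `^ (- p) * circle_pint p f z0).
Proof.
move=> /andP[r0 r1] p1 A0 cT sr PT df dh fqh x1 y1 /andP[z0M z01].
have s0 : (0 < size s)%N by rewrite size_tuple.
have ME : n.+1%:R / (1 - r) = (size s)%:R / (1 - r) by rewrite size_tuple.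
have := functional_calculus_estimate cT r0 r1 sr s0 PT ME z01 z0M erefl df dh fqh p1 A0 x1 y1.
move=> /le_trans; apply; rewrite ler_pM2l//; apply: eq_ler; congr (_ + _); first by ring.
rewrite -[RHS]mulrA; congr (_ * _); rewrite /circle_pint -segintZ; last exact: circle_pint_cont.
apply: eq_segint => t _; rewrite powRM ?absc_ge0 ?invr_ge0 ?ltW// mulrC; congr (_ * _).
by rewrite -[A^-1]powR_inv1 ?ltW// -powRrM mulN1r.
Qed.

Lemma poweR_inv_le1 (x : \bar R) p : 0 < p -> (0 <= x)%E ->
  (x `^ p^-1 <= 1)%E -> (x <= 1)%E.
Proof.
move=> p0 x0 h.
have -> : x = ((x `^ p^-1) `^ p)%E by rewrite -poweRrM mulVf ?gt_eqF// poweRe1.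
have -> : (1 = 1 `^ p :> \bar R)%E by rewrite poweR1r.
apply: gt0_ler_poweR => //; first exact: ltW.
  by rewrite in_itv/= poweR_ge0 leey.
by rewrite in_itv/= leey lee_fin ler01.
Qed.

Lemma poweR_inv_ge1 (x : \bar R) p : 0 < p -> (0 <= x)%E -> (x <= 1)%E ->
  (x `^ p^-1 <= 1)%E.
Proof.
move=> p0 x0 x1; have -> : (1 = 1 `^ p^-1 :> \bar R)%E by rewrite poweR1r.
apply: gt0_ler_poweR => //; first by rewrite invr_ge0 ltW.
  by rewrite in_itv/= x0 leey.
by rewrite in_itv/= leey lee_fin ler01.
Qed.

Lemma hardy_circle_integral p (f : R[i] -> R[i]) (s : R) : 1 <= p ->
  holomorphic_disc f -> 0 <= s < 1 ->
  (\int[lebesgue_measure]_(t in `[0%R, (2 * pi)%R])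
    (absc (f ((s * cos t) +i* (s * sin t))) `^ p)%:E = (circle_pint p f s%:C)%:E)%E.
Proof.
move=> p1 df /andP[s0 s1]; have as1 : absc s%:C < 1 by rewrite absc_real ger0_norm.
rewrite /circle_pint /segint /Rintegral fineK; last first.
  apply: integrable_fin_num => //; apply: seg_cont_integrable; exact: circle_pint_cont.
apply: eq_integral => t _; congr (absc (f _) `^ p)%:E.
by rewrite /eit; simpc.
Qed.

Lemma hardy_ball_circle p f (sg : R) : 1 <= p -> hardy_ball p f -> 0 <= sg < 1 ->
  circle_pint p f sg%:C <= 2 * pi.
Proof.
move=> p1 [df hn] /andP[sg0 sg1]; have p0 : 0 < p by exact: lt_le_trans p1.
have pp : 0 < 2 * pi :> R by rewrite mulr_gt0 ?pi_gt0.
have asg : absc sg%:C < 1 by rewrite absc_real ger0_norm.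
have h : ((((2 * pi)^-1)%:E * \int[lebesgue_measure]_(t in `[0%R, (2 * pi)%R])
  (absc (f ((sg * cos t) +i* (sg * sin t))) `^ p)%:E) `^ p^-1 <= 1)%E.
  apply: le_trans hn; apply: ereal_sup_ubound; exists sg => //=.
  by rewrite in_itv/= sg0 sg1.
have sg01 : 0 <= sg < 1 by rewrite sg0.
move: h; rewrite hardy_circle_integral// => /poweR_inv_le1 -/(_ p0); rewrite -EFinM !lee_fin.
have c0 : 0 <= circle_pint p f sg%:C by apply: Rintegral_ge0 => t _; exact: powR_ge0.
by rewrite ler_pdivrMl// mulr1; apply; rewrite mulr_ge0// invr_ge0 ltW.
Qed.

Lemma hardy_upper p n r : 1 <= p -> 0 <= r < 1 ->
  (sup_calM n r (hardy_ball p) <= (57 * (n.+1%:R / (1 - r)) `^ (1 / p))%:E)%E.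
Proof.
move=> p1 r01; have p0 : 0 < p by exact: lt_le_trans p1.
have /andP[r0 r1] := r01; move ME : (n.+1%:R / (1 - r)) => M.
have M1 : 1 <= M by rewrite -ME ler_pdivlMr ?subr_gt0// mul1r (@le_trans _ _ 1) ?ler1n//; lra.
have M0 : 0 < M by exact: lt_le_trans M1.
set A := M `^ (1 / p); have A0 : 0 < A by rewrite powR_gt0.
apply: sup_calM_le; first by rewrite mulr_ge0// ltW.
  by move=> f [].
move=> f h s T q x y Sf cT sr PT dh fqh x1 y1.
pose sg := 1 - (8 * M)^-1.
have sg01 : 0 <= sg < 1.
  rewrite /sg subr_ge0 ltrBlDr ltrDl invr_gt0 mulr_gt0// andbT invf_le1 ?mulr_gt0//; lra.
have /andP[sg0 sg1] := sg01.
have hz : 1 - (8 * (n.+1%:R / (1 - r)))^-1 <= absc sg%:C < 1.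
  by rewrite ME absc_real ger0_norm// sg1 lexx.
have := calculus_estimate r01 p1 A0 cT sr PT (proj1 Sf) dh fqh x1 y1 hz.
have AM : A `^ (- p) = M^-1.
  by rewrite /A -powRrM mulrN divfK ?gt_eqF// powR_inv1// ltW.
rewrite ME AM -[32 * M / M]mulrA divff ?gt_eqF// mulr1.
have := hardy_ball_circle p1 Sf sg01; have pi0 := pi_gt0 R.
set X := complex.Re _; set I := circle_pint _ _ _ => HI HX.
(* As A^p = M, the factor M A^(-p) is 1; with I <= 2 pi this gives 57 = 25 + 32. *)
have : A * (50 * pi + 32 * I) <= A * (2 * pi * 57) by rewrite ler_pM2l//; lra.
move=> /(le_trans HX); rewrite (_ : A * (2 * pi * 57) = 2 * pi * (57 * A)); last by ring.
by rewrite ler_pM2l ?mulr_gt0.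
Qed.
End UpperBounds.

(** * Area measure in polar coordinates *)

Section PlaneMeasure.
Variable R : realType.
Notation leb := (@lebesgue_measure R).
Notation leb2 := (leb \x leb)%E.
Implicit Types (G : R -> \bar R) (F : R * R -> \bar R) (a b t : R).
Local Open Scope ereal_scope.

Lemma measurable_affine a b : measurable_fun setT (fun x : R => (a * x + b)%R).
Proof.
apply: continuous_measurable_fun => x; apply: continuousD; last exact: cvg_cst.
by apply: continuousM; [exact: cvg_cst|exact: cvg_id].
Qed.

(** The image of Lebesgue measure under x -> a x + b, multiplied by a, has the right value on
    half-open intervals; uniqueness then identifies it. *)
Lemma lebesgue_affine a b G : (0 < a)%R -> measurable_fun setT G ->
  (forall x, 0 <= G x) ->
  \int[leb]_x G x = a%:E * \int[leb]_x G (a * x + b)%R.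
Proof.
move=> a0 mG G0; pose phi (x : R) := (a * x + b)%R.
have mphi : measurable_fun setT (phi : measurableTypeR R -> measurableTypeR R).
  exact: measurable_affine.
pose push : {measure set (measurableTypeR R) -> \bar R} :=
  measure_function_pushforward__canonical__measure_function_Measure leb mphi.
pose nu : {measure set (measurableTypeR R) -> \bar R} := mscale (NngNum (ltW a0)) push.
have nuE A : measurable A -> leb A = nu A.
  apply: lebesgue_measure_unique => X [[c d] _ <-].
  have preim : phi @^-1` `]c, d]%classic = `]((c - b) / a)%R, ((d - b) / a)%R]%classic.
    apply/seteqP; split=> x /=; rewrite !in_itv/= /phi ltr_pdivrMr// ler_pdivlMr//;
      by rewrite ltrBlDr lerBrDr [(x * a)%R]mulrC.
  rewrite /nu /= /mscale /= /pushforward preim !lebesgue_measure_itv/= !lte_fin.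
  rewrite ltr_pM2r ?invr_gt0// ltrD2r; case: ifPn => _; last by rewrite mule0.
  by rewrite -!EFinB -EFinM; congr (_%:E); field; exact: lt0r_neq0.
rewrite (@eq_measure_integral _ _ _ _ nu) => [|A mA _]; last exact: nuE.
rewrite ge0_integral_mscale//; congr (_ * _).
by rewrite ge0_integral_pushforward// preimage_setT.
Qed.

Lemma lebesgue_shift b G : measurable_fun setT G -> (forall x, 0 <= G x) ->
  \int[leb]_x G (x + b)%R = \int[leb]_x G x.
Proof.
move=> mG G0; rewrite [RHS](@lebesgue_affine 1 b)// mul1e.
by apply: eq_integral => x _; rewrite mul1r.
Qed.

(** For a fixed second coordinate a shear is a translation of the first. *)
Lemma plane_shear1 a F : measurable_fun setT F -> (forall w, 0 <= F w) ->
  \int[leb2]_w F (w.1 + a * w.2, w.2)%R = \int[leb2]_w F w.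
Proof.
move=> mF F0.
have mphi : measurable_fun setT (fun w : R * R => (w.1 + a * w.2, w.2)%R).
  apply: measurable_fun_pair; last exact: measurable_snd.
  apply: measurable_funD; first exact: measurable_fst.
  by apply: measurable_funM => //; exact: measurable_snd.
rewrite fubini_tonelli2; last 2 first.
- exact: (measurableT_comp mF mphi).
- by move=> w; exact: F0.
rewrite [RHS](@fubini_tonelli2 _ _ _ _ _ leb leb F mF F0); apply: eq_integral => y _;
  rewrite /fubini_G /=.
apply: (@lebesgue_shift _ (fun x => F (x, y))) => //.
exact: measurableT_comp mF (pair2_measurable y).
Qed.

Lemma plane_shear2 a F : measurable_fun setT F -> (forall w, 0 <= F w) ->
  \int[leb2]_w F (w.1, w.2 + a * w.1)%R = \int[leb2]_w F w.
Proof.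
move=> mF F0.
have mphi : measurable_fun setT (fun w : R * R => (w.1, w.2 + a * w.1)%R).
  apply: measurable_fun_pair; first exact: measurable_fst.
  apply: measurable_funD; first exact: measurable_snd.
  by apply: measurable_funM => //; exact: measurable_fst.
rewrite fubini_tonelli1; last 2 first.
- exact: (measurableT_comp mF mphi).
- by move=> w; exact: F0.
rewrite [RHS](@fubini_tonelli1 _ _ _ _ _ leb leb F mF F0); apply: eq_integral => x _;
  rewrite /fubini_F /=.
apply: (@lebesgue_shift _ (fun y => F (x, y))) => //.
exact: measurableT_comp mF (pair1_measurable x).
Qed.

Lemma plane_scale a F : (0 < a)%R -> measurable_fun setT F -> (forall w, 0 <= F w) ->
  \int[leb2]_w F w = (a ^+ 2)%:E * \int[leb2]_w F (a * w.1, a * w.2)%R.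
Proof.
move=> a0 mF F0.
have mphi : measurable_fun setT (fun w : R * R => (a * w.1, a * w.2)%R).
  by apply: measurable_fun_pair; apply: measurable_funM => //;
    solve [exact: measurable_fst|exact: measurable_snd].
have mF' := measurableT_comp mF mphi.
rewrite (@fubini_tonelli1 _ _ _ _ _ leb leb F mF F0) [in RHS](@fubini_tonelli1 _ _ _ _ _ leb leb _ mF' (fun w => F0 _)).
have mFF : measurable_fun setT (fubini_F leb F).
  exact: measurable_fun_fubini_tonelli_F.
have FF0 x : 0 <= fubini_F leb F x by apply: integral_ge0 => y _; exact: F0.
rewrite (lebesgue_affine 0 a0 mFF FF0) expr2 EFinM -muleA; congr (_ * _).
have mFa : measurable_fun setT (fubini_F leb (F \o (fun w : R * R => (a * w.1, a * w.2)%R))).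
  by apply: measurable_fun_fubini_tonelli_F => // w; exact: F0.
rewrite -[RHS]ge0_integralZl//; last 2 first.
- by move=> x _; apply: integral_ge0 => y _; exact: F0.
- by rewrite lee_fin ltW.
apply: eq_integral => x _; rewrite /fubini_F addr0 /=.
rewrite (@lebesgue_affine a 0 (fun y => F (a * x, y)%R))//.
- by congr (_ * _); apply: eq_integral => y _; rewrite addr0.
- exact: measurableT_comp mF (pair1_measurable (a * x)%R).
Qed.

(* The rotation by the angle [t - pi]. It is a product of three shears as soon
   as the angle is not [pi] modulo [2 pi]. *)
Definition turn t (w : R * R) : R * R :=
  (- (w.1 * cos t - w.2 * sin t), - (w.1 * sin t + w.2 * cos t))%R.

Lemma plane_turn t F : cos t != 1%R -> measurable_fun setT F -> (forall w, 0 <= F w) ->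
  \int[leb2]_w F (turn t w) = \int[leb2]_w F w.
Proof.
(* With theta = t - pi these are sin theta and -tan(theta/2), the coefficients in the classical
   decomposition of a rotation into three shears. *)
move=> t1 mF F0; pose b : R := (- sin t)%R; pose a : R := (sin t / (1 - cos t))%R.
have c0 : (1 - cos t != 0)%R by rewrite subr_eq0 eq_sym.
have sc : (sin t ^+ 2 = (1 - cos t) * (1 + cos t))%R.
  by rewrite sin2cos2; ring.
have ms1 c : measurable_fun setT (fun w : R * R => (w.1 + c * w.2, w.2)%R).
  apply: measurable_fun_pair; last exact: measurable_snd.
  apply: measurable_funD; first exact: measurable_fst.
  by apply: measurable_funM => //; exact: measurable_snd.
have ms2 c : measurable_fun setT (fun w : R * R => (w.1, w.2 + c * w.1)%R).
  apply: measurable_fun_pair; first exact: measurable_fst.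
  apply: measurable_funD; first exact: measurable_snd.
  by apply: measurable_funM => //; exact: measurable_fst.
pose F1 w := F (w.1 + a * w.2, w.2)%R.
have mF1 : measurable_fun setT F1 by exact: measurableT_comp mF (ms1 a).
pose F2 w := F1 (w.1, w.2 + b * w.1)%R.
have mF2 : measurable_fun setT F2 by exact: measurableT_comp mF1 (ms2 b).
transitivity (\int[leb2]_w F2 (w.1 + a * w.2, w.2)%R).
  apply: eq_integral => -[x y] _; rewrite /F2 /F1 /turn /=; congr F.
  have ab : (a * b = - (1 + cos t))%R.
    by rewrite /a /b mulrAC mulrN -expr2 sc mulNr mulrAC divff// mul1r.
  have a2 : (a * (1 - cos t) = sin t)%R by rewrite /a divfK.
  have E1 : (y + b * (x + a * y) = - (x * sin t + y * cos t))%R.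
    rewrite mulrDr mulrA [(b * a)%R]mulrC ab /b; ring.
  rewrite E1; congr (_, _).
  rewrite (_ : (a * - (x * sin t + y * cos t)) = (a * b) * x - a * y * cos t)%R; last first.
    by rewrite /b; ring.
  rewrite ab -a2; ring.
rewrite (plane_shear1 a mF2) => [|w]; last exact: F0.
rewrite /F2 (plane_shear2 b mF1) => [|w]; last exact: F0.
by rewrite /F1 (plane_shear1 a mF).
Qed.

Lemma measurable_turn : measurable_fun setT (fun tw : R * (R * R) => turn tw.1 tw.2).
Proof.
have mc : measurable_fun setT (fun tw : R * (R * R) => cos tw.1).
  apply: (measurableT_comp _ measurable_fst).
  exact: continuous_measurable_fun (@continuous_cos R).
have ms : measurable_fun setT (fun tw : R * (R * R) => sin tw.1).
  apply: (measurableT_comp _ measurable_fst).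
  exact: continuous_measurable_fun (@continuous_sin R).
have m1 : measurable_fun setT (fun tw : R * (R * R) => tw.2.1).
  exact: measurableT_comp measurable_fst measurable_snd.
have m2 : measurable_fun setT (fun tw : R * (R * R) => tw.2.2).
  exact: measurableT_comp measurable_snd measurable_snd.
apply: measurable_fun_pair; apply: measurable_funN.
  by apply: measurable_funB; apply: measurable_funM.
by apply: measurable_funD; apply: measurable_funM.
Qed.

Lemma cos_neq1 t : (0 < t < 2 * pi)%R -> cos t != 1%R.
Proof.
move=> /andP[t0 t2]; rewrite -[t in cos t](divfK (_ : 2 != 0 :> R)%R)// mulr_natr cos_mulr2n.
apply/eqP => h; have : (sin (t / 2) ^+ 2 = 0)%R by rewrite sin2cos2; move: h; rewrite mulr2n; lra.
move/eqP; rewrite sqrf_eq0 => /eqP s0.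
have : (0 < sin (t / 2))%R.
  by apply: sin_gt0_pi; rewrite divr_gt0//= ltr_pdivrMr// mulrC.
by rewrite s0 ltxx.
Qed.

(** Exchanging the angle with the plane variable by Tonelli treats the product measure as one
    sigma-finite factor. *)
Lemma plane_sigma_finite : sigma_finite setT leb2.
Proof.
pose I n := `](- n%:R)%R, n%:R]%classic : set R.
have mI n : measurable (I n) by exact: measurable_itv.
exists (fun n => I n `*` I n) => [|n].
  apply/seteqP; split => // -[x y] _.
  exists (Num.truncn `|x| + Num.truncn `|y|).+1 => //=.
  rewrite /I /= !in_itv/=.
  have xb (u v : R) : (`|u| < (Num.truncn `|u| + Num.truncn `|v|).+1%:R)%R.
    apply: lt_le_trans (truncnS_gt _) _; rewrite ler_nat ltnS; exact: leq_addr.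
  have := xb x y; have := xb y x; rewrite addnC !ltr_norml => /andP[y1 y2] /andP[x1 x2].
  by split; apply/andP; split; (rewrite ?x1 ?y1//; apply: ltW).
split; first by apply: measurableX; exact: mI.
have [k kE] : exists k : R, leb (I n) = k%:E.
  rewrite /I lebesgue_measure_itv/=; case: ifPn => _; last by exists 0%R.
  by exists (n%:R - - n%:R)%R; rewrite EFinB.
have -> : leb2 (I n `*` I n) = leb (I n) * leb (I n).
  by apply: product_measure1E; exact: mI.
by rewrite kE -EFinM ltry.
Qed.

(** Rotation invariance integrated over the angle, followed by Tonelli. This replaces the change to
    polar coordinates: each point carries the integral over its own circle. *)
Lemma plane_rotation_average F : measurable_fun setT F -> (forall w, 0 <= F w) ->
  (2 * pi)%:E * \int[leb2]_w F w =
  \int[leb2]_w \int[leb]_(t in `[0%R, (2 * pi)%R]) F (turn t w).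
Proof.
move=> mF F0.
pose H (tw : R * (R * R)) := F (turn tw.1 tw.2).
have mH : measurable_fun setT H by exact: measurableT_comp mF measurable_turn.
(* The open interval drops the two angles with cos t = 1, at which the shear decomposition breaks
   down. *)
pose D := `]0%R, (2 * pi)%R[%classic : set R.
have mD : measurable D by exact: measurable_itv.
pose HD (tw : R * (R * R)) := H tw * (\1_D tw.1)%:E.
have mHD : measurable_fun setT HD.
  apply: emeasurable_funM => //; apply/measurable_EFinP.
  apply: (measurableT_comp (measurable_indic _) measurable_fst) => //.
have HD0 tw : 0 <= HD tw by rewrite mule_ge0 ?lee_fin// F0.
have inner w : \int[leb]_t HD (t, w) = \int[leb]_(t in `[0%R, (2 * pi)%R]) F (turn t w).
  rewrite -[RHS]/(\int[leb]_(t in `[0%R, (2 * pi)%R]) H (t, w)).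
  have mHw : measurable_fun setT (fun t => H (t, w)).
    apply: (measurableT_comp mH); exact: pair2_measurable.
  rewrite (@integral_itv_bndoo _ 0%R (2 * pi)%R (fun t => H (t, w)) true false); last first.
    exact: measurable_funTS.
  rewrite [RHS]integral_mkcond; apply: eq_integral => t _.
  by rewrite /HD /= epatch_indic.
transitivity (\int[leb2]_w \int[leb]_t HD (t, w)); last first.
  by apply: eq_integral => w _; exact: inner.
pose l2 : {sigma_finite_measure set (measurableTypeR R * measurableTypeR R)%type -> \bar R} :=
  HB.pack leb2 (Measure_isSigmaFinite.Build _ _ _ leb2 plane_sigma_finite).
rewrite -(@fubini_tonelli _ _ _ _ _ leb l2 HD)//.
transitivity (\int[leb]_t ((\int[leb2]_w F w) * (\1_D t)%:E)).
  have E : \int[leb]_t (\1_D t)%:E = (2 * pi)%:E.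
    rewrite integral_indic// setIT;
      rewrite [LHS](lebesgue_measure_itv `]0%R, (2 * pi)%R[)/= lte_fin mulr_gt0 ?pi_gt0//.
    by rewrite -EFinB subr0.
  rewrite ge0_integralZl//; first by rewrite E muleC.
  - by apply/measurable_EFinP; exact: measurable_indic.
  - by apply: integral_ge0 => w _; exact: F0.
apply: eq_integral => t _; rewrite /HD /= indicE.
have [tD|tD] := boolP (t \in D); last first.
  by rewrite mule0 -[LHS](@integral0 _ _ _ leb2 setT); apply: eq_integral => w _; rewrite mule0.
rewrite mule1 -[LHS](@plane_turn t)//; last first.
  by apply: cos_neq1; move: tD; rewrite inE /D/= in_itv.
by apply: eq_integral => w _; rewrite mule1.
Qed.

End PlaneMeasure.

(** * Open sets, areas of discs and radial functions *)

Section PlaneArea.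
Variable R : realType.
Notation leb := (@lebesgue_measure R).
Notation leb2 := (leb \x leb)%E.

Definition plane_open (U : set (R * R)) := forall w, U w -> exists2 e : R, 0 < e &
  forall w', `|w'.1 - w.1| < e -> `|w'.2 - w.2| < e -> U w'.

(** The set is a countable union of boxes with rational centres and half-sides 1/(k+1); [pickle]
    enumerates the triples of parameters, and boxes not contained in the set are replaced by the
    empty set. *)
Lemma plane_open_measurable U : plane_open U -> measurable U.
Proof.
move=> oU.
pose box (i : rat * rat * nat) : set (R * R) :=
  `](ratr i.1.1 - i.2.+1%:R^-1), (ratr i.1.1 + i.2.+1%:R^-1)[%classic `*`
  `](ratr i.1.2 - i.2.+1%:R^-1), (ratr i.1.2 + i.2.+1%:R^-1)[%classic.
pose F (k : nat) : set (R * R) :=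
  if unpickle k is Some i then (if `[< box i `<=` U >] then box i else set0) else set0.
have -> : U = \bigcup_k F k.
  apply/seteqP; split => [[x y] Uxy|w [k _]]; last first.
    rewrite /F; case: (unpickle k) => // i; case: asboolP => // bU; exact: bU.
  have [e e0 he] := oU _ Uxy.
  have [k ke] : exists k, 2 * k.+1%:R^-1 < e.
    exists (Num.truncn (2 / e)); rewrite ltr_pdivrMr// mulrC -ltr_pdivrMr//.
    exact: truncnS_gt.
  have k0 : 0 < k.+1%:R^-1 :> R by rewrite invr_gt0.
  have xk : x < x + k.+1%:R^-1 by rewrite ltrDl.
  have yk : y < y + k.+1%:R^-1 by rewrite ltrDl.
  have [a] := rat_in_itvoo xk; have [b] := rat_in_itvoo yk.
  rewrite !in_itv/= => /andP[b1 b2] /andP[a1 a2].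
  exists (pickle (a, b, k)); [exact: I|]; rewrite /F pickleK.
  case: asboolP => [_|]; last first.
    case=> -[x' y'] [] /=; rewrite !in_itv/= => /andP[x1 x2] /andP[y1 y2].
    move: (k.+1%:R^-1) ke k0 x1 x2 y1 y2 a1 a2 b1 b2 => h {xk yk} ke k0 x1 x2 y1 y2 a1 a2 b1 b2.
    by apply: he => /=; rewrite ltr_distl; apply/andP; split; lra.
  by split => /=; rewrite in_itv/=; apply/andP; split; move: (k.+1%:R^-1) k0 a1 a2 b1 b2 => h; lra.
apply: bigcupT_measurable => k; rewrite /F; case: (unpickle k) => [i|//].
by case: asboolP => _//; apply: measurableX; exact: measurable_itv.
Qed.

Lemma plane_continuous_measurable (D : set (R * R)) (g : R * R -> R) : plane_open D ->
  (forall w, D w -> forall e, 0 < e -> exists2 d, 0 < d &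
    forall w', `|w'.1 - w.1| < d -> `|w'.2 - w.2| < d -> `|g w' - g w| < e) ->
  measurable_fun D g.
Proof.
move=> oD cg mD; apply: (measurability _ (RGenOInfty.measurableE R)) => //.
move=> _ [_ [a ->] <-]; apply: plane_open_measurable => w [Dw].
rewrite /= in_itv/= andbT => ag.
have [d1 d10 h1] := oD _ Dw.
have ga0 : 0 < g w - a by rewrite subr_gt0.
have [d2 d20 h2] := cg _ Dw _ ga0.
exists (Num.min d1 d2); first by rewrite lt_min d10.
move=> w'; rewrite !lt_min => /andP[x1 x2] /andP[y1 y2]; split; first exact: h1.
by rewrite /= in_itv/= andbT; have := h2 w' x2 y2; rewrite ltr_distl; lra.
Qed.

Definition sqnorm (w : R * R) : R := w.1 ^+ 2 + w.2 ^+ 2.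

Definition plane_disc (a : R) : set (R * R) := [set w | sqnorm w < a].

Lemma measurable_sqnorm : measurable_fun setT sqnorm.
Proof.
by apply: measurable_funD; apply: measurable_funX; [exact: measurable_fst|exact: measurable_snd].
Qed.

Lemma sqnorm_preimage_measurable (A : set R) : measurable A -> measurable (sqnorm @^-1` A).
Proof. by move=> mA; rewrite -[X in measurable X]setTI; exact: measurable_sqnorm. Qed.

Lemma plane_disc_measurable a : measurable (plane_disc a).
Proof.
have -> : plane_disc a = sqnorm @^-1` `]-oo, a[%classic.
  by apply/seteqP; split=> w /=; rewrite in_itv.
by apply: sqnorm_preimage_measurable; exact: measurable_itv.
Qed.

(** Kept as an unevaluated positive number: it only enters multiplicative constants. *)
Definition disc_area : R := fine (leb2 (plane_disc 1)).

Let square (a : R) : set (R * R) := `]-a, a[%classic `*` `]-a, a[%classic.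

Let square_area (a : R) : 0 < a -> leb2 (square a) = ((2 * a) ^+ 2)%:E.
Proof.
move=> a0; have -> : leb2 (square a) = (leb `](- a)%R, a%R[%classic * leb `](- a)%R, a%R[%classic)%E.
  by apply: product_measure1E; exact: measurable_itv.
have -> : leb `]-a, a[%classic = (2 * a)%:E.
  rewrite lebesgue_measure_itv/= lte_fin ifT; last by lra.
  by rewrite -EFinB opprK -mulr2n mulr_natl.
by rewrite -EFinM.
Qed.

Let msquare a : measurable (square a).
Proof. by apply: measurableX; exact: measurable_itv. Qed.

Lemma disc_areaE : leb2 (plane_disc 1) = disc_area%:E.
Proof.
rewrite fineK// ge0_fin_numE//; apply: le_lt_trans (ltry ((2 * 1) ^+ 2)).
rewrite -square_area//; apply: le_measure; rewrite ?inE//;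
  [exact: plane_disc_measurable|exact: msquare|].
move=> [x y]; rewrite /plane_disc /sqnorm /square /= !in_itv/= => h.
have hx : x ^+ 2 < 1 by apply: le_lt_trans h; rewrite lerDl sqr_ge0.
have hy : y ^+ 2 < 1 by apply: le_lt_trans h; rewrite lerDr sqr_ge0.
have sq (u : R) : u ^+ 2 < 1 -> `|u| < 1.
  by rewrite -(ltr_pXn2r (_ : 0 < 2)%N (_ : `|u| \in Num.nneg))// ?nnegrE// expr1n real_normK ?num_real.
by rewrite -!ltr_norml; split; exact: sq.
Qed.

Lemma disc_area_gt0 : 0 < disc_area.
Proof.
rewrite -lte_fin -disc_areaE; apply: lt_le_trans (_ : (leb2 (square 2^-1) <= _)%E).
  by rewrite square_area// lte_fin exprn_gt0// mulr_gt0// invr_gt0.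
apply: le_measure; rewrite ?inE//; [exact: msquare|exact: plane_disc_measurable|].
move=> [x y]; rewrite /plane_disc /sqnorm /square /= !in_itv/= -!ltr_norml => -[hx hy].
have sq (u : R) : `|u| < 2^-1 -> u ^+ 2 < 2^-1.
  move=> hu; rewrite -real_normK ?num_real//; apply: le_lt_trans (_ : `|u| * 1 < _).
    by rewrite expr2 ler_wpM2l// (le_trans (ltW hu))// invf_le1// ler1n.
  by rewrite mulr1.
by have := sq _ hx; have := sq _ hy; lra.
Qed.

(** [a] is the squared radius, so scaling by its root makes the area linear in it. In other words
    |w|^2 is uniformly distributed on the disc. *)
Lemma plane_disc_area a : 0 <= a -> leb2 (plane_disc a) = (disc_area * a)%:E.
Proof.
rewrite le_eqVlt => /predU1P[<-|a0].
  rewrite mulr0 (_ : plane_disc 0 = set0) ?measure0//.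
  by apply/seteqP; split=> // w; rewrite /plane_disc /= ltNge addr_ge0 ?sqr_ge0.
have mi b : measurable_fun setT (fun w => (\1_(plane_disc b) w)%:E : \bar R).
  by apply/measurable_EFinP; apply: measurable_indic; exact: plane_disc_measurable.
have iE b : leb2 (plane_disc b) = (\int[leb2]_w (\1_(plane_disc b) w)%:E)%E.
  by rewrite integral_indic ?setIT//; exact: plane_disc_measurable.
have sa0 : 0 < Num.sqrt a by rewrite sqrtr_gt0.
rewrite iE (plane_scale sa0 (mi a)); last by move=> w; rewrite lee_fin.
rewrite sqr_sqrtr ?ltW// mulrC EFinM -disc_areaE iE; congr (_ * _)%E.
apply: eq_integral => w _; congr (_%:E); rewrite !indicE; congr (_%:R).
congr nat_of_bool; apply/idP/idP;
  rewrite !inE /plane_disc /sqnorm /= !exprMn -mulrDr sqr_sqrtr ?ltW//.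
  by rewrite -[X in _ < X]mulr1 ltr_pM2l.
by rewrite -[X in _ -> _ < X]mulr1 ltr_pM2l.
Qed.

Lemma plane_annulus_area a b : 0 <= a -> a <= b ->
  leb2 (sqnorm @^-1` `[a, b[%classic) = (disc_area * (b - a))%:E.
Proof.
move=> a0 ab; have -> : sqnorm @^-1` `[a, b[%classic = plane_disc b `\` plane_disc a.
  apply/seteqP; split=> w /=; rewrite in_itv/= /plane_disc /=.
    by move=> /andP[aw wb]; split => //; apply/negP; rewrite -leNgt.
  by move=> [-> /negP]; rewrite -leNgt andbT.
have -> : leb2 (plane_disc b `\` plane_disc a) =
    (leb2 (plane_disc b) - leb2 (plane_disc b `&` plane_disc a))%E.
  apply: measureD; [exact: plane_disc_measurable|exact: plane_disc_measurable|].
  rewrite [X in (X < _)%E](plane_disc_area (le_trans a0 ab)); exact: ltry.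
rewrite (_ : plane_disc b `&` plane_disc a = plane_disc a); last first.
  by apply/seteqP; split=> w //= [] // aw; split=> //; exact: lt_le_trans ab.
by rewrite !plane_disc_area ?(le_trans a0)// -EFinB -mulrBr.
Qed.

Local Open Scope ereal_scope.

(* The area measure is pushed forward by [1 - |w|^2] to a multiple of the
   Lebesgue measure of ]-oo, 1]; adding the Lebesgue measure of ]1, +oo[ allows
   to apply its uniqueness. *)
Lemma plane_radial_integral (psi : R -> \bar R) : measurable_fun setT psi ->
  (forall v, 0 <= psi v) ->
  \int[leb2]_(w in plane_disc 1) psi (1 - sqnorm w)%R =
  disc_area%:E * \int[leb]_(v in `]0%R, 1%R]) psi v.
Proof.
move=> mpsi psi0; pose V (w : R * R) := (1 - sqnorm w)%R.
have mV : measurable_fun setT (V : measurableTypeR R * measurableTypeR R -> measurableTypeR R).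
  by apply: measurable_funB => //; exact: measurable_sqnorm.
have k0 := disc_area_gt0.
have ki0 : (0 <= disc_area^-1)%R by rewrite invr_ge0 ltW.
pose push : {measure set (measurableTypeR R) -> \bar R} :=
  measure_function_pushforward__canonical__measure_function_Measure leb2 mV.
pose m1 : {measure set (measurableTypeR R) -> \bar R} := mscale (NngNum ki0) push.
have mI : measurable (`]1%R, +oo[%classic : set (measurableTypeR R)) by exact: measurable_itv.
pose m2 : {measure set (measurableTypeR R) -> \bar R} := mrestr leb mI.
pose nu : {measure set (measurableTypeR R) -> \bar R} := measure_add m1 m2.
have nuA A : nu A = m1 A + m2 A by exact: measure_addE.
have m1A A : m1 A = (disc_area^-1)%:E * leb2 (V @^-1` A) by [].
have m2A A : m2 A = leb (A `&` `]1%R, +oo[)%classic by [].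
have nuE A : measurable A -> leb A = nu A.
  apply: lebesgue_measure_unique => X [[c d] _ <-].
  rewrite [RHS]nuA m1A m2A /=.
  have [dc|cd] := leP d c.
    rewrite (_ : `]c, d]%classic = set0) ?set0I ?preimage_set0 ?measure0 ?mule0 ?adde0//.
    by apply/seteqP; split => // x /=; rewrite in_itv/= => /andP[cx xd];
      have := lt_le_trans cx (le_trans xd dc); rewrite ltxx.
  have prE : V @^-1` `]c, d]%classic = sqnorm @^-1` `[Num.max 0%R (1 - d)%R, Num.max 0%R (1 - c)%R[%classic.
    apply/seteqP; split=> w /=; rewrite !in_itv/= /V ge_max lt_max.
      by move=> /andP[h1 h2]; rewrite addr_ge0 ?sqr_ge0//=; apply/andP; split; [lra|apply/orP;
        right; lra].
    move=> /andP[/andP[w0 w1] /orP[]]; first by rewrite ltNge w0.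
    by move=> w2; apply/andP; split; lra.
  have -> : leb2 (V @^-1` `]c, d]%classic) = (disc_area * (Num.max 0 (1 - c) - Num.max 0 (1 - d)))%:E.
    have n0 : (0 <= Num.max 0 (1 - d))%R by rewrite le_max lexx.
    have nle : (Num.max 0 (1 - d) <= Num.max 0 (1 - c))%R.
      by rewrite ge_max !le_max lexx lerD2l lerN2 (ltW cd) orbT.
    by rewrite prE; exact: plane_annulus_area.
  rewrite -EFinM mulKf ?gt_eqF//.
  rewrite (_ : (`]c, d] `&` `]1%R, +oo[)%classic = `]Num.max c 1%R, d]%classic); last first.
    apply/seteqP; split=> x /=; rewrite !in_itv/= andbT gt_max.
      by move=> [/andP[-> ->] ->].
    by move=> /andP[/andP[-> ->] ->].
  rewrite !lebesgue_measure_itv/= !lte_fin cd gt_max cd /=.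
  case: ifPn => [d1|]; last rewrite -leNgt => d1.
    rewrite -!EFinB -EFinD; congr (_%:E).
    have -> : (Num.max 0 (1 - d) = 0)%R by apply: max_idPl; lra.
    have [c1|c1] := leP c 1%R.
      by rewrite (max_idPr _) ?(max_idPr c1); lra.
    by rewrite (max_idPl _) ?(max_idPl (ltW c1)); lra.
  rewrite -EFinB adde0; congr (_%:E).
  by rewrite !(max_idPr _); lra.
have mD : measurable (`]0%R, 1%R]%classic : set (measurableTypeR R)) by exact: measurable_itv.
have mpsi' : measurable_fun (`]0%R, 1%R]%classic : set (measurableTypeR R)) psi by exact: measurable_funTS.
have -> : \int[leb]_(v in `]0%R, 1%R]) psi v = \int[m1]_(v in `]0%R, 1%R]) psi v.
  apply: eq_measure_integral => A mA AD; rewrite [LHS]nuE// nuA -[RHS]adde0.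
  congr (_ + _); rewrite m2A (_ : A `&` _ = set0)%classic ?measure0//.
  apply/seteqP; split=> // x [/AD] /=; rewrite !in_itv/= andbT => /andP[_ x1].
  by rewrite ltNge x1.
rewrite ge0_integral_mscale// muleA -EFinM divff ?gt_eqF// mul1e.
rewrite ge0_integral_pushforward//.
rewrite (_ : plane_disc 1 = V @^-1` `]0%R, 1%R]%classic)//.
apply/seteqP; split=> w /=; rewrite in_itv/= /V /plane_disc /= subr_gt0 => h.
  by rewrite h lerBlDr lerDl addr_ge0 ?sqr_ge0.
by case/andP: h.
Qed.

End PlaneArea.

(** * The upper estimate in Bergman spaces *)

Section BergmanPolar.
Variable R : realType.
Notation leb := (@lebesgue_measure R).
Notation leb2 := (leb \x leb)%E.
Implicit Types (f : R[i] -> R[i]) (p beta : R) (w : R * R).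

Definition cplx w : R[i] := w.1 +i* w.2.

Lemma absc_cplx_sqr w : absc (cplx w) ^+ 2 = sqnorm w.
Proof. by rewrite absc_sqr. Qed.

Lemma unit_disc_plane : [set w | unit_disc (cplx w)] = plane_disc 1.
Proof.
apply/seteqP; split=> w; rewrite /plane_disc /unit_disc /= -absc_cplx_sqr.
  by rewrite expr_lt1 ?absc_ge0.
by rewrite expr_lt1 ?absc_ge0.
Qed.

(** The sign comes from the angle t - pi; because of it the circle integrals below start at
    [- cplx w]. *)
Lemma cplx_turn t w : cplx (turn t w) = - cplx w * eit t.
Proof.
by apply/eqP; rewrite eq_complex/=; apply/andP; split; apply/eqP; ring.
Qed.

Lemma absc_cplx_turn t w : absc (cplx (turn t w)) = absc (cplx w).
Proof. by rewrite cplx_turn abscM abscN absc_eit mulr1. Qed.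

Lemma plane_open_disc : plane_open (plane_disc (1 : R)).
Proof.
rewrite -unit_disc_plane => w; rewrite /= /unit_disc /= => w1.
exists ((1 - absc (cplx w)) / 2); first by rewrite divr_gt0// subr_gt0.
move=> w' h1 h2; rewrite -(subrK (cplx w) (cplx w')).
apply: le_lt_trans (abscD _ _) _; rewrite -ltrBrDr.
apply: le_lt_trans (absc_le _) _; rewrite ReB ImB /= (splitr (1 - _)).
exact: ltrD.
Qed.

Lemma plane_disc_open_measurable (g : R[i] -> R[i]) : holomorphic_disc g ->
  measurable_fun (plane_disc 1) (fun w => absc (g (cplx w))).
Proof.
move=> dg; apply: plane_continuous_measurable; first exact: plane_open_disc.
rewrite -unit_disc_plane => w /= Dw e e0.
have [d d0 hd] := cdiff_continuous (dg _ Dw) e0.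
exists (d / 2); first by rewrite divr_gt0.
move=> w' h1 h2; have ww : absc (cplx w' - cplx w) < d.
  by apply: le_lt_trans (absc_le _) _; rewrite ReB ImB /= (splitr d) ltrD.
have := hd _ ww; set a := g _; set b := g _ => ab.
apply: le_lt_trans ab; rewrite ler_norml; apply/andP; split.
  by rewrite lerNl opprB abscB; exact: ler_abscB.
exact: ler_abscB.
Qed.

Definition bergman_density p beta f w : R :=
  absc (f (cplx w)) `^ p * (1 - absc (cplx w) ^+ 2) `^ beta.

Lemma bergman_density_ge0 p beta f w : 0 <= bergman_density p beta f w.
Proof. by rewrite mulr_ge0 ?powR_ge0. Qed.

Lemma measurable_bergman_density p beta f : holomorphic_disc f ->
  measurable_fun (plane_disc 1) (bergman_density p beta f).
Proof.
move=> df; apply: measurable_funM.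
  exact: (measurableT_comp (measurable_powR _)) (plane_disc_open_measurable df).
apply: (measurableT_comp (measurable_powR _)).
rewrite (_ : (fun _ => _) = (fun w => 1 - sqnorm w)); last first.
  by apply/funext => w; rewrite absc_cplx_sqr.
by apply: measurable_funB => //; apply: measurable_funTS; exact: measurable_sqnorm.
Qed.

Lemma measurable_turn_average (F : R * R -> \bar R) : measurable_fun setT F ->
  (forall w, (0 <= F w)%E) ->
  measurable_fun setT (fun w => \int[leb]_(t in `[0%R, (2 * pi)%R]) F (turn t w))%E.
Proof.
move=> mF F0; pose D := `[0%R, (2 * pi)%R]%classic : set R.
pose H (wt : R * R * R) := (F (turn wt.2 wt.1) * (\1_D wt.2)%:E)%E.
have mH : measurable_fun setT H.
  apply: emeasurable_funM; last first.
    apply/measurable_EFinP; apply: (measurableT_comp _ measurable_snd).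
    by apply: measurable_indic; exact: measurable_itv.
  apply: (measurableT_comp mF).
  exact: (measurableT_comp (@measurable_turn R) (@measurable_swap _ _ _ _)).
have H0 wt : (0 <= H wt)%E by rewrite mule_ge0 ?lee_fin.
have := @measurable_fun_fubini_tonelli_F _ _ _ _ _ leb H mH H0.
congr (measurable_fun _ _); apply/funext => w; rewrite /fubini_F.
rewrite [RHS]integral_mkcond; apply: eq_integral => t _.
by rewrite /H /= epatch_indic.
Qed.

(** The disc and the weight are rotation invariant, so only |f|^p is averaged. *)
Lemma bergman_turn_average p beta f w : 1 <= p -> holomorphic_disc f ->
  (\int[leb]_(t in `[0%R, (2 * pi)%R])
     ((EFin \o bergman_density p beta f) \_ (plane_disc 1)) (turn t w) =
  ((fun w => ((1 - sqnorm w) `^ beta * circle_pint p f (- cplx w))%:E) \_ (plane_disc 1)) w)%E.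
Proof.
move=> p1 df; rewrite [RHS]patchE.
have turnD t : (turn t w \in plane_disc 1) = (w \in plane_disc 1).
  by apply/idP/idP; rewrite -unit_disc_plane !inE /= /unit_disc /= absc_cplx_turn.
case: ifPn => wD; last first.
  by rewrite [LHS]integral0_eq// => t _; rewrite patchE turnD (negbTE wD).
have w1 : absc (- cplx w) < 1.
  by move: wD; rewrite -unit_disc_plane inE /= /unit_disc /= abscN.
rewrite EFinM /circle_pint /segint /Rintegral fineK; last first.
  apply: integrable_fin_num => //; apply: seg_cont_integrable; exact: circle_pint_cont.
rewrite -ge0_integralZl_EFin//; last 3 first.
- by move=> t _; rewrite lee_fin powR_ge0.
- apply: measurable_int; apply: seg_cont_integrable; exact: circle_pint_cont.
- exact: powR_ge0.
apply: eq_integral => t _; rewrite patchE turnD wD /= -EFinM /bergman_density.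
by rewrite absc_cplx_turn absc_cplx_sqr cplx_turn mulrC.
Qed.

Lemma measurable_bergman_patch p beta f : holomorphic_disc f ->
  measurable_fun setT ((EFin \o bergman_density p beta f) \_ (plane_disc 1)).
Proof.
move=> df; apply: (proj1 (measurable_restrictT _ (plane_disc_measurable 1))).
by apply/measurable_EFinP; exact: measurable_bergman_density.
Qed.

Lemma bergman_patch_ge0 p beta f w :
  (0 <= ((EFin \o bergman_density p beta f) \_ (plane_disc 1)) w)%E.
Proof. by rewrite patchE; case: ifPn => // _; rewrite lee_fin bergman_density_ge0. Qed.

(** Measurability comes from Tonelli through the rotation average, with no regularity of the circle
    integral in its base point. *)
Lemma measurable_circle_pint p beta f : 1 <= p -> holomorphic_disc f ->
  measurable_fun (plane_disc 1)
    (fun w => ((1 - sqnorm w) `^ beta * circle_pint p f (- cplx w))%:E).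
Proof.
move=> p1 df; apply: (proj2 (measurable_restrictT _ (plane_disc_measurable 1))).
have := measurable_turn_average (measurable_bergman_patch p beta df)
  (@bergman_patch_ge0 p beta f).
by congr (measurable_fun _ _); apply/funext => w; exact: bergman_turn_average.
Qed.

Lemma bergman_polar p beta f : 1 <= p -> holomorphic_disc f ->
  ((2 * pi)%:E * \int[leb2]_(w in plane_disc 1) (bergman_density p beta f w)%:E =
  \int[leb2]_(w in plane_disc 1)
    ((1 - sqnorm w) `^ beta * circle_pint p f (- cplx w))%:E)%E.
Proof.
move=> p1 df; rewrite integral_mkcond.
rewrite (plane_rotation_average (measurable_bergman_patch p beta df) (@bergman_patch_ge0 p beta f)).
by rewrite [RHS]integral_mkcond; apply: eq_integral => w _; exact: bergman_turn_average.
Qed.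

Lemma bergman_normE p beta f : bergman_norm p beta f =
  (((pi^-1)%:E * \int[leb2]_(w in plane_disc 1) (bergman_density p beta f w)%:E) `^ p^-1)%E.
Proof. by rewrite -unit_disc_plane. Qed.

(** The weight is monotone: its minimum on [b, 2 b] sits at b for beta >= 0 and at 2 b for beta < 0,
    whence the minimum of 1 and 2^beta. *)
Lemma bergman_upper_arith (beta v b : R) : 0 < b -> b <= v <= 2 * b ->
  Num.min 1 (2 `^ beta) * b `^ beta <= v `^ beta.
Proof.
move=> b0 /andP[bv vb]; have v0 : 0 < v by exact: lt_le_trans bv.
have [be0|be0] := leP 0 beta.
  apply: (@le_trans _ _ (1 * b `^ beta)); first by rewrite ler_wpM2r ?powR_ge0// ge_min lexx.
  by rewrite mul1r ge0_ler_powR// nnegrE ltW.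
apply: (@le_trans _ _ (2 `^ beta * b `^ beta)).
  by rewrite ler_wpM2r ?powR_ge0// ge_min lexx orbT.
rewrite -powRM// ?(ltW b0)// -[beta]opprK !(powRN _ (- beta)) lef_pV2 ?posrE ?powR_gt0 ?mulr_gt0//.
by rewrite ge0_ler_powR// ?oppr_ge0 ?nnegrE ?ltW// mulr_gt0.
Qed.

(** 25 is the mean bound of the kernel; 512 = 32 * 16 combines its supremum 32 M with the annulus
    width 1/(16 M); the parenthesis holds the area constant and the least weight on the annulus, up
    to powers of M. *)
Definition bergman_const beta : R :=
  25 + 512 * pi / (disc_area R * (Num.min 1 (2 `^ beta) * 16 `^ (- beta))).

Lemma bergman_const_gt0 beta : 0 < bergman_const beta.
Proof.
have m0 : 0 < Num.min 1 (2 `^ beta) * 16 `^ (- beta) :> R.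
  by rewrite mulr_gt0 ?powR_gt0// lt_min ltr01 powR_gt0.
apply: ltr_pwDl (ltr0n _ 25) _; apply: divr_ge0.
  exact: mulr_ge0 (ler0n _ _) (ltW (pi_gt0 R)).
exact: mulr_ge0 (ltW (disc_area_gt0 R)) (ltW m0).
Qed.

Lemma bergman_upper p beta n r : 1 <= p -> 0 <= r < 1 ->
  (sup_calM n r (bergman_ball p beta) <=
    (bergman_const beta * (n.+1%:R / (1 - r)) `^ ((2 + beta) / p))%:E)%E.
Proof.
move=> p1 r01; have p0 : 0 < p by exact: lt_le_trans p1.
have /andP[r0 r1] := r01; move ME : (n.+1%:R / (1 - r)) => M.
have M1 : 1 <= M by rewrite -ME ler_pdivlMr ?subr_gt0// mul1r (@le_trans _ _ 1) ?ler1n//; lra.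
have M0 : 0 < M by exact: lt_le_trans M1.
set A := M `^ ((2 + beta) / p); have A0 : 0 < A by rewrite powR_gt0.
have pi0 := pi_gt0 R; have k0 := disc_area_gt0 R.
set c := Num.min 1 (2 `^ beta) * 16 `^ (- beta).
have c0 : 0 < c by rewrite mulr_gt0 ?powR_gt0// lt_min ltr01 powR_gt0.
have kc0 : 0 < disc_area R * c by rewrite mulr_gt0.
have BD : 0 <= 512 * pi / (disc_area R * c).
  exact: divr_ge0 (mulr_ge0 (ler0n _ _) (ltW pi0)) (ltW kc0).
have B0 := ltW (bergman_const_gt0 beta).
apply: sup_calM_le; first by rewrite mulr_ge0// ltW.
  by move=> f [].
move=> f h s T q x y [df bn] cT sr PT dh fqh x1 y1.
set X := complex.Re _.
have AM : A `^ (- p) = M `^ (- (2 + beta)).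
  by rewrite /A -powRrM mulrN divfK ?gt_eqF.
(* The circle estimate solved for the circle integral: a value [X] of the form forces at least [L]
   on every admissible circle. *)
pose L := (2 * pi * X / A - 50 * pi) / (32 * M * A `^ (- p)).
have d0 : 0 < 32 * M * A `^ (- p) by rewrite mulr_gt0 ?powR_gt0// mulr_gt0.
have HL z0 : 1 - (8 * M)^-1 <= absc z0 < 1 -> L <= circle_pint p f z0.
  move=> hz; have := calculus_estimate r01 p1 A0 cT sr PT df dh fqh x1 y1.
  rewrite ME => /(_ z0 hz) HX.
  rewrite /L ler_pdivrMr// lerBlDl ler_pdivrMr// [leRHS]mulrC.
  by rewrite [circle_pint _ _ _ * _]mulrC.
(* If [L] is not positive, the bound 25 A already holds. *)
have [L0|L0] := leP L 0.
  have : 2 * pi * X / A <= 50 * pi.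
    by move: L0; rewrite /L pmulr_lle0 ?invr_gt0// subr_le0.
  rewrite ler_pdivrMr// (_ : 50 * pi * A = 2 * pi * (25 * A)); last by ring.
  rewrite ler_pM2l ?mulr_gt0// => /le_trans; apply; rewrite ler_pM2r//.
  by rewrite /bergman_const lerDl; exact: BD.
(* On 1 - 2 b <= |w|^2 < 1 - b one has |w| >= |w|^2 >= 1 - 1/(8 M), so each such circle is
   admissible, while the weight base 1 - |w|^2 stays between b and 2 b. *)
pose b := (16 * M)^-1; have b0 : 0 < b by rewrite invr_gt0 mulr_gt0.
have b2 : 2 * b = (8 * M)^-1 by rewrite /b; field; rewrite gt_eqF.
have b21 : 2 * b <= 1.
  by rewrite b2 invf_le1 ?mulr_gt0//; lra.
pose Ann := (@sqnorm R) @^-1` `[1 - 2 * b, 1 - b[%classic.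
have mAnn : measurable Ann by apply: sqnorm_preimage_measurable; exact: measurable_itv.
have AnnD : Ann `<=` plane_disc 1.
  by move=> w; rewrite /Ann /plane_disc /= in_itv/= => /andP[_ h2]; lra.
have areaA : leb2 Ann = (disc_area R * b)%:E.
  by rewrite /Ann plane_annulus_area//; [congr (_%:E); ring|lra|lra].
pose g w := (1 - sqnorm w) `^ beta * circle_pint p f (- cplx w).
have Hint : (\int[leb2]_(w in plane_disc 1) (bergman_density p beta f w)%:E <= pi%:E)%E.
  move: bn; rewrite bergman_normE => /poweR_inv_le1; rewrite lee_pdivrMl// mule1; apply => //.
  apply: mule_ge0; first by rewrite lee_fin invr_ge0 (ltW pi0).
  by apply: integral_ge0 => w _; rewrite lee_fin bergman_density_ge0.
have gA w : Ann w -> Num.min 1 (2 `^ beta) * b `^ beta * L <= g w.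
  rewrite /Ann /= in_itv/= => /andP[h1 h2].
  have hv : b <= 1 - sqnorm w <= 2 * b by apply/andP; split; lra.
  apply: ler_pM; [|exact: ltW|exact: bergman_upper_arith|].
    by rewrite mulr_ge0 ?powR_ge0// le_min ler01 powR_ge0.
  apply: HL; rewrite abscN.
  have w1 : absc (cplx w) < 1.
    by have := AnnD w; rewrite -unit_disc_plane; apply; rewrite /Ann /= in_itv/= h1.
  rewrite w1 andbT -b2; apply: le_trans h1 _; rewrite -absc_cplx_sqr expr2.
  by rewrite ler_piMl ?absc_ge0// ltW.
have g0 w : plane_disc 1 w -> (0 <= (g w)%:E)%E.
  move=> _; rewrite lee_fin mulr_ge0 ?powR_ge0//.
  by apply: Rintegral_ge0 => t _; exact: powR_ge0.
have m0 : 0 <= Num.min 1 (2 `^ beta) * b `^ beta * L.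
  apply: mulr_ge0 (ltW L0); apply: mulr_ge0 (powR_ge0 _ _).
  by rewrite le_min ler01 powR_ge0.
have H1 : ((Num.min 1 (2 `^ beta) * b `^ beta * L * (disc_area R * b))%:E <=
    (2 * pi * pi)%:E)%E.
  apply: (@le_trans _ _ ((2 * pi)%:E * \int[leb2]_(w in plane_disc 1) (bergman_density p beta f w)%:E)%E); last first.
    rewrite [leRHS]EFinM; apply: lee_wpmul2l Hint.
    by rewrite lee_fin; exact: mulr_ge0 (ler0n _ _) (ltW pi0).
  rewrite bergman_polar// EFinM -areaA -integral_cst//.
  have mg := measurable_circle_pint beta p1 df.
  apply: (@le_trans _ _ (\int[leb2]_(w in Ann) (g w)%:E)%E).
    apply: ge0_le_integral => //.
    exact: measurable_funS (plane_disc_measurable 1) AnnD mg.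
  apply: ge0_subset_integral => //.
  exact: plane_disc_measurable.
have H2 : Num.min 1 (2 `^ beta) * b `^ beta * L * (disc_area R * b) =
    disc_area R * c * (2 * pi * X / A - 50 * pi) / 512.
  have -> : b `^ beta = 16 `^ (- beta) * M `^ (- beta).
    rewrite /b -powR_inv1; last exact: mulr_ge0 (ler0n _ _) (ltW M0).
    rewrite -powRrM mulN1r powRM ?(ltW M0)//.
  rewrite /L AM /b /c.
  have -> : M `^ (- (2 + beta)) = M `^ (- beta) / M ^+ 2.
    rewrite opprD addrC powRD; last by rewrite (gt_eqF M0) implybT.
    by rewrite (powRN _ 2) (powR_mulrn 2 (ltW M0)).
  have Mb : M `^ (- beta) != 0 by rewrite gt_eqF// powR_gt0.
  move: (16 `^ (- beta)) (M `^ (- beta)) Mb (2 * pi * X / A - 50 * pi) (Num.min 1 _) => u v v0 y0 m.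
  by field; rewrite v0 gt_eqF.
move: H1; rewrite lee_fin H2 (ler_pdivrMr _ _ (ltr0n _ 512)).
rewrite mulrC -(ler_pdivlMr _ _ kc0) lerBlDl (ler_pdivrMr _ _ A0) => H3.
rewrite -(ler_pM2l (mulr_gt0 (ltr0n _ 2) pi0)) (le_trans H3)//.
rewrite /bergman_const -/c; move: (disc_area R * c) (lt0r_neq0 kc0) => k kn0.
by apply: eq_ler; field.
Qed.

End BergmanPolar.

(** * The extremal matrix *)

Section ShiftMatrix.
Variables (F : fieldType) (n : nat).
Implicit Types (u : nat -> F) (r : F).

Definition shift_mx : 'M[F]_n.+1 := \matrix_(i, j) (i == j.+1 :> nat)%:R.

(** Vectors as truncations of sequences on [nat]: the shift then acts by [shift_fun], away from
    ordinals. *)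
Definition col_fun u : 'cV[F]_n.+1 := \col_i u i.

Definition shift_fun u (i : nat) : F := if i is j.+1 then u j else 0.

Lemma shift_col u : shift_mx *m col_fun u = col_fun (shift_fun u).
Proof.
apply/matrixP => i j; rewrite !mxE; case: i => [[|i] hi] /=.
  by rewrite big1// => k _; rewrite !mxE /= mul0r.
rewrite (bigD1 (Ordinal (ltnW hi)))//= !mxE eqxx mul1r big1 ?addr0// => k kne.
rewrite !mxE /= eqSS; case: eqP => [ik|]; last by rewrite mul0r.
by case/eqP: kne; apply: val_inj.
Qed.

Lemma col_fun_inord (x : 'cV[F]_n.+1) : x = col_fun (fun i => x (inord i) ord0).
Proof. by apply/matrixP => i j; rewrite ord1 mxE inord_val. Qed.

Lemma shift_expr_col m u : shift_mx ^+ m *m col_fun u = col_fun (iter m shift_fun u).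
Proof.
elim: m => [|m ih]; first by rewrite expr0 mul1mx.
by rewrite exprS -mulmxE -mulmxA ih shift_col.
Qed.

Lemma iter_shift_fun m u i :
  iter m shift_fun u i = if (i < m)%N then 0 else u (i - m)%N.
Proof.
elim: m u i => [|m ih] u i; first by rewrite subn0.
by case: i => [|i] //=; rewrite ih ltnS subSS.
Qed.

Lemma mx_eq0 (A : 'M[F]_n.+1) : (forall x : 'cV_n.+1, A *m x = 0) -> A = 0.
Proof.
move=> A0; apply/matrixP => i j; rewrite mxE.
by have /matrixP/(_ i ord0) := A0 (delta_mx j ord0); rewrite -colE !mxE.
Qed.

Lemma shift_nilp : shift_mx ^+ n.+1 = 0.
Proof.
apply: mx_eq0 => x; rewrite (col_fun_inord x) shift_expr_col.
by apply/matrixP => i j; rewrite !mxE iter_shift_fun ltn_ord.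
Qed.

Lemma shift_expr_neq0 : shift_mx ^+ n != 0.
Proof.
apply/eqP => E; have := shift_expr_col n (fun i => (i == 0)%:R).
rewrite E mul0mx => /matrixP/(_ ord_max ord0); rewrite !mxE iter_shift_fun/=.
by rewrite ltnn subnn eqxx => /eqP; rewrite eq_sym oner_eq0.
Qed.

Definition shift_den r : 'M[F]_n.+1 := 1 + r *: shift_mx.

(** The Neumann series, finite because the shift is nilpotent. *)
Definition shift_den_inv r : 'M[F]_n.+1 := \sum_(i < n.+1) (- (r *: shift_mx)) ^+ i.

Lemma shift_den_invl r : shift_den r * shift_den_inv r = 1.
Proof.
have := subrX1 (- (r *: shift_mx)) n.+1.
rewrite -scaleNr exprZn shift_nilp scaler0 sub0r => /(congr1 -%R).
by rewrite opprK -mulNr opprB scaleNr opprK => <-.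
Qed.

Lemma shift_den_invr r : shift_den_inv r * shift_den r = 1.
Proof. by apply: mulmx1C; exact: shift_den_invl. Qed.

Lemma shift_comm_den_inv r : GRing.comm shift_mx (shift_den_inv r).
Proof.
apply: commr_sum => i _; apply: commrX; apply: commrN.
by rewrite /GRing.comm -scalerAr -scalerAl.
Qed.

(* A single Blaschke factor at [-r] applied to the shift: a non-derogatory
   contraction with the single eigenvalue [r]. *)
Definition moebius_shift r : 'M[F]_n.+1 := (r%:A + shift_mx) * shift_den_inv r.

(** The difference is the shift times a commuting unit and a scalar; if 1 - r^2 is nonzero it is
    nilpotent of the same order as the shift. *)
Lemma moebius_shift_subr r :
  moebius_shift r - r%:A = (1 - r ^+ 2) *: (shift_mx * shift_den_inv r).
Proof.
rewrite /moebius_shift -{2}(shift_den_invl r) /shift_den.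
rewrite scalerAl -mulrBl scalerAl; congr (_ * _).
rewrite scalerDr scalerA opprD addrACA subrr add0r scalerBl scale1r expr2.
by [].
Qed.

Lemma moebius_shift_subr_expr r m : (moebius_shift r - r%:A) ^+ m =
  (1 - r ^+ 2) ^+ m *: (shift_mx ^+ m * shift_den_inv r ^+ m).
Proof.
by rewrite moebius_shift_subr exprZn exprMn_comm//; exact: shift_comm_den_inv.
Qed.

(** As a divisor of the right side the minimal polynomial is a power of X - r; a smaller exponent
    would annihilate the n-th power of the shift. *)
Lemma mxminpoly_moebius_shift r : 1 - r ^+ 2 != 0 ->
  mxminpoly (moebius_shift r) = ('X - r%:P) ^+ n.+1.
Proof.
move=> r2; have hX m : horner_mx (moebius_shift r) (('X - r%:P) ^+ m) =
    (moebius_shift r - r%:A) ^+ m.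
  by rewrite rmorphXn/= rmorphB/= horner_mx_X horner_mx_C scalemx1.
have /dvdp_exp_XsubCP[m mn] : mxminpoly (moebius_shift r) %| ('X - r%:P) ^+ n.+1.
  by rewrite dvd_mxminpoly hX moebius_shift_subr_expr shift_nilp mul0r scaler0.
rewrite eqp_monic ?mxminpoly_monic ?monic_exp ?monicXsubC// => /eqP E.
move: mn; rewrite leq_eqVlt => /orP[/eqP <-//|]; rewrite ltnS => mn.
have : horner_mx (moebius_shift r) (('X - r%:P) ^+ n) == 0.
  by rewrite -dvd_mxminpoly E dvdp_exp2l.
rewrite hX moebius_shift_subr_expr scaler_eq0 expf_eq0 (negbTE r2) andbF/= => /eqP Z.
case/eqP: shift_expr_neq0.
have UV : shift_den_inv r ^+ n * shift_den r ^+ n = 1.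
  rewrite -exprMn_comm ?shift_den_invr ?expr1n//.
  by rewrite /GRing.comm shift_den_invl shift_den_invr.
by rewrite -[LHS]mulr1 -UV mulrA Z mul0r.
Qed.

Lemma moebius_shift_den r : moebius_shift r * shift_den r = r%:A + shift_mx.
Proof. by rewrite -mulrA shift_den_invr mulr1. Qed.

Lemma comm_moebius_shift_den r : GRing.comm (moebius_shift r) (shift_den r).
Proof.
rewrite /GRing.comm moebius_shift_den /moebius_shift mulrA.
have C : GRing.comm (shift_den r) (r%:A + shift_mx).
  apply: commrD; first by rewrite /GRing.comm mulr_algl mulr_algr.
  apply: commr_sym; apply: commrD; first exact: commr1.
  by rewrite /GRing.comm -scalerAr -scalerAl.
by rewrite C -mulrA shift_den_invl mulr1.
Qed.

(* The factor [1 - t J] with [t = (s - r)/(1 - s r)], denominators cleared. *)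
Lemma moebius_shift_resolvent r s : (1 - s *: moebius_shift r) * shift_den r =
  (1 - s * r)%:A - (s - r) *: shift_mx.
Proof.
rewrite mulrBl mul1r -scalerAl moebius_shift_den /shift_den scalerDr !scalerBl scalerA.
rewrite opprD opprB scale1r [in RHS]addrACA.
by rewrite [in RHS]addrA -!addrA; congr (_ + _); rewrite addrCA; congr (_ + _); rewrite addrC.
Qed.

End ShiftMatrix.

(** * The functional calculus of kernel powers *)

Section InterpolationOfKernelPower.
Variable R : realType.
Implicit Types (F g : R[i] -> R[i]) (d q : {poly R[i]}) (l z : R[i]) (a s : R) (k : nat).

Lemma cdiff_punctured0 F l : cdiff F l -> absc l < 1 ->
  (forall z, absc z < 1 -> z != l -> F z = 0) -> F l = 0.
Proof.
move=> dF l1 F0; apply/eqP/negPn/negP; rewrite -absc_eq0 => Fl.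
have Fp : 0 < absc (F l) by rewrite lt_neqAle eq_sym Fl absc_ge0.
have [e e0 he] := cdiff_continuous dF Fp.
pose m := Num.min e (1 - absc l).
have m0 : 0 < m by rewrite lt_min e0 subr_gt0.
have m2 : m / 2 < m by rewrite ltr_pdivrMr// ltr_pMr// ltr1n.
have hm : absc ((m / 2)%:C) = m / 2 by rewrite absc_real ger0_norm// ltW// divr_gt0.
have wl : absc (l + (m / 2)%:C - l) < e.
  by rewrite addrC addKr hm (lt_le_trans m2)// ge_min lexx.
have := he _ wl; rewrite F0 ?sub0r ?abscN ?ltxx//.
  by rewrite (le_lt_trans (abscD _ _))// hm -ltrBrDl (lt_le_trans m2)// ge_min lexx orbT.
by rewrite -subr_eq0 addrC addKr -absc_eq0 hm gt_eqF// divr_gt0.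
Qed.

(** Formal divisibility from an analytic factorisation. The identity is asked only away from [l], so
    that it survives the cancellation of one factor z - l; at [l] continuity supplies the root. *)
Lemma dvdp_XsubC_expr_disc N d l g : absc l < 1 -> cdiff g l ->
  (forall z, absc z < 1 -> z != l -> d.[z] = (z - l) ^+ N * g z) ->
  ('X - l%:P) ^+ N %| d.
Proof.
move=> l1 dg; elim: N d => [|N ih] d H; first by rewrite expr0 dvd1p.
have dl : root d l.
  rewrite /root; apply/eqP.
  have := @cdiff_punctured0 (fun z => d.[z] - (z - l) ^+ N.+1 * g z) l _ l1.
  rewrite subrr expr0n mul0r subr0; apply.
    apply: cdiffB; first exact: cdiff_horner.
    apply: (cdiffM _ dg); apply: cdiffX; apply: cdiffB; [exact: cdiff_id|exact: cdiff_cst].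
  by move=> z z1 zl; rewrite H// subrr.
have /factor_theorem[d' E] := dl; rewrite E exprSr dvdp_mul// ih// => z z1 zl.
have := H z z1 zl; rewrite E hornerM hornerXsubC exprSr mulrC -mulrA mulrCA.
by apply: mulfI; rewrite subr_eq0.
Qed.

Definition kernel_power a s k z : R[i] := a%:C / (1 - s%:C * z) ^+ k.

Lemma kernel_den_neq0 s z : 0 <= s <= 1 -> absc z < 1 -> 1 - s%:C * z != 0.
Proof.
move=> /andP[s0 s1] z1; rewrite subr_eq0; apply/eqP => /(congr1 (@absc R)).
rewrite absc1 abscM absc_real ger0_norm// => E.
have : s * absc z <= absc z by rewrite ler_piMl ?absc_ge0.
by rewrite -E => /le_lt_trans/(_ z1); rewrite ltxx.
Qed.

Lemma cdiff_kernel_power a s k z : 0 <= s <= 1 -> absc z < 1 ->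
  cdiff (kernel_power a s k) z.
Proof.
move=> s01 z1; apply: cdiffM; first exact: cdiff_cst.
apply: cdiffV; first by rewrite expf_neq0// kernel_den_neq0.
apply: cdiffX; apply: cdiffB; first exact: cdiff_cst.
by apply: cdiffM; [exact: cdiff_cst|exact: cdiff_id].
Qed.

Definition kernel_poly s : {poly R[i]} := 1 - s%:C *: 'X.

Lemma horner_kernel_poly s z : (kernel_poly s).[z] = 1 - s%:C * z.
Proof. by rewrite /kernel_poly !hornerE. Qed.

Section Interpolation.
Variables (n N : nat) (T : 'M[R[i]]_n.+1) (l : R[i]).
Hypothesis mT : mxminpoly T = ('X - l%:P) ^+ N.
Hypothesis l1 : absc l < 1.

(** A Bezout relation u (X - l)^N + v (1 - s X)^k = 1 gives the interpolant a v and the quotient a u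
    / (1 - s z)^k. *)
Lemma kernel_power_interpolable a s k : 0 <= s <= 1 ->
  interpolants (kernel_power a s k) T !=set0.
Proof.
move=> s01; have : coprimep (('X - l%:P) ^+ N) (kernel_poly s ^+ k).
  apply: coprimep_expl; apply: coprimep_expr; rewrite coprimep_sym coprimep_XsubC.
  by rewrite /root horner_kernel_poly kernel_den_neq0.
move=> /Bezout_eq1_coprimepP[[u v] /= E].
exists (a%:C *: v), (fun z => a%:C * u.[z] / (1 - s%:C * z) ^+ k).
  move=> z z1; apply: cdiffM.
    by apply: cdiffM; [exact: cdiff_cst|exact: cdiff_horner].
  apply: cdiffV; first by rewrite expf_neq0// kernel_den_neq0.
  apply: cdiffX; apply: cdiffB; first exact: cdiff_cst.
  by apply: cdiffM; [exact: cdiff_cst|exact: cdiff_id].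
move=> z z1; rewrite mT /kernel_power hornerZ.
have := congr1 (horner^~ z) E; rewrite hornerD !hornerM [in (kernel_poly s ^+ k).[z]]horner_exp.
rewrite horner_kernel_poly hornerC; have : (1 - s%:C * z) ^+ k != 0.
  by rewrite expf_neq0// kernel_den_neq0.
move: (_ ^+ k) (u.[z]) (v.[z]) ((_ ^+ N).[z]) => w y x c w0 E1.
apply: (mulIf w0); rewrite mulrBl mulfVK// mulrA mulfVK//.
by rewrite -[X in X - _]mulr1 -E1; ring.
Qed.

(** Whichever interpolant q is picked by [xget], the minimal polynomial divides a - q (1 - s X)^k.
    The relation determines f(T) without computing q. *)
Lemma kernel_power_holo_mx a s k : 0 <= s <= 1 ->
  holo_mx (kernel_power a s k) T * (1 - s%:C *: T) ^+ k = a%:C%:A.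
Proof.
move=> s01; have := xgetPex 0 (kernel_power_interpolable a k s01).
rewrite /holo_mx; move: (xget _ _) => q [h dh E].
have : mxminpoly T %| a%:C%:P - q * kernel_poly s ^+ k.
  rewrite mT.
  apply: (@dvdp_XsubC_expr_disc _ _ _ (fun z => h z * (1 - s%:C * z) ^+ k)) => //.
    apply: cdiffM; first exact: dh.
    apply: cdiffX; apply: cdiffB; first exact: cdiff_cst.
    by apply: cdiffM; [exact: cdiff_cst|exact: cdiff_id].
  move=> z z1 _; rewrite hornerD hornerN hornerM horner_exp horner_kernel_poly hornerC.
  have := E z z1; rewrite mT horner_exp hornerXsubC mulrA => <-.
  by rewrite mulrBl mulfVK// expf_neq0// kernel_den_neq0.
rewrite dvd_mxminpoly rmorphB/= rmorphM/= rmorphXn/= rmorphB/= rmorph1 linearZ/=.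
by rewrite horner_mx_X horner_mx_C subr_eq0 scalemx1 => /eqP.
Qed.

End Interpolation.
End InterpolationOfKernelPower.

(** * Growth of binomial coefficients and their sums of squares *)

Lemma expn_leq_ffact i k : (i.+1 ^ k <= (i + k) ^_ k)%N.
Proof.
elim: k => [|k ih]; first by rewrite expn0 ffactn0.
by rewrite expnS addnS ffactSS leq_mul// ltnS leq_addr.
Qed.

Section BinomialSums.
Variable R : realFieldType.
Implicit Types (t : R) (k m : nat).

Lemma expr_mean_le (x y : R) m : 0 <= x -> 0 <= y ->
  ((x + y) / 2) ^+ m <= x ^+ m + y ^+ m.
Proof.
wlog xy : x y / x <= y => [H x0 y0|x0 y0].
  by have [xy|/ltW yx] := leP x y; [exact: H|rewrite addrC [leRHS]addrC; exact: H].
rewrite (@le_trans _ _ (y ^+ m))//; last by rewrite lerDr exprn_ge0.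
by apply: lerXn2r; rewrite ?nnegrE//; lra.
Qed.

(** Each summand is paired with its mirror image: the two bases add up to n + 1, so the larger one
    is at least n/2. *)
Lemma sum_expr_ge n m :
  n%:R * (n%:R / 2) ^+ m <= 2 * \sum_(i < n) (i.+1%:R : R) ^+ m.
Proof.
rewrite [leRHS]mulr_natl mulr2n [X in _ <= _ + X](reindex_inj rev_ord_inj)/= -big_split/=.
rewrite mulr_natl -[X in _ *+ X <= _]card_ord -sumr_const.
apply: ler_sum => i _; apply: le_trans (expr_mean_le _ (ler0n _ _) (ler0n _ _)).
apply: lerXn2r; rewrite ?nnegrE ?divr_ge0// ?addr_ge0//.
by rewrite ler_pM2r ?invr_gt0// -natrD ler_nat addnS subnKC// leqnSn.
Qed.

(** The Taylor coefficients of (1 - t x)^-(k+1). *)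
Definition neg_binom t k (i : nat) : R := 'C(i + k, k)%:R * t ^+ i.

Lemma neg_binom_ge0 t k i : 0 <= t -> 0 <= neg_binom t k i.
Proof. by move=> t0; rewrite mulr_ge0 ?ler0n ?exprn_ge0. Qed.

(** As t^i >= t^n >= 1/2 for i < n, the coefficients on the right are at least (i + 1)^k / (2 k!),
    whereas the sum on the left is at most n. *)
Lemma neg_binom_sum_ge t n k : 0 <= t -> t <= 1 -> 2^-1 <= t ^+ n ->
  (n%:R ^+ k / (4 * k`!%:R * 2 ^+ k)) ^+ 2 * \sum_(i < n) neg_binom t 0 i ^+ 2 <=
  \sum_(i < n) neg_binom t k i ^+ 2.
Proof.
move=> t0 t1 tn; have kf : 0 < (k`!%:R : R) by rewrite ltr0n fact_gt0.
have H0 : \sum_(i < n) neg_binom t 0 i ^+ 2 <= n%:R.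
  rewrite -[X in _ <= X%:R]card_ord -sumr_const; apply: ler_sum => i _.
  rewrite expr_le1// ?neg_binom_ge0// /neg_binom bin0 mul1r.
  by rewrite exprn_ile1.
have H1 : \sum_(i < n) (i.+1%:R ^+ (k * 2)) / (2 * k`!%:R) ^+ 2 <=
    \sum_(i < n) neg_binom t k i ^+ 2.
  apply: ler_sum => i _; rewrite exprM -expr_div_n; apply: lerXn2r; rewrite ?nnegrE.
  - by rewrite divr_ge0 ?exprn_ge0 ?mulr_ge0 ?ler0n.
  - exact: neg_binom_ge0.
  rewrite invfM mulrCA.
  rewrite /neg_binom [leRHS]mulrC; apply: ler_pM.
  - by rewrite invr_ge0.
  - by rewrite divr_ge0 ?exprn_ge0 ?ler0n.
  - apply: le_trans tn _; apply: ler_wiXn2l => //; exact: ltnW.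
  by rewrite ler_pdivrMr// -natrX -natrM bin_ffact ler_nat expn_leq_ffact.
apply: le_trans H1; rewrite -mulr_suml.
have H2 := sum_expr_ge n (k * 2).
set S := \sum_(i < n) _ in H2 *.
apply: (@le_trans _ _ ((n%:R ^+ k / (4 * k`!%:R * 2 ^+ k)) ^+ 2 * n%:R)).
  by rewrite ler_wpM2l// sqr_ge0.
rewrite ler_pdivlMr ?exprn_gt0 ?mulr_gt0//.
move: H2; rewrite exprM expr_div_n.
have p2 : 0 < (2 : R) ^+ k by rewrite exprn_gt0.
move: S => S.
have -> : (n%:R ^+ k / (4 * k`!%:R * 2 ^+ k)) ^+ 2 * n%:R * (2 * k`!%:R) ^+ 2 =
  4^-1 * (n%:R * (n%:R ^+ k / 2 ^+ k) ^+ 2) :> R.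
  by field; rewrite !gt_eqF.
have : 0 <= n%:R * (n%:R ^+ k / 2 ^+ k) ^+ 2 :> R by rewrite mulr_ge0 ?sqr_ge0.
move: (n%:R * _) => Z; lra.
Qed.

End BinomialSums.

Section ShiftBinomial.
Variables (F : fieldType) (n : nat).

(** Pascal's rule: the factor 1 - t J lowers the order of the negative binomial series by one,
    truncation included. *)
Lemma shift_neg_binom (c t : F) k :
  (c%:A - (c * t) *: shift_mx F n) *m col_fun n (fun i => 'C(i + k.+1, k.+1)%:R * t ^+ i) =
  c *: col_fun n (fun i => 'C(i + k, k)%:R * t ^+ i).
Proof.
rewrite mulmxBl -!scalemxAl mul1mx shift_col.
apply/matrixP => i j; rewrite !mxE /shift_fun; case: (nat_of_ord i) => [|m].
  by rewrite !add0n !binn mulr0 subr0.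
by rewrite addSn [(m + k.+1)%N]addnS binS natrD -addnS [(m.+1 + k)%N]addSnnS exprS; ring.
Qed.

Lemma shift_neg_binom_expr (c t : F) k :
  (c%:A - (c * t) *: shift_mx F n) ^+ k *m col_fun n (fun i => 'C(i + k, k)%:R * t ^+ i) =
  c ^+ k *: col_fun n (fun i => 'C(i + 0, 0)%:R * t ^+ i).
Proof.
elim: k => [|k ih]; first by rewrite !expr0 mul1mx scale1r.
rewrite exprSr -mulmxE -mulmxA shift_neg_binom -scalemxAr ih scalerA exprS.
by [].
Qed.

End ShiftBinomial.

Lemma bernoulli_expr (R : realFieldType) (t : R) n : 0 <= t -> t <= 1 ->
  1 - n%:R * (1 - t) <= t ^+ n.
Proof.
move=> t0 t1; elim: n => [|n ih]; first by rewrite mul0r subr0 expr0.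
rewrite exprS (le_trans _ (ler_wpM2l t0 ih))//.
have n0 : 0 <= n%:R :> R by rewrite ler0n.
rewrite -natr1 -subr_ge0; have := mulr_ge0 n0 (sqr_ge0 (1 - t)).
by congr (0 <= _); ring.
Qed.

(** * Lower estimates *)

Section LowerBound.
Variable R : realType.
Implicit Types (u : nat -> R) (r s a t : R) (k : nat).

Section ShiftNorms.
Variable n : nat.

Definition real_col u : 'cV[R[i]]_n.+1 := col_fun n (fun i => (u i)%:C).

Lemma l2norm_real_col u : l2norm (real_col u) ^+ 2 = \sum_(i < n.+1) u i ^+ 2.
Proof.
rewrite l2norm_sqr; apply: eq_bigr => i _.
by rewrite mxE absc_real real_normK// num_real.
Qed.

Lemma ler_l2norm_real_col u v : (forall i, 0 <= u i <= v i) ->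
  l2norm (real_col u) <= l2norm (real_col v).
Proof.
move=> uv; rewrite -(ler_pXn2r (_ : 0 < 2)%N)// ?nnegrE ?l2norm_ge0//.
rewrite !l2norm_real_col; apply: ler_sum => i _.
have /andP[u0 uvi] := uv i; apply: lerXn2r => //; rewrite nnegrE//.
exact: le_trans uvi.
Qed.

Lemma l2norm_shift x : l2norm (shift_mx R[i] n *m x) <= l2norm x.
Proof.
rewrite -(ler_pXn2r (_ : 0 < 2)%N)// ?nnegrE ?l2norm_ge0//.
rewrite (col_fun_inord x) shift_col !l2norm_sqr.
rewrite big_ord_recl [leRHS]big_ord_recr/= !mxE/= absc0 expr0n add0r.
rewrite (eq_bigr (fun i : 'I_n => absc (x (inord i) ord0) ^+ 2)); last first.
  by move=> i _; rewrite !mxE.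
rewrite [X in _ <= X + _](eq_bigr (fun i : 'I_n => absc (x (inord i) ord0) ^+ 2)).
  by rewrite lerDl sqr_ge0.
by move=> i _; rewrite !mxE.
Qed.

(** With y = (1 + r J)^-1 x the claim is |(r + J) y| <= |(1 + r J) y|, the Blaschke inequality of
    the shift at the point -r. *)
Lemma moebius_shift_contraction r : 0 <= r <= 1 ->
  contractions (moebius_shift n r%:C).
Proof.
move=> /andP[r0 r1]; apply/contractionP => x.
have E : x = shift_den n r%:C *m (shift_den_inv n r%:C *m x).
  by rewrite mulmxA mulmxE shift_den_invl mul1mx.
move: (shift_den_inv _ _ *m x) E => y ->; rewrite mulmxA mulmxE moebius_shift_den.
have l1 : absc (- r%:C) <= 1 by rewrite abscN absc_real ger0_norm.
have lc : (- r%:C)^* = - r%:C :> R[i] by rewrite rmorphN/= conj_Creal// complex_real.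
have := mobius_contraction l2norm_shift y l1; rewrite lc.
rewrite /shift_den !mulmxDl -!scalemxAl mul1mx !scaleNr !opprK.
by rewrite [_ + r%:C *: y]addrC.
Qed.

(** For nonnegative r and nonnegative entries the factor 1 + r J only increases entries; this
    disposes of the denominator of T in the lower bound. *)
Lemma shift_den_real_col r k u : 0 <= r -> (forall i, 0 <= u i) ->
  l2norm (real_col u) <= l2norm (shift_den n r%:C ^+ k *m real_col u).
Proof.
move=> r0 u0.
suff [v [uv ->]] : exists v, (forall i, u i <= v i) /\
    shift_den n r%:C ^+ k *m real_col u = real_col v.
  by apply: ler_l2norm_real_col => i; rewrite u0 uv.
elim: k => [|k [v [uv E]]]; first by exists u; split=> //; rewrite expr0 mul1mx.
exists (fun i => v i + r * shift_fun v i); split=> [i|].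
  apply: le_trans (uv i) _; rewrite lerDl mulr_ge0//; case: i => //= i.
  exact: le_trans (u0 i) (uv i).
rewrite exprS -mulmxE -mulmxA E /shift_den mulmxDl mul1mx -scalemxAl shift_col.
apply/matrixP => i j; rewrite !mxE rmorphD rmorphM; congr (_ + _ * _).
by rewrite /shift_fun; case: (nat_of_ord i).
Qed.

Lemma real_col_neg_binom t k :
  real_col (neg_binom t k) = col_fun n (fun i => 'C(i + k, k)%:R * t%:C ^+ i).
Proof.
by apply/matrixP => i l; rewrite !mxE /neg_binom rmorphM/= rmorphXn/= rmorph_nat.
Qed.

Lemma moebius_shift_resolvent_neg_binom r s t k : (1 - s * r) * t = s - r ->
  (1 - s%:C *: moebius_shift n r%:C) ^+ k *m
    (shift_den n r%:C ^+ k *m real_col (neg_binom t k)) =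
  (1 - s * r)%:C ^+ k *: real_col (neg_binom t 0).
Proof.
move=> ct.
have C : GRing.comm (1 - s%:C *: moebius_shift n r%:C) (shift_den n r%:C).
  apply: commr_sym; apply: commrB; first exact: commr1.
  by rewrite /GRing.comm -scalerAr -scalerAl comm_moebius_shift_den.
have E : (1 - s%:C *: moebius_shift n r%:C) * shift_den n r%:C =
    (1 - s * r)%:C%:A - ((1 - s * r)%:C * t%:C) *: shift_mx R[i] n.
  have ctC : (1 - s * r)%:C * t%:C = s%:C - r%:C by rewrite -rmorphM ct rmorphB.
  by rewrite moebius_shift_resolvent ctC rmorphB rmorphM rmorph1.
rewrite mulmxA mulmxE -(exprMn_comm k C) E !real_col_neg_binom.
exact: shift_neg_binom_expr.
Qed.

End ShiftNorms.

(** 4 k! 2^k comes from the binomial sums, a further 2^k from 1 - s r <= 2 (1 - r). *)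
Definition lower_const k : R := (4 * k`!%:R * 4 ^+ k)^-1.

Lemma lower_const_gt0 k : 0 < lower_const k.
Proof. by rewrite invr_gt0 mulr_gt0 ?exprn_gt0 ?mulr_gt0 ?ltr0n ?fact_gt0. Qed.

Definition peak_radius n r : R := 1 - (1 - r) / (4 * n.+1%:R).

Lemma opnorm_moebius_shift_ge n r k a (Q : 'M[R[i]]_n.+1) :
  0 <= r < 1 -> 0 <= a ->
  Q * (1 - (peak_radius n r)%:C *: moebius_shift n r%:C) ^+ k = a%:C%:A ->
  a * lower_const k * (n.+1%:R / (1 - r)) ^+ k <= opnorm Q.
Proof.
move=> /andP[r0 r1] a0; set s := peak_radius n r; set T := moebius_shift _ _ => QE.
have N1 : 1 <= n.+1%:R :> R by rewrite ler1n.
have N0 : 0 < n.+1%:R :> R by rewrite ltr0n.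
have r1' : 0 < 1 - r by rewrite subr_gt0.
have s1E : 1 - s = (1 - r) / (4 * n.+1%:R) by rewrite /s /peak_radius subKr.
have s1 : 0 <= 1 - s by rewrite s1E divr_ge0// ?(ltW r1')// mulr_ge0.
have s1r : 1 - s <= 1 - r.
  by rewrite s1E ler_pdivrMr ?mulr_gt0// ler_peMr ?(ltW r1')//; lra.
have s0 : 0 <= s by lra.
have c1 : 1 - r <= 1 - s * r by nra.
have c2 : 1 - s * r <= 2 * (1 - r) by nra.
have c0 : 0 < 1 - s * r by exact: lt_le_trans c1.
pose t := (s - r) / (1 - s * r).
have t0 : 0 <= t by rewrite divr_ge0 ?(ltW c0)//; lra.
have t1E : 1 - t = (1 - s) * (1 + r) / (1 - s * r) by rewrite /t; field; rewrite gt_eqF.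
have t1 : 0 <= 1 - t.
  by rewrite t1E divr_ge0 ?(ltW c0)// mulr_ge0//; lra.
(* Bernoulli's inequality, with N = n + 1: N (1 - t) = (1 - r) (1 + r) / (4 (1 - s r)) is at most
   1/2 because 1 - s r >= 1 - r. *)
have tN : 2^-1 <= t ^+ n.+1.
  apply: le_trans (bernoulli_expr _ t0 _); last by lra.
  suff : n.+1%:R * (1 - t) <= 2^-1 by lra.
  rewrite t1E s1E mulrA ler_pdivrMr//.
  have -> : n.+1%:R * ((1 - r) / (4 * n.+1%:R) * (1 + r)) = (1 - r) * (1 + r) / 4.
    by field; rewrite gt_eqF.
  nra.
pose y j := real_col n (neg_binom t j).
have xE : (1 - s%:C *: T) ^+ k *m (shift_den n r%:C ^+ k *m y k) =
    (1 - s * r)%:C ^+ k *: y 0.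
  by apply: moebius_shift_resolvent_neg_binom; rewrite /t mulrC divfK// gt_eqF.
have QyE : Q *m ((1 - s * r)%:C ^+ k *: y 0) = a%:C *: (shift_den n r%:C ^+ k *m y k).
  by rewrite -xE mulmxA mulmxE QE -scalemxAl mul1mx.
have y0 : 0 < l2norm (y 0).
  rewrite lt_neqAle l2norm_ge0 andbT eq_sym; apply/eqP => /(l2norm_eq0).
  move/matrixP/(_ ord0 ord0); rewrite !mxE /neg_binom bin0 mul1r expr0 => /eqP.
  by rewrite oner_eq0.
have yk : n.+1%:R ^+ k / (4 * k`!%:R * 2 ^+ k) * l2norm (y 0) <= l2norm (y k).
  rewrite -(ler_pXn2r (_ : 0 < 2)%N)// ?nnegrE ?l2norm_ge0//; last first.
    by rewrite mulr_ge0 ?l2norm_ge0// divr_ge0 ?exprn_ge0// ?mulr_ge0 ?exprn_ge0 ?ler0n.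
  rewrite exprMn !l2norm_real_col neg_binom_sum_ge//; lra.
have := l2norm_mulmx_le Q ((1 - s * r)%:C ^+ k *: y 0).
rewrite QyE !l2normZ abscX !absc_real ger0_norm// ger0_norm ?(ltW c0)// => H.
have kn := shift_den_real_col n k r0 (fun i => neg_binom_ge0 k i t0).
have {H} : a * (n.+1%:R ^+ k / (4 * k`!%:R * 2 ^+ k)) <= opnorm Q * (1 - s * r) ^+ k.
  have := le_trans (ler_wpM2l a0 (le_trans yk kn)) H.
  by rewrite [leLHS]mulrA [leRHS]mulrA ler_pM2r.
move=> H.
have oQ : 0 <= opnorm Q.
  apply: contraT; rewrite -ltNge => o0; have := le_lt_trans H _ => /(_ 0).
  rewrite pmulr_llt0 ?exprn_gt0// => /(_ o0); rewrite ltNge.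
  by rewrite mulr_ge0// divr_ge0 ?exprn_ge0// ?mulr_ge0 ?exprn_ge0 ?ler0n.
have {}H : a * (n.+1%:R ^+ k / (4 * k`!%:R * 2 ^+ k)) <= opnorm Q * (2 * (1 - r)) ^+ k.
  apply: le_trans H _; apply: ler_wpM2l => //; apply: lerXn2r; rewrite ?nnegrE ?(ltW c0)//.
  by rewrite mulr_ge0// ltW.
rewrite -(ler_pM2r (_ : 0 < (2 * (1 - r)) ^+ k)) ?exprn_gt0 ?mulr_gt0//.
apply: le_trans H; apply: eq_ler; rewrite /lower_const expr_div_n exprMn.
have -> : (4 : R) ^+ k = 2 ^+ k * 2 ^+ k by rewrite -exprMn; congr (_ ^+ _); ring.
by field; rewrite !gt_eqF ?exprn_gt0// ltr0n fact_gt0.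
Qed.

Lemma sup_calM_ge n r k a (B : set (R[i] -> R[i])) : 0 <= r < 1 -> 0 <= a ->
  B (kernel_power a (peak_radius n r) k) ->
  ((a * lower_const k * (n.+1%:R / (1 - r)) ^+ k)%:E <= sup_calM n r B)%E.
Proof.
move=> r01 a0 Bf; have /andP[r0 r1] := r01.
pose f := kernel_power a (peak_radius n r) k.
pose sg : n.+1.-tuple R[i] := [tuple r%:C | _ < n.+1].
have rr : absc r%:C = r by rewrite absc_real ger0_norm.
have mT : mxminpoly (moebius_shift n r%:C) = ('X - r%:C%:P) ^+ n.+1.
  apply: mxminpoly_moebius_shift; rewrite subr_eq0 -rmorphXn/=.
  apply/eqP => /(congr1 (@complex.Re R))/= E.
  have : r ^+ 2 < 1 by rewrite expr_lt1.
  by rewrite -E ltxx.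
have l1 : absc r%:C < 1 by rewrite rr.
have s01 : 0 <= peak_radius n r <= 1.
  have N1 : 1 <= n.+1%:R :> R by rewrite ler1n.
  rewrite /peak_radius subr_ge0 gerBl ler_pdivrMr ?mulr_gt0// divr_ge0 ?andbT ?mulr_ge0//.
    lra.
  lra.
apply: (@le_trans _ _ (calM f sg)); last first.
  apply: ereal_sup_ubound; exists f => //; exists sg => //.
  by move=> l /mapP[i _ ->]; rewrite /unit_disc /= rr.
apply: (@le_trans _ _ (opnorm (holo_mx f (moebius_shift n r%:C)))%:E); last first.
  apply: ereal_sup_ubound; exists (moebius_shift n r%:C) => //; split.
    by apply: moebius_shift_contraction; rewrite r0 ltW.
  rewrite mT /poly_of_zeros big_tuple; under [RHS]eq_bigr do rewrite tnth_mktuple.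
  by rewrite big_const_ord iter_mulr_1.
rewrite lee_fin; apply: opnorm_moebius_shift_ge => //.
by apply: (kernel_power_holo_mx mT l1).
Qed.

End LowerBound.

(** * Kernel powers on circles *)

Section KernelNorms.
Variable R : realType.
Notation leb := (@lebesgue_measure R).
Notation leb2 := (leb \x leb)%E.
Implicit Types (w z : R[i]) (p beta a s c e : R) (k : nat).

Lemma powR_antimono c x e : 0 < c -> c <= x -> e <= 0 -> x `^ e <= c `^ e.
Proof.
move=> c0 cx e0; have x0 : 0 < x by exact: lt_le_trans cx.
rewrite -[e]opprK ![_ `^ (- - e)]powRN lef_pV2 ?posrE ?powR_gt0//.
by apply: ge0_ler_powR; rewrite ?oppr_ge0 ?nnegrE ?(ltW c0) ?(ltW x0).
Qed.

Lemma powRVM x e : 0 < x -> x `^ (- e) * x `^ e = 1.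
Proof. by move=> x0; rewrite powRN mulVf// gt_eqF ?powR_gt0. Qed.

Lemma Re_cayley w : 1 - w != 0 ->
  complex.Re ((1 + w) / (1 - w)) = (1 - absc w ^+ 2) / absc (1 - w) ^+ 2.
Proof.
rewrite -absc_eq0 => w1; have : absc (1 - w) ^+ 2 != 0 by rewrite expf_neq0.
rewrite !absc_sqr; case: w w1 => x y _ /=; rewrite !sub0r sqrrN => h.
by field.
Qed.

Lemma cdiff_cayley z : absc z < 1 -> cdiff (fun w => (1 + w) / (1 - w)) z.
Proof.
move=> z1; apply: cdiffM; first by apply: cdiffD; [exact: cdiff_cst|exact: cdiff_id].
apply: cdiffV; last by apply: cdiffB; [exact: cdiff_cst|exact: cdiff_id].
by have := @kernel_den_neq0 _ 1 _ _ z1; rewrite mul1r; apply; rewrite ler01 lexx.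
Qed.

Lemma absc_1B_ge z : 1 - absc z <= absc (1 - z).
Proof. by have := ler_abscB 1 z; rewrite absc1. Qed.

Lemma absc_mul_eit z t : absc (z * eit t) = absc z.
Proof. by rewrite abscM absc_eit mulr1. Qed.

Lemma seg_cont_kernel z : absc z < 1 ->
  seg_cont (fun t => absc (1 - z * eit t) ^- 2) 0 (2 * pi).
Proof.
move=> z1 t _.
have d0 : 1 - z * eit t != 0.
  by rewrite -absc_eq0 gt_eqF// (lt_le_trans _ (absc_1B_ge _))// absc_mul_eit subr_gt0.
rewrite (_ : (fun _ => _) = (fun t => absc ((1 - z * eit t)^-1 ^+ 2))); last first.
  by apply/funext => u; rewrite abscX abscV exprVn.
apply: ccont_absc; apply: (ccont_comp (g := fun w => (1 - w)^-1 ^+ 2)).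
  apply: cdiffX; apply: cdiffV => //.
  by apply: cdiffB; [exact: cdiff_cst|exact: cdiff_id].
exact: ccont_circle.
Qed.

(** The Poisson kernel is the real part of the holomorphic (1 + w) / (1 - w), whose value at 0 is
    1. *)
Lemma poisson_circle z : absc z < 1 ->
  (1 - absc z ^+ 2) * segint (fun t => absc (1 - z * eit t) ^- 2) 0 (2 * pi) = 2 * pi.
Proof.
move=> z1; rewrite -segintZ; last exact: seg_cont_kernel.
have := mean_value cdiff_cayley z1.
have -> : complex.Re ((1 + 0) / (1 - 0) : R[i]) = 1 by rewrite addr0 subr0 divr1.
rewrite [RHS]mulr1 => E; apply: etrans E; apply: eq_segint => t _.
by rewrite Re_cayley ?absc_mul_eit// -absc_eq0 gt_eqF// (lt_le_trans _ (absc_1B_ge _))//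
  absc_mul_eit subr_gt0.
Qed.

Lemma kernel_power_absc a s k p z : 0 <= a -> 0 <= s <= 1 -> absc z < 1 ->
  absc (kernel_power a s k z) `^ p = a `^ p * absc (1 - s%:C * z) `^ (- (k%:R * p)).
Proof.
move=> a0 s01 z1; rewrite /kernel_power abscM abscV abscX absc_real ger0_norm//.
rewrite powRM ?invr_ge0 ?exprn_ge0 ?absc_ge0//; congr (_ * _).
rewrite -powR_mulrn ?absc_ge0// -powRN -powRrM; congr (_ `^ _); ring.
Qed.

(** Two powers of the modulus are kept for the Poisson kernel; the remaining exponent 2 - k p is
    nonpositive by hypothesis, so that part is bounded pointwise by its value at the nearest point 1
    - |w|. *)
Lemma kernel_power_circle p a s k z : 0 <= a -> 0 <= s <= 1 -> absc z < 1 ->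
  1 <= p -> 2 <= k%:R * p ->
  circle_pint p (kernel_power a s k) z <=
    2 * pi * a `^ p * (1 - s * absc z) `^ (1 - k%:R * p).
Proof.
move=> a0 s01 z1 p1 kp; have /andP[s0 s1] := s01.
set w := s%:C * z; have wE : absc w = s * absc z.
  by rewrite abscM absc_real ger0_norm.
have w1 : absc w < 1.
  by rewrite wE; apply: le_lt_trans z1; rewrite ler_piMl ?absc_ge0.
rewrite -wE; have c0 : 0 < 1 - absc w by rewrite subr_gt0.
have sq : 1 - absc w <= 1 - absc w ^+ 2.
  by rewrite lerD2l lerN2 expr2 ler_piMl ?absc_ge0// ltW.
set I := segint (fun t => absc (1 - w * eit t) ^- 2) 0 (2 * pi).
have PI : (1 - absc w) * I <= 2 * pi.
  rewrite -(poisson_circle w1); apply: ler_wpM2r sq.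
  by apply: Rintegral_ge0 => t _; rewrite invr_ge0 sqr_ge0.
set c := (1 - absc w) `^ (2 - k%:R * p).
have cE : (1 - absc w) `^ (1 - k%:R * p) = c / (1 - absc w).
  rewrite /c -[_^-1]powR_inv1 ?(ltW c0)// -powRD ?(gt_eqF c0) ?implybT//.
  by congr (_ `^ _); ring.
apply: (@le_trans _ _ (segint (fun t => a `^ p * c * absc (1 - w * eit t) ^- 2) 0 (2 * pi))).
  apply: le_segint.
  - by apply: circle_pint_cont => // u u1; exact: cdiff_kernel_power.
  - by move=> t h; apply: continuousM; [exact: cvg_cst|exact: seg_cont_kernel h].
  move=> t _; rewrite kernel_power_absc ?absc_mul_eit// mulrA -/w -mulrA.
  apply: ler_wpM2l; first exact: powR_ge0.
  have D0 : 1 - absc w <= absc (1 - w * eit t).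
    by apply: le_trans (absc_1B_ge _); rewrite absc_mul_eit.
  have Dp : 0 < absc (1 - w * eit t) by exact: lt_le_trans D0.
  rewrite -[X in X ^- 2]powRr1 ?(ltW Dp)// -powR_mulrn ?powR_ge0// -powRrM mul1r -powRN.
  rewrite (_ : - (k%:R * p) = (2 - k%:R * p) + - 2); last by ring.
  rewrite powRD ?(gt_eqF Dp) ?implybT//; apply: ler_wpM2r; first exact: powR_ge0.
  by apply: powR_antimono => //; rewrite subr_le0.
rewrite segintZ; last exact: seg_cont_kernel.
have Id : I <= 2 * pi / (1 - absc w) by rewrite ler_pdivlMr// mulrC.
have ac : 0 <= a `^ p * c by rewrite mulr_ge0 ?powR_ge0.
by apply: le_trans (ler_wpM2l ac Id) _; rewrite cE; apply: eq_ler; ring.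
Qed.

End KernelNorms.

(** * The radial integral *)

Section RadialWeight.
Variable R : realType.
Notation leb := (@lebesgue_measure R).
Variables (beta d : R).
Hypotheses (b1 : -1 < beta) (d0 : 0 < d).

(** The exponent -(2 + beta) is the one for which v^beta has the elementary primitive (v / (d +
    v))^(1 + beta) / ((1 + beta) d). *)
Definition radial_weight (v : R) : R := v `^ beta * (d + v) `^ (- (2 + beta)).

Definition radial_primitive (v : R) : R :=
  ((1 + beta) * d)^-1 * (v `^ (1 + beta) * (d + v) `^ (- (1 + beta))).

Lemma is_derive_shifted_powR (e v : R) : 0 < d + v ->
  is_derive v 1 (fun x : R => (d + x) `^ e) (e * (d + v) `^ (e - 1)).
Proof.
move=> dv; have h : is_derive v 1 (fun x : R => d + x) 1.
  exact: is_derive_eq (is_deriveD (is_derive_cst d v 1) (is_derive_id v 1)) (add0r 1).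
have h2 := is_derive1_powR e dv.
by apply: is_derive_eq (is_derive1_comp (f := fun x => x `^ e) h2 h) _; rewrite mulr1.
Qed.

Lemma is_derive_radial_primitive (v : R) : 0 < v ->
  is_derive v 1 radial_primitive (radial_weight v).
Proof.
move=> v0; have dv0 : 0 < d + v by rewrite addr_gt0.
have h1 := is_derive1_powR (1 + beta) v0.
have h2 := is_derive_shifted_powR (- (1 + beta)) dv0.
have h3 := is_deriveM h1 h2.
have h4 := is_deriveZ ((1 + beta) * d)^-1 h3.
apply: is_derive_eq h4 _.
have -> : 1 + beta - 1 = beta by ring.
have -> : - (1 + beta) - 1 = - (2 + beta) by ring.
rewrite /radial_weight /GRing.scale /=.
have -> : v `^ (1 + beta) = v * v `^ beta.
  by rewrite powRD ?(gt_eqF v0) ?implybT// powRr1 ?ltW.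
have -> : (d + v) `^ (- (1 + beta)) = (d + v) * (d + v) `^ (- (2 + beta)).
  rewrite -{2}[d + v]powRr1 ?(ltW dv0)// -powRD ?(gt_eqF dv0) ?implybT//.
  by congr (_ `^ _); ring.
have e1 : 1 + beta != 0 by rewrite gt_eqF// -ltrBlDl sub0r.
by field; rewrite e1 (gt_eqF d0).
Qed.

Lemma radial_weight_ge0 v : 0 <= radial_weight v.
Proof. by rewrite mulr_ge0 ?powR_ge0. Qed.

Lemma measurable_radial_weight : measurable_fun setT radial_weight.
Proof.
apply: measurable_funM; first exact: measurable_powR.
apply: (measurableT_comp (measurable_powR _)).
by apply: measurable_funD => //; exact: measurable_cst.
Qed.

Lemma is_derive_continuous (f : R -> R) (x df : R) :
  is_derive x 1 f df -> {for x, continuous f}.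
Proof. by move=> [h _]; apply/differentiable_continuous/derivable1_diffP. Qed.

Lemma radial_weight_continuous (v : R) : 0 < v -> {for v, continuous radial_weight}.
Proof.
move=> v0; have dv0 : 0 < d + v by rewrite addr_gt0.
apply: continuousM; apply: is_derive_continuous.
  exact: is_derive1_powR.
exact: is_derive_shifted_powR.
Qed.

Lemma radial_weight_integral_seg (e : R) : 0 < e < 1 ->
  (\int[leb]_(v in `[e, 1%R]) (radial_weight v)%:E <= (((1 + beta) * d)^-1)%:E)%E.
Proof.
move=> /andP[e0 e1]; have b0 : 0 < 1 + beta by rewrite -ltrBlDl sub0r.
have c0 : 0 <= ((1 + beta) * d)^-1 by rewrite invr_ge0 mulr_ge0// ltW.
rewrite (@continuous_FTC2 R radial_weight radial_primitive)//; first last.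
- move=> v; rewrite in_itv/= => /andP[ev _].
  have [_ <-] := is_derive_radial_primitive (lt_trans e0 ev).
  by rewrite derive1E.
- split.
  + move=> v; rewrite in_itv/= => /andP[ev _].
    by have [] := is_derive_radial_primitive (lt_trans e0 ev).
  + apply: cvg_at_right_filter.
    exact: is_derive_continuous (is_derive_radial_primitive e0).
  + apply: cvg_at_left_filter.
    exact: is_derive_continuous (is_derive_radial_primitive ltr01).
- apply: continuous_subspace_itv => v; rewrite in_itv/= => /andP[ev _].
  exact: radial_weight_continuous (lt_le_trans e0 ev).
rewrite -EFinB lee_fin lerBlDr (le_trans (y := ((1 + beta) * d)^-1))//.
  rewrite /radial_primitive powR1 mul1r ler_piMr//.
  rewrite powRN invf_le1 ?powR_gt0 ?addr_gt0//.
  by rewrite -[leLHS](powRr0 (d + 1)) ler_powR ?(ltW b0)// lerDr ltW.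
by rewrite lerDl mulr_ge0// mulr_ge0 ?powR_ge0.
Qed.

(** For beta < 0 the weight is unbounded at 0, so the primitive is used on [1/(i+2), 1] and the
    bound, uniform in i, passes to the limit by monotone convergence. *)
Lemma radial_weight_integral :
  (\int[leb]_(v in `]0%R, 1%R]) (radial_weight v)%:E <= (((1 + beta) * d)^-1)%:E)%E.
Proof.
pose F (i : nat) := `[(i.+2%:R^-1 : R), 1]%classic.
have -> : `]0%R, 1%R]%classic = \bigcup_i F i.
  apply/seteqP; split=> [v|v [i _]]; rewrite /F /= !in_itv/=.
    move=> /andP[v0 v1]; exists (Num.truncn v^-1) => //=; rewrite in_itv/= v1 andbT.
    rewrite -[v in _ <= v]invrK lef_pV2 ?posrE ?invr_gt0//.
    have := truncnS_gt v^-1; move/ltW/le_trans; apply; rewrite ler_nat.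
    exact: leqnSn.
  by move=> /andP[iv ->]; rewrite andbT (lt_le_trans _ iv)// invr_gt0 ltr0n.
have mw A : measurable_fun A (EFin \o radial_weight).
  by apply/measurable_EFinP; apply: measurable_funTS; exact: measurable_radial_weight.
have ndF : nondecreasing_seq F.
  apply/nondecreasing_seqP => i; rewrite subsetEset => v; rewrite /F /= !in_itv/=.
  move=> /andP[iv ->]; rewrite andbT (le_trans _ iv)// lef_pV2 ?posrE ?ltr0n//.
  by rewrite ler_nat.
have F0 i v : F i v -> (0 <= (radial_weight v)%:E)%E by rewrite lee_fin radial_weight_ge0.
have h : (\int[leb]_(v in F i) (radial_weight v)%:E @[i --> \oo] -->
    \int[leb]_(v in \bigcup_i F i) (radial_weight v)%:E)%E.
  apply: ge0_nondecreasing_set_cvg_integral => //; first by move=> i; exact: measurable_itv.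
  by move=> i; exact: mw.
rewrite -(cvg_lim _ h)//; apply: lime_le; first by apply/cvg_ex; eexists; exact: h.
apply: nearW => i; apply: radial_weight_integral_seg.
by rewrite invr_gt0 ltr0n invf_lt1 ?ltr0n// ltr1n.
Qed.

End RadialWeight.

(** * Normalised kernel powers and the lower bounds *)

Section LowerBoundNorms.
Variable R : realType.
Notation leb := (@lebesgue_measure R).
Notation leb2 := (leb \x leb)%E.
Implicit Types (p beta d r : R) (k n : nat).

(** The amplitude is chosen so that its p-th power d^(k p - 1) cancels the growth d^(1 - k p) of the
    circle integrals. *)
Lemma kernel_power_hardy_ball p k d : 1 <= p -> 2 <= k%:R * p -> 0 < d <= 1 ->
  hardy_ball p (kernel_power (d `^ (k%:R - 1 / p)) (1 - d) k).
Proof.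
move=> p1 kp /andP[d0 d1]; have p0 : 0 < p by exact: lt_le_trans p1.
set a := d `^ _; have a0 : 0 <= a by exact: powR_ge0.
have s01 : 0 <= 1 - d <= 1 by apply/andP; split; lra.
have hf : holomorphic_disc (kernel_power a (1 - d) k).
  by move=> z z1; exact: cdiff_kernel_power.
split=> //; apply: ge_ereal_sup => x /= [s]; rewrite in_itv/= => s1 <-{x}.
rewrite hardy_circle_integral//; have /andP[s0 s1'] := s1.
have pp : 0 < 2 * pi :> R by rewrite mulr_gt0 ?pi_gt0.
apply: poweR_inv_ge1 => //.
  rewrite -EFinM lee_fin mulr_ge0 ?invr_ge0 ?(ltW pp)//.
  by apply: Rintegral_ge0 => t _; exact: powR_ge0.
rewrite -EFinM lee_fin ler_pdivrMl// mulr1.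
have as1 : absc s%:C < 1 by rewrite absc_real ger0_norm.
apply: le_trans (kernel_power_circle a0 s01 as1 p1 kp) _.
rewrite -mulrA ler_piMr ?(ltW pp)// /a -powRrM absc_real ger0_norm//.
have -> : (k%:R - 1 / p) * p = - (1 - k%:R * p) by field; rewrite gt_eqF.
rewrite -[leRHS](powRVM (1 - k%:R * p) d0); apply: ler_wpM2l; first exact: powR_ge0.
apply: powR_antimono => //; last lra.
have : (1 - d) * s <= 1 - d by rewrite ler_piMr ?(ltW s1')//; lra.
lra.
Qed.

(** The balance of powers: the amplitude d^(k - e) with d = 1/(4 M) against the growth M^k of the
    matrix leaves M^e. *)
Lemma powR_inv4M (M e : R) k : 0 < M ->
  (4 * M)^-1 `^ (k%:R - e) * M ^+ k = 4 `^ (e - k%:R) * M `^ e.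
Proof.
move=> M0; rewrite -powR_inv1; last exact: mulr_ge0 (ler0n _ _) (ltW M0).
rewrite -powRrM mulN1r opprB powRM ?ler0n ?(ltW M0)// -mulrA; congr (_ * _).
rewrite -powR_mulrn ?(ltW M0)// -powRD ?(gt_eqF M0) ?implybT//.
by rewrite subrK.
Qed.

Lemma peak_radiusE n r : 0 <= r < 1 -> exists2 d, 0 < d <= 1 &
  peak_radius n r = 1 - d /\ d = (4 * (n.+1%:R / (1 - r)))^-1.
Proof.
move=> /andP[r0 r1]; have N1 : 1 <= n.+1%:R :> R by rewrite ler1n.
have r1' : 0 < 1 - r by rewrite subr_gt0.
have N0 : 0 < 4 * n.+1%:R :> R by exact: mulr_gt0 (ltr0n _ 4) (ltr0n _ n.+1).
exists ((1 - r) / (4 * n.+1%:R)).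
  by rewrite divr_gt0// ler_pdivrMr//; lra.
by split=> //; rewrite mulrA invf_div.
Qed.

Lemma hardy_lower p n r : 1 <= p -> 0 <= r < 1 ->
  ((lower_const R 2 * 4 `^ (1 / p - 2) * (n.+1%:R / (1 - r)) `^ (1 / p))%:E
    <= sup_calM n r (hardy_ball p))%E.
Proof.
move=> p1 r01; have [d d01 [sE dE]] := peak_radiusE n r01.
have M0 : 0 < n.+1%:R / (1 - r) by case/andP: r01 => _ r1; rewrite divr_gt0 ?subr_gt0.
(* The exponent k = 2 serves for every p >= 1. *)
have kp : 2 <= 2%:R * p by rewrite ler_peMr.
have a0 : 0 <= d `^ (2%:R - 1 / p) by exact: powR_ge0.
have := @kernel_power_hardy_ball p 2 d p1 kp d01; rewrite -sE.
move=> /(sup_calM_ge r01 a0); apply: le_trans; rewrite lee_fin; apply: eq_ler.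
by rewrite -mulrA -(powR_inv4M (1 / p) 2 M0) -dE mulrA [lower_const _ _ * _]mulrC.
Qed.

(** Normalisation that turns the final bound of the Bergman integral into exactly pi: the power of 3
    is lost in comparing the kernel with the radial weight, the rest comes from the radial
    integral. *)
Definition bergman_scale p beta k : R :=
  pi * (1 + beta) / (disc_area R * 3 `^ (k%:R * p - 1)).

Lemma bergman_scale_gt0 p beta k : -1 < beta -> 0 < bergman_scale p beta k.
Proof.
move=> b1; have b0 : 0 < 1 + beta by rewrite -ltrBlDl sub0r.
by rewrite divr_gt0 ?mulr_gt0 ?pi_gt0 ?disc_area_gt0 ?powR_gt0.
Qed.

(** The base on the left is at least (d + 1 - x^2) / 3. Of its exponent, -(2 + beta) is kept for the
    radial weight; the rest, 3 + beta - q <= 0, is estimated by replacing d + 1 - x^2 by d. *)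
Lemma kernel_weight_le beta (q d x : R) : -1 < beta -> 3 + beta <= q -> 0 < d <= 1 ->
  0 <= x < 1 ->
  (1 - (1 - d) * x) `^ (1 - q) <=
  3 `^ (q - 1) * d `^ (3 + beta - q) * (d + (1 - x ^+ 2)) `^ (- (2 + beta)).
Proof.
move=> b1 q3 /andP[d0 d1] /andP[x0 x1].
have v0 : 0 < 1 - x ^+ 2 by rewrite subr_gt0 expr_lt1.
set v := 1 - x ^+ 2 in v0 *; have D0 : 0 < d + v by rewrite addr_gt0.
have h : (d + v) / 3 <= 1 - (1 - d) * x.
  have : 0 <= d * x by rewrite mulr_ge0// ltW.
  have : d * x <= x by rewrite ler_piMl.
  have : 0 <= (1 - x) ^+ 2 by exact: sqr_ge0.
  have : d * x <= d by rewrite ler_piMr// ltW.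
  rewrite /v ler_pdivrMr// expr2 => *; nra.
apply: (@le_trans _ _ (((d + v) / 3) `^ (1 - q))).
  by apply: powR_antimono h _; [rewrite divr_gt0|lra].
rewrite powRM ?invr_ge0 ?(ltW D0)// -[3^-1]powR_inv1// -powRrM.
have -> : -1 * (1 - q) = q - 1 by ring.
rewrite mulrC -mulrA; apply: ler_wpM2l; first exact: powR_ge0.
have -> : 1 - q = (3 + beta - q) + - (2 + beta) by ring.
rewrite powRD ?(gt_eqF D0) ?implybT//; apply: ler_wpM2r; first exact: powR_ge0.
by apply: powR_antimono => //; lra.
Qed.

Lemma kernel_power_bergman_ball p beta k d : 1 <= p -> -1 < beta ->
  3 + beta <= k%:R * p -> 0 < d <= 1 ->
  bergman_ball p beta (kernel_power
    (bergman_scale p beta k `^ (1 / p) * d `^ (k%:R - (2 + beta) / p)) (1 - d) k).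
Proof.
move=> p1 b1 kp d01; have /andP[d0 d1] := d01; have p0 : 0 < p by exact: lt_le_trans p1.
have b0 : 0 < 1 + beta by rewrite -ltrBlDl sub0r.
have kp2 : 2 <= k%:R * p by lra.
have K0 := bergman_scale_gt0 p k b1; set K := bergman_scale _ _ _ in K0 *.
set a := _ * _; have a0 : 0 <= a by rewrite mulr_ge0 ?powR_ge0.
have s01 : 0 <= 1 - d <= 1 by apply/andP; split; lra.
have hf : holomorphic_disc (kernel_power a (1 - d) k).
  by move=> z z1; exact: cdiff_kernel_power.
have ap : a `^ p = K * d `^ (k%:R * p - (2 + beta)).
  rewrite /a powRM ?powR_ge0// -!powRrM; congr (_ * _ `^ _).
    by rewrite mul1r mulVf ?gt_eqF// powRr1 ?ltW.
  by field; rewrite gt_eqF.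
have pi0 := pi_gt0 R; have kc0 := disc_area_gt0 R.
split=> //; rewrite bergman_normE; set I := integral _ _ _.
have I0 : (0 <= I)%E by apply: integral_ge0 => w _; rewrite lee_fin bergman_density_ge0.
suff : ((2 * pi)%:E * I <= (2 * pi * pi)%:E)%E.
  rewrite [leRHS]EFinM lee_pmul2l// ?lte_fin ?mulr_gt0// => Ipi.
  apply: poweR_inv_ge1 => //; first by rewrite mule_ge0// lee_fin invr_ge0 ltW.
  by rewrite lee_pdivrMl// mule1.
rewrite /I bergman_polar//.
pose c := 2 * pi * a `^ p * (3 `^ (k%:R * p - 1) * d `^ (3 + beta - k%:R * p)).
have c0 : 0 <= c by rewrite !mulr_ge0 ?powR_ge0 ?(ltW pi0).
apply: (@le_trans _ _ (\int[leb2]_(w in plane_disc 1)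
    (c%:E * (radial_weight beta d (1 - sqnorm w))%:E))%E).
  apply: ge0_le_integral.
  - exact: plane_disc_measurable.
  - move=> w _; rewrite lee_fin mulr_ge0 ?powR_ge0//.
    by apply: Rintegral_ge0 => t _; exact: powR_ge0.
  - exact: measurable_circle_pint.
  - apply: measurable_funTS; apply/measurable_EFinP; apply: measurable_funM => //.
    apply: (measurableT_comp (measurable_radial_weight beta d)).
    by apply: measurable_funB => //; exact: measurable_sqnorm.
  move=> w; rewrite -unit_disc_plane /= /unit_disc /= => w1.
  rewrite -EFinM lee_fin /radial_weight mulrCA; apply: ler_wpM2l; first exact: powR_ge0.
  have w1' : absc (- cplx w) < 1 by rewrite abscN.
  apply: le_trans (kernel_power_circle a0 s01 w1' p1 kp2) _.
  rewrite /c -[leRHS]mulrA; apply: ler_wpM2l; first by rewrite !mulr_ge0 ?powR_ge0 ?(ltW pi0).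
  rewrite abscN -absc_cplx_sqr; apply: kernel_weight_le => //.
  by rewrite absc_ge0.
rewrite (plane_radial_integral (psi := fun v => (c%:E * (radial_weight beta d v)%:E)%E));
  last 2 first.
- apply/measurable_EFinP; apply: measurable_funM => //; exact: measurable_radial_weight.
- by move=> v; rewrite -EFinM lee_fin mulr_ge0// radial_weight_ge0.
rewrite ge0_integralZl_EFin//; last 2 first.
- by move=> v _; rewrite lee_fin radial_weight_ge0.
- apply/measurable_EFinP; apply: measurable_funTS; exact: measurable_radial_weight.
apply: (@le_trans _ _ ((disc_area R)%:E * (c%:E * (((1 + beta) * d)^-1)%:E))%E).
  apply: lee_wpmul2l; first by rewrite lee_fin ltW.
  apply: lee_wpmul2l; first by rewrite lee_fin.
  exact: radial_weight_integral.
rewrite -!EFinM lee_fin; apply: eq_ler; rewrite /c ap.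
have -> : d `^ (3 + beta - k%:R * p) = d * d `^ (- (k%:R * p - (2 + beta))).
  rewrite -{2}[d]powRr1 ?(ltW d0)// -powRD ?(gt_eqF d0) ?implybT//.
  by congr (_ `^ _); ring.
have := powRVM (k%:R * p - (2 + beta)) d0.
have t0 : 3 `^ (k%:R * p - 1) != 0 :> R by rewrite gt_eqF// powR_gt0.
rewrite /K /bergman_scale; move: (d `^ _) (d `^ (- _)) (3 `^ _) t0 => x y t t0 yx.
have -> : disc_area R * (2 * pi * (pi * (1 + beta) / (disc_area R * t) * x) * (t * (d * y)) *
   ((1 + beta) * d)^-1) = 2 * pi * pi * (y * x).
  by field; rewrite (gt_eqF kc0) (gt_eqF b0) (gt_eqF d0) t0.
by rewrite yx mulr1.
Qed.

Lemma bergman_lower p beta k n r : 1 <= p -> -1 < beta -> 3 + beta <= k%:R * p ->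
  0 <= r < 1 ->
  ((bergman_scale p beta k `^ (1 / p) * lower_const R k * 4 `^ ((2 + beta) / p - k%:R) *
    (n.+1%:R / (1 - r)) `^ ((2 + beta) / p))%:E <= sup_calM n r (bergman_ball p beta))%E.
Proof.
move=> p1 b1 kp r01; have [d d01 [sE dE]] := peak_radiusE n r01.
have M0 : 0 < n.+1%:R / (1 - r) by case/andP: r01 => _ r1; rewrite divr_gt0 ?subr_gt0.
set K := bergman_scale _ _ _.
have a0 : 0 <= K `^ (1 / p) * d `^ (k%:R - (2 + beta) / p) by rewrite mulr_ge0 ?powR_ge0.
have := kernel_power_bergman_ball p1 b1 kp d01; rewrite -sE -/K.
move=> /(sup_calM_ge r01 a0); apply: le_trans; rewrite lee_fin; apply: eq_ler.
rewrite -mulrA -(powR_inv4M ((2 + beta) / p) k M0) -dE.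
by ring.
Qed.

End LowerBoundNorms.

Theorem corollary2p2 (R : realType) (p : R) (hp : 1 <= p) :
  (exists c1 c2 : R, [/\ 0 < c1, 0 < c2 &
     forall (n : nat) (r : R), 0 <= r < 1 ->
       ((c1 * (n.+1%:R / (1 - r)) `^ (1 / p))%:E
          <= sup_calM n r (hardy_ball p))%E /\
       (sup_calM n r (hardy_ball p)
          <= (c2 * (n.+1%:R / (1 - r)) `^ (1 / p))%:E)%E])
  /\
  (forall beta : R, -1 < beta ->
   exists c1 c2 : R, [/\ 0 < c1, 0 < c2 &
     forall (n : nat) (r : R), 0 <= r < 1 ->
       ((c1 * (n.+1%:R / (1 - r)) `^ ((2 + beta) / p))%:E
          <= sup_calM n r (bergman_ball p beta))%E /\
       (sup_calM n r (bergman_ball p beta)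
          <= (c2 * (n.+1%:R / (1 - r)) `^ ((2 + beta) / p))%:E)%E]).
Proof.
split=> [|beta b1].
  exists (lower_const R 2 * 4 `^ (1 / p - 2)), 57; split; last first.
  - by move=> n r r01; split; [exact: hardy_lower|exact: hardy_upper].
  - exact: ltr0n.
  - by rewrite mulr_gt0 ?lower_const_gt0 ?powR_gt0.
(* An integer above 3 + beta, so k p >= 3 + beta as p >= 1; it depends on beta alone, which keeps
   the constants free of n and r. *)
pose k := (Num.truncn (3 + beta)).+1.
have kp : 3 + beta <= k%:R * p.
  by apply: le_trans (ltW (truncnS_gt _)) _; rewrite ler_peMr ?ler0n.
exists (bergman_scale p beta k `^ (1 / p) * lower_const R k *
  4 `^ ((2 + beta) / p - k%:R)), (bergman_const beta); split; last first.
- by move=> n r r01; split; [exact: bergman_lower|exact: bergman_upper].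
- exact: bergman_const_gt0.
- by rewrite !mulr_gt0 ?lower_const_gt0 ?powR_gt0 ?bergman_scale_gt0.
Qed.
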